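(* For every $\gamma>0$ there is a constant $K$, depending on $\gamma$ only, such that the following holds. Let $(\Omega,\mu)$ be a probability space, $N\ge1$, $P=\mu^N$ on $\Omega^N$, let $h:\Omega\times\Omega\to[0,\infty)$ be measurable with $h(\omega,\omega)=0$ for all $\omega\in\Omega$, and let $\psi$ be a convex function on $\mathbb R$ with $\psi(0)=0$, $\psi(x)\le x^2$ for $0\le x\le1$, and $\psi(x)\ge x$ for $x\ge1$. Let $\theta$, with inverse function $\xi$, be as in the context, and assume that $$|\xi'(b+1)|\ge\gamma|\xi'(b)|\quad\text{for all } b\ge0,\qquad |\theta'(1)|\ge\gamma .$$ Let $w\ge 0$ be a nonincreasing function on $]0,1]$ with $w\le\theta$, $w(1/2)\ge\gamma$, $\int_0^1w^2\,d\lambda\le1$, and assume that condition $H(\xi,w)$ holds. Assume that for each subset $B$ of $\Omega$ we have $$0<\mu(B)\le\tfrac12\ \Rightarrow\ \int_\Omega\exp\psi(h(x,B))\,d\mu(x)\le\exp w(\mu(B)),$$ $$\mu(B)\ge\tfrac12,\ t\ge1\ \Rightarrow\ \mu(\{x:\psi(h(x,B))\ge t\})\le e^{-t}(1-\mu(B)).$$ Then, for each subset $A$ of $\Omega^N$, $$\int_{\Omega^N}\exp\Big(\frac1K f_{h,\psi}(A,x)\Big)\,dP(x)\le\exp\theta(P(A)).$$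
   Context: Functions $\theta,\xi$: $\theta$ is a convex decreasing function from $]0,1]$ to $\mathbb R^+$ with $\theta(1)=0$ and $\lim_{x\to0}\theta(x)=\infty$ (so $\theta(0)=+\infty$ by convention), and $\xi:\mathbb R^+\to]0,1]$ is the inverse function of $\theta$ (convex, $\xi(0)=1$). It is assumed that $\xi''$ is decreasing and that $\xi''(b)\le|\xi'(b)|$ for all $b>0$. Condition $H(\xi,w)$: with $x^+=\max(x,0)$, and for $x\in\mathbb R$, $b\ge0$, $$\Xi(x,b)=\xi(x^+)-\xi(b)-(x^+-b)\xi'(b),$$ the condition $H(\xi,w)$ is that for all $b\ge0$ and all $0\le t\le1$, $$\int_0^1\Xi(b-tw(u),b)\,d\lambda(u)\le t^2|\xi'(b)|,$$ where $\lambda$ is Lebesgue measure on $[0,1]$. For $B\subset\Omega$, $h(x,B)=\inf\{h(x,y):y\in B\}$. For $A\subset\Omega^N$ and $x\in\Omega^N$ let $$U_A(x)=\{(s_i)_{i\le N}\in\mathbb R_+^N : \exists y\in A,\ \forall i\le N,\ s_i\ge h(x_i,y_i)\},$$ let $V_A(x)$ be the convex hull of $U_A(x)$, and $$f_{h,\psi}(A,x)=\inf\Big\{\sum_{i\le N}\psi(s_i): s=(s_i)_{i\le N}\in V_A(x)\Big\}.$$ Measurability convention: all sets and functions are treated as if they were measurable (otherwise integrals are upper integrals and probabilities of exceptional sets are outer probabilities). *)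

(* Defs.v *)
From HB Require Import structures.
From mathcomp Require Import all_boot all_order all_algebra.
From mathcomp Require Import all_classical all_reals all_analysis.
From mathcomp Require Import measurable_realfun.

Set Implicit Arguments.
Unset Strict Implicit.
Unset Printing Implicit Defensive.

Import Order.TTheory GRing.Theory Num.Theory.
Import numFieldNormedType.Exports.

Local Open Scope classical_set_scope.
Local Open Scope ring_scope.

(** Derivative of a function with domain [D]: one-sided at an endpoint of [D],
    the usual one at an interior point (see [derive_withinE]). The values of
    [f] outside [D] are irrelevant when [x \in D]. *)
Section derivative.
Context {R : realType}.
Implicit Types (D : set R) (f : R -> R) (x : R).

Definition diff_quotient f x : R -> R := fun y => (f y - f x) / (y - x).

Definition derivable_within D f x : Prop :=
  cvg (diff_quotient f x @ within D (dnbhs x)).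

Definition derive_within D f x : R :=
  lim (diff_quotient f x @ within D (dnbhs x)).

Lemma derive_withinE D f x : nbhs x D -> derive_within D f x = derive1 f x.
Proof.
move=> Dx; rewrite /derive_within /derive1.
have eqF : diff_quotient f x @ within D (dnbhs x) =
    (fun h => h^-1 *: (f (h + x) - f x)) @ 0^'.
  rewrite predeqE => A.
  pose P h := h != 0 -> A (h^-1 *: (f (h + x) - f x)).
  pose Q z := z != x -> A (diff_quotient f x z).
  have PQ : (\forall z \near x, Q z) <-> \forall h \near 0, P h.
    rewrite (near_shift 0 x) subr0.
    have -> : Q \o shift x = P; last by [].
    apply/funext => h; rewrite /P /Q /diff_quotient /= addrK mulrC.
    by rewrite -subr_eq0 addrK.
  split=> [nA|nA]; last by apply: filterS (PQ.2 nA) => z Qz zx _; exact: Qz.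
  apply/PQ.1; apply: filterS2 Dx nA => z Dz + zx; exact.
by rewrite eqF.
Qed.

End derivative.

(** The product measure mu^n on [n.-tuple T] with its product sigma-algebra;
    see [power_probability_box]. *)
Section power_measure.
Context {d : measure_display} {T : measurableType d} {R : realType}.
Variable mu : probability T R.

Definition tuple_cons n (z : T * n.-tuple T) : n.+1.-tuple T :=
  [tuple of z.1 :: z.2].

Lemma measurable_tuple_cons n : measurable_fun setT (@tuple_cons n).
Proof. by apply: measurable_cons; [exact: measurable_fst|exact: measurable_snd]. Qed.

HB.instance Definition _ n := @isMeasurableFun.Build _ _ _ _
  (@tuple_cons n) (@measurable_tuple_cons n).

Fixpoint power_probability n : probability (n.-tuple T) R :=
  match n return probability (n.-tuple T) R with
  | 0 => \d_ [tuple]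
  | n'.+1 => distribution (mu \x power_probability n')%E (@tuple_cons n')
  end.

Lemma power_probability_box n (B : 'I_n -> set T) :
  (forall i, measurable (B i)) ->
  power_probability n [set x | forall i, B i (tnth x i)] =
  (\prod_(i < n) mu (B i))%E.
Proof.
elim: n B => [|n IH] B mB /=.
  rewrite big_ord0 diracE mem_set//= => -[].
  by [].
rewrite big_ord_recl /distribution /pushforward /=.
transitivity ((mu \x power_probability n)%E
    (B ord0 `*` [set x | forall i, B (lift ord0 i) (tnth x i)])).
  congr (_ _); apply/seteqP; split => [[y z]/= yz|[y z] /= [yB zB] i].
    split; first by have := yz ord0; rewrite (tnth_nth y).
    by move=> i; have := yz (lift ord0 i); rewrite tnthS.
  case: (unliftP ord0 i) => [j ->|->]; first by rewrite tnthS.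
  by rewrite (tnth_nth y).
have mC : measurable
    [set x : n.-tuple T | forall i, B (lift ord0 i) (tnth x i)].
  have -> : [set x : n.-tuple T | forall i, B (lift ord0 i) (tnth x i)] =
      \big[setI/setT]_(i < n) ((@tnth n T ^~ i) @^-1` B (lift ord0 i)).
    rewrite -bigcap_seq; apply/seteqP; split => x /= Bx i.
      by move=> _; exact: Bx.
    exact: (Bx i (mem_index_enum i)).
  apply: bigsetI_measurable => i _; rewrite -[X in measurable X]setTI.
  exact: (measurable_tnth i).
rewrite product_measure1E//; congr (_ * _)%E.
exact: (IH (fun i => B (lift ord0 i))).
Qed.

End power_measure.

Section upper_integral.
Local Open Scope ereal_scope.
Context {d : measure_display} {T : measurableType d} {R : realType}.
Variable mu : {measure set T -> \bar R}.
Implicit Type f : T -> \bar R.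

(** Meant for nonnegative [f]. The library's [\int[mu]_x f x] is a supremum over
    simple functions, hence a lower integral when [f] is not measurable. *)
Definition upper_integral f : \bar R :=
  ereal_inf [set \int[mu]_x g x | g in
    [set g : T -> \bar R | measurable_fun setT g /\ forall x, f x <= g x]].

(** Measurability with respect to the [mu]-completion. *)
Definition completed_measurable f : Prop :=
  exists2 g : T -> \bar R, measurable_fun setT g &
    {ae mu, forall x, f x = g x}.

End upper_integral.

Section profile.
Context {R : realType}.
Implicit Types (theta xi w : R -> R).

(** [theta] is only meaningful on ]0, 1] and [xi], its inverse, on [0, +oo[. *)
Record profile theta xi : Prop := Profile {
  theta_ge0 : {in `]0, 1], forall x, 0 <= theta x} ;
  theta_convex : convex_function (`]0, 1]%classic : set R) theta ;
  theta_decreasing : {in `]0, 1] &, {homo theta : x y /~ x < y}} ;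
  theta1 : theta 1 = 0 ;
  theta_lim0 : theta x @[x --> 0^'+] --> +oo ;
  xi_range : {in `[0, +oo[, forall b, xi b \in `]0, 1]} ;
  thetaK : {in `]0, 1], cancel theta xi} ;
  xiK : {in `[0, +oo[, cancel xi theta} }.

(** theta(0) = +oo *)
Definition theta_ext theta (p : R) : \bar R :=
  if p == 0 then +oo%E else (theta p)%:E.

Definition xi' xi : R -> R := derive_within `[0, +oo[%classic xi.

Definition xi'' xi : R -> R := derive_within `[0, +oo[%classic (xi' xi).

Record smooth_profile xi : Prop := SmoothProfile {
  xi_convex : convex_function (`[0, +oo[%classic : set R) xi ;
  xi_derivable :
    {in `[0, +oo[, forall b, derivable_within `[0, +oo[%classic xi b} ;
  xi'_derivable :
    {in `]0, +oo[, forall b, derivable_within `[0, +oo[%classic (xi' xi) b} ;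
  xi''_decreasing : {in `]0, +oo[ &, {homo xi'' xi : x y /~ x <= y}} ;
  xi''_le : {in `]0, +oo[, forall b, xi'' xi b <= `|xi' xi b|} }.

Definition Xi xi (x b : R) : R :=
  xi (Num.max x 0) - xi b - (Num.max x 0 - b) * xi' xi b.

Definition condition_H xi w : Prop := forall b t : R,
  0 <= b -> 0 <= t <= 1 ->
  (\int[lebesgue_measure]_(u in `]0%R, 1%R]) (Xi xi (b - t * w u) b)%:E
    <= (t ^+ 2 * `|xi' xi b|)%:E)%E.

End profile.

Section penalty.
Context {R : realType} {T : Type}.
Variable h : T -> T -> R.

(** Meaningful for nonempty [B] and [h] bounded below: [inf] is the real-valued
    infimum. *)
Definition hdist (x : T) (B : set T) : R := inf [set h x y | y in B].

Definition convex_hull (M : lmodType R) (U : set M) : set M :=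
  smallest (@convex_set R M) U.

Context {n : nat}.

Definition U_set (A : set (n.-tuple T)) (x : n.-tuple T) : set 'rV[R]_n :=
  [set s | (forall i, 0 <= s ord0 i) /\
    exists2 y, A y & forall i, h (tnth x i) (tnth y i) <= s ord0 i].

Definition V_set (A : set (n.-tuple T)) (x : n.-tuple T) : set 'rV[R]_n :=
  convex_hull (U_set A x).

(** Equal to +oo when [A] is empty. *)
Definition f_hpsi (psi : R -> R) (A : set (n.-tuple T)) (x : n.-tuple T) : \bar R :=
  ereal_inf [set (\sum_(i < n) psi (s ord0 i))%:E | s in V_set A x].

End penalty.

(* Main.v *)
Require Import Defs.
From mathcomp Require Import all_boot all_order all_algebra.
From mathcomp Require Import all_classical all_reals all_analysis.
From mathcomp Require Import measurable_realfun ring lra.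
Import Order.TTheory GRing.Theory Num.Theory.
Import numFieldNormedType.Exports.
Local Open Scope classical_set_scope.
Local Open Scope ring_scope.

Set Implicit Arguments.
Unset Strict Implicit.
Unset Printing Implicit Defensive.

(* Split off one coordinate. With A_y the section of A at y, a point of V_A at
   (y, x) arises as a convex combination, with weights 1 - t and t, of points
   of V_(A_y)(x) and V_(A_z)(x), at the extra price psi(t h(y, z)). Convexity of
   exp and induction then bound the inner integral at y by the exponential of
   (1 - t) v(y) + t v(z) + psi(t h(y, z)) / K, where v(y) = theta(P(A_y)), for
   every z and t. Write b = theta(P(A)), so that the integral of xi(v) is xi(b).
   It remains to gain, by a good choice of t and z, more than the second order
   losses in the convexity of xi and exp.

   Below b: let t0 be the least number such that every level set {v <= c} with
   c < b satisfies b - c <= t0 w(mu(v <= c)). If t0 exceeds a multiple of 1/K,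
   moving to that level set with t = 1 is already enough. Otherwise H(xi, w) and
   int w^2 <= 1 bound the losses on {v < b} by a multiple of t0^2, while moving
   to an extremal level set with a small t gains about K t0^2.

   Above b: level sets {v <= c} with c - b >= 8 t0 / gamma have measure at least
   1/2. Points with v - b of order r move to {v <= b + r} with t proportional to
   r; the exceptional points are controlled at every dyadic scale r by the tail
   hypothesis, whose bound is proportional to mu(v > b + r). *)

(** * Convex profiles *)

(** What averages exactly is not v - b but the measure g of the section at y. So the first order
    term is taken to be (xi(b) - g) / |xi'(b)|, of mean zero; convexity of xi and xi'' <= |xi'|
    compare it with v - b up to second order. v is cut off at b + 1, up to which |xi'| is comparable
    with |xi'(b)|. The inner integral J need not be measurable in y, and upper integrals are only
    subadditive. Hence the bound in one coordinate has the shape J <= Phi + F: Phi is bounded,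
    measurable, of any sign, and is integrated exactly; F collects nonnegative costs that are only
    bounded from above. At points not far above b the two moves do not compete: their bounds are
    averaged, so that half of each gain is available. The tail hypothesis bounds the cost of the
    exceptional points by a small multiple of mu(v > b + r), which is the mean of a multiple of an
    indicator. That multiple is subtracted in Phi and paid for, point by point, by what remains of
    the gain in (v - b)^2. *)

Lemma convex_functionE (R : realType) (D : set R) (f : R -> R) (x y t : R) :
  convex_function (D : set R) f -> D x -> D y -> 0 <= t <= 1 ->
  f ((1 - t) * x + t * y) <= (1 - t) * f x + t * f y.
Proof.
move=> cf Dx Dy /andP[t0 t1].
have := cf (Itv01 t0 t1) y x (mem_set Dy) (mem_set Dx).
rewrite convRE/= /conv/= /unstable.onem => h.
by rewrite addrC [leRHS]addrC.
Qed.

Section xi_calculus.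
Context {R : realType} (theta xi : R -> R).
Hypotheses (pr : profile theta xi) (sm : smooth_profile xi).

Lemma xi_lt (x y : R) : 0 <= x -> x < y -> xi y < xi x.
Proof.
move=> x0 xy; have y0 : 0 <= y by rewrite (le_trans x0)// ltW.
have Ix : x \in `[0, +oo[ by rewrite in_itv/= x0.
have Iy : y \in `[0, +oo[ by rewrite in_itv/= y0.
rewrite ltNge; apply/negP; rewrite le_eqVlt => /orP[/eqP xyE|].
  by move: xy; rewrite -(xiK pr Ix) -(xiK pr Iy) xyE ltxx.
move=> /(theta_decreasing pr (xi_range pr Iy) (xi_range pr Ix)).
by rewrite (xiK pr Ix) (xiK pr Iy) => /(lt_trans xy); rewrite ltxx.
Qed.

Lemma xi_le (x y : R) : 0 <= x -> x <= y -> xi y <= xi x.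
Proof. by move=> x0; rewrite le_eqVlt => /orP[/eqP->//|/(xi_lt x0)/ltW]. Qed.

(** Convexity bounds the slopes of the chords of [xi] from [b] towards [x], and those of the short
    chords tend to [xi' xi b]. Only the side of [b] that contains [x] enters, so b = 0 is
    covered. *)
Lemma xi_tangent (b x : R) : 0 <= b -> 0 <= x ->
  xi b + (x - b) * xi' xi b <= xi x.
Proof.
move=> b0 x0.
have cvgL : diff_quotient xi b @ within `[0, +oo[ b^' --> xi' xi b.
  by apply: (xi_derivable sm); rewrite in_itv/= b0.
have slope s : 0 < s <= 1 ->
    xi (b + s * (x - b)) - xi b <= s * (xi x - xi b).
  move=> /andP[s0 s1].
  have := @convex_functionE _ _ _ b x s (xi_convex sm).
  rewrite /= !in_itv/= b0 x0 s1 (ltW s0) => /(_ isT isT isT).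
  have -> : (1 - s) * b + s * x = b + s * (x - b) by ring.
  lra.
have [xb|bx|->] := ltgtP x b; last by rewrite subrr mul0r addr0.
- suff : (xi x - xi b) / (x - b) <= xi' xi b.
    by rewrite ler_ndivrMr ?subr_lt0// mulrC; lra.
  have cvgl : diff_quotient xi b @ b^'- --> xi' xi b.
    apply: cvg_trans cvgL; apply: cvg_app => A /=.
    rewrite /within /= /nbhs/= /dnbhs /at_left /within /=.
    have b_gt0 : 0 < b by lra.
    move=> nA; near=> z => zb.
    have : z != b -> z \in `[0, +oo[ -> A z by near: z; exact: nA.
    apply; first by rewrite lt_eqF.
    by rewrite in_itv/= andbT ltW//; near: z; exact: lt_nbhsr.
  rewrite -(cvg_lim _ cvgl)//; apply: limr_ge; first by apply/cvg_ex; exists (xi' xi b).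
  near=> z.
  have zb : z < b by near: z; exact: nbhs_left_lt.
  have xz : x < z by near: z; exact: nbhs_left_gt.
  have xb' : x - b < 0 by rewrite subr_lt0.
  have zb' : z - b < 0 by rewrite subr_lt0.
  have := @slope ((z - b) / (x - b)).
  rewrite divfK ?lt_eqF// (_ : b + (z - b) = z); last by ring.
  rewrite ler_ndivrMr// mul1r lerD2r (ltW xz) andbT.
  rewrite nmulr_rgt0// invr_lt0 xb' => /(_ isT) h.
  by rewrite /diff_quotient ler_ndivlMr// mulrC mulrA mulrAC.
- suff : xi' xi b <= (xi x - xi b) / (x - b).
    by rewrite ler_pdivlMr ?subr_gt0// mulrC; lra.
  have cvgl : diff_quotient xi b @ b^'+ --> xi' xi b.
    apply: cvg_trans cvgL; apply: cvg_app => A /=.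
    rewrite /within /= /nbhs/= /dnbhs /at_right /within /=.
    move=> nA; near=> z => zb.
    have : z != b -> z \in `[0, +oo[ -> A z by near: z; exact: nA.
    apply; first by rewrite gt_eqF.
    by rewrite in_itv/= andbT ltW// (le_lt_trans b0).
  rewrite -(cvg_lim _ cvgl)//; apply: limr_le; first by apply/cvg_ex; exists (xi' xi b).
  near=> z.
  have zb : b < z by near: z; exact: nbhs_right_gt.
  have xz : z < x by near: z; exact: nbhs_right_lt.
  have xb' : 0 < x - b by rewrite subr_gt0.
  have zb' : 0 < z - b by rewrite subr_gt0.
  have := @slope ((z - b) / (x - b)).
  rewrite divfK ?gt_eqF// (_ : b + (z - b) = z); last by ring.
  rewrite ler_pdivrMr// mul1r lerD2r (ltW xz) andbT divr_gt0// => /(_ isT) h.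
  by rewrite /diff_quotient ler_pdivrMr// mulrC mulrA mulrAC.
Unshelve. all: by end_near. Qed.

Lemma xi'_lt0 (b : R) : 0 <= b -> xi' xi b < 0.
Proof.
move=> b0; have b1 : 0 <= b + 1 by lra.
have := xi_tangent b0 b1; have := @xi_lt b (b + 1) b0.
by rewrite ltrDl ltr01 => /(_ isT); lra.
Qed.

Lemma xi'_le (x y : R) : 0 <= x -> x <= y -> xi' xi x <= xi' xi y.
Proof.
move=> x0; rewrite le_eqVlt => /orP[/eqP->//|xy].
have y0 : 0 <= y by lra.
have := xi_tangent x0 y0; have := xi_tangent y0 x0 => h1 h2.
have : 0 <= (y - x) * (xi' xi y - xi' xi x) by nra.
by rewrite pmulr_rge0 ?subr_gt0// subr_ge0.
Qed.

(** Mean value theorem for xi', with xi''(z) <= |xi'(z)| <= |xi'(b)| at the intermediate point,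
    since xi' is negative and nondecreasing. For b > 0 the one-sided derivatives on [b, x] are
    ordinary ones. *)
Lemma xi'_growth (b x : R) : 0 < b -> b <= x ->
  xi' xi x - xi' xi b <= - xi' xi b * (x - b).
Proof.
move=> b0; rewrite le_eqVlt => /orP[/eqP->|bx]; first by rewrite !subrr mulr0.
have nbhs0 (z : R) : 0 < z -> nbhs z (`[0, +oo[%classic : set R).
  move=> z0; near=> y; rewrite /= in_itv/= andbT ltW//.
  by near: y; exact: lt_nbhsr.
have drv (z : R) : 0 < z -> is_derive z 1 (xi' xi) (xi'' xi z).
  move=> z0.
  have := xi'_derivable sm; move=> /(_ z); rewrite in_itv/= z0 => /(_ isT) dz.
  have -> : xi'' xi z = derive1 (xi' xi) z by rewrite /xi'' derive_withinE; last exact: nbhs0.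
  apply: DeriveDef; last by rewrite derive1E.
  apply/derivable1_diffP/derivable1_diffP.
  move: dz; rewrite /derivable_within.
  have : within `[0, +oo[%classic z^' = z^'.
    apply/seteqP; split => A.
      rewrite /within/= => nA; have := nbhs0 _ z0 => nz.
      rewrite /dnbhs /within /=; near=> y => yz.
      have : y \in `[0, +oo[ by near: y; exact: nz.
      by move: yz; near: y; exact: nA.
    by move=> nA; apply: filterS nA => y Ay _.
  move=> -> /cvg_ex[/= l cl]; apply/cvg_ex; exists l.
  move: cl; rewrite /diff_quotient.
  move=> /cvgrPdist_lt cl; apply/cvgrPdist_lt => e e0.
  have H : \forall y \near z, y != z ->
      `|l - (xi' xi y - xi' xi z) / (y - z)| < e by exact: cl.
  rewrite (near_shift 0 z) subr0 in H.
  apply: filterS H => h /= H h0.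
  have := H; rewrite -subr_eq0 addrK => /(_ h0).
  by rewrite mulrC /GRing.scale/= mulr1.
have [z zbx ->] : exists2 z, z \in `]b, x[ &
    xi' xi x - xi' xi b = xi'' xi z * (x - b).
  apply: MVT => //.
    by move=> z; rewrite in_itv/= => /andP[bz _]; apply: drv; rewrite (lt_trans b0).
  apply: derivable_within_continuous => z; rewrite in_itv/= => /andP[bz _].
  by have [] := drv z (lt_le_trans b0 bz).
apply: ler_wpM2r; first by rewrite subr_ge0 ltW.
move: zbx; rewrite in_itv/= => /andP[bz zx].
have z0 : 0 < z by rewrite (lt_trans b0).
have := xi''_le sm; move=> /(_ z); rewrite in_itv/= z0 => /(_ isT) /le_trans; apply.
rewrite (ltr0_norm (xi'_lt0 (ltW z0))) lerN2.
by apply: xi'_le; exact: ltW.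
Unshelve. all: by end_near. Qed.

(** The tangent at [v], evaluated at [b], bounds the drop below by (v - b) |xi'(v)|, and
    [xi'_growth] compares the slopes. The first order coefficient is exactly |xi'(b)|, as the
    comparison with the mean-zero term demands. *)
Lemma xi_drop_quad (b v : R) : 0 < b -> b <= v ->
  - xi' xi b * ((v - b) - (v - b) ^+ 2) <= xi b - xi v.
Proof.
move=> b0 bv; have v0 : 0 <= v by lra.
have := xi_tangent v0 (ltW b0); have := xi'_growth b0 bv.
by move=> h1 h2; nra.
Qed.

(** The same tangent, with |xi'(v)| >= |xi'(b + 1)|. The coefficient is worse than in
    [xi_drop_quad], but the bound keeps its force up to distance 1. *)
Lemma xi_drop_lin (gamma b v : R) : 0 <= b -> b <= v <= b + 1 ->
  gamma * `|xi' xi b| <= `|xi' xi (b + 1)| ->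
  gamma * - xi' xi b * (v - b) <= xi b - xi v.
Proof.
move=> b0 /andP[bv vb]; have b10 : 0 <= b + 1 by lra.
rewrite !ltr0_norm ?xi'_lt0// => hg; have v0 : 0 <= v by lra.
have := xi_tangent v0 b0; have := xi'_le v0 vb => h1 h2.
by nra.
Qed.

End xi_calculus.

(** * Upper integrals *)

Section upper_integral_theory.
Local Open Scope ereal_scope.
Context {d : measure_display} {T : measurableType d} {R : realType}.
Variable mu : {measure set T -> \bar R}.
Implicit Types f g : T -> \bar R.

Lemma upper_integral_ge0 f : (forall x, 0 <= f x) -> 0 <= upper_integral mu f.
Proof.
move=> f0; apply: le_ereal_inf_tmp => _ [g [_ fg] <-].
by apply: integral_ge0 => x _; exact: le_trans (fg x).
Qed.

Lemma upper_integral_le f g : (forall x, f x <= g x) ->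
  upper_integral mu f <= upper_integral mu g.
Proof.
move=> fg; apply: le_ereal_inf_tmp => _ [h [mh gh] <-].
apply: ereal_inf_lbound; exists h => //; split => // x.
exact: le_trans (fg x) (gh x).
Qed.

Lemma upper_integral_le_integral f g : measurable_fun setT g ->
  (forall x, f x <= g x) -> upper_integral mu f <= \int[mu]_x g x.
Proof. by move=> mg fg; apply: ereal_inf_lbound; exists g. Qed.

Lemma upper_integral_adherent f (r e : R) : upper_integral mu f <= r%:E ->
  (0 < e)%R -> exists2 g, measurable_fun setT g /\ (forall x, f x <= g x) &
    \int[mu]_x g x <= (r + e)%:E.
Proof.
move=> fr e0; have : upper_integral mu f < (r + e)%:E.
  by rewrite (le_lt_trans fr)// lte_fin ltrDl.
by move=> /ereal_inf_lt[_ [g [mg fg] <-]] /ltW; exists g.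
Qed.

Lemma upper_integralD_le f g (r s : R) : (forall x, 0 <= f x) ->
  (forall x, 0 <= g x) -> upper_integral mu f <= r%:E ->
  upper_integral mu g <= s%:E ->
  upper_integral mu (fun x => f x + g x) <= (r + s)%:E.
Proof.
move=> f0 g0 fr gs; apply/lee_addgt0Pr => e e0.
have e2 : (0 < e / 2)%R by rewrite divr_gt0.
have [f' [mf' ff'] If'] := upper_integral_adherent fr e2.
have [g' [mg' gg'] Ig'] := upper_integral_adherent gs e2.
apply: (@le_trans _ _ (\int[mu]_x (f' x + g' x))).
  apply: upper_integral_le_integral => [|x]; last exact: leeD.
  exact: emeasurable_funD.
rewrite ge0_integralD//; last 2 first.
- by move=> x _; exact: le_trans (ff' x).
- by move=> x _; exact: le_trans (gg' x).
apply: le_trans (leeD If' Ig') _; rewrite -!EFinD lee_fin; lra.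
Qed.

Lemma upper_integralZ_le f (c r : R) : (0 <= c)%R -> (forall x, 0 <= f x) ->
  upper_integral mu f <= r%:E ->
  upper_integral mu (fun x => c%:E * f x) <= (c * r)%:E.
Proof.
move=> c0 f0 fr; apply/lee_addgt0Pr => e e0.
have e' : (0 < e / (c + 1))%R by rewrite divr_gt0// ltr_wpDl.
have [g [mg fg] Ig] := upper_integral_adherent fr e'.
apply: (@le_trans _ _ (\int[mu]_x (c%:E * g x))).
  apply: upper_integral_le_integral => [|x]; first exact: measurable_funeM.
  by rewrite lee_wpmul2l.
rewrite ge0_integralZl_EFin//; last by move=> x _; exact: le_trans (fg x).
apply: (@le_trans _ _ (c%:E * (r + e / (c + 1))%:E)); first by rewrite lee_wpmul2l.
rewrite -EFinM -EFinD lee_fin mulrDr lerD2l mulrA ler_pdivrMr ?ltr_wpDl//; nra.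
Qed.

End upper_integral_theory.

Section upper_integral_probability.
Local Open Scope ereal_scope.
Context {d : measure_display} {T : measurableType d} {R : realType}.
Variable P : probability T R.

Lemma upper_integral_cst_le (f : T -> \bar R) (c : R) :
  (forall x, f x <= c%:E) -> upper_integral P f <= c%:E.
Proof.
move=> fc; apply: le_trans (upper_integral_le_integral P (g := cst c%:E) _ fc) _.
  exact: measurable_cst.
by rewrite integral_cst//= probability_setT mule1.
Qed.

(** [phi] may take both signs and enters with its exact integral; only the nonnegative [F] is
    replaced by a measurable majorant. Cancellations inside [phi] thus survive. *)
Lemma upper_integral_bounded_add_le (f : T -> \bar R) (phi : T -> R)
    (F : T -> \bar R) (r : R) :
  measurable_fun setT phi -> bounded_fun phi ->
  (forall x, 0 <= F x) -> upper_integral P F <= r%:E ->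
  (forall x, f x <= (phi x)%:E + F x) ->
  upper_integral P f <= (\int[P]_x phi x)%R%:E + r%:E.
Proof.
move=> mphi bphi F0 Fr fF; apply/lee_addgt0Pr => e e0.
have [g [mg Fg] Ig] := upper_integral_adherent Fr e0.
have g0 x : 0 <= g x by exact: le_trans (Fg x).
have iphi : P.-integrable setT (EFin \o phi).
  apply: measurable_bounded_integrable => //.
  by rewrite /= probability_setT ltry.
have ig : P.-integrable setT g.
  apply/integrableP; split => //.
  under eq_integral do rewrite gee0_abs//.
  by rewrite (le_lt_trans Ig)// ltry.
apply: (@le_trans _ _ (\int[P]_x ((phi x)%:E + g x))).
  apply: upper_integral_le_integral => [|x].
    by apply: emeasurable_funD => //; exact/measurable_EFinP.
  by apply: le_trans (fF x) _; rewrite leeD2l.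
rewrite integralD//; apply: le_trans (leeD (lexx _) Ig) _.
rewrite EFinD addeA; apply: leeD => //; apply: leeD => //.
by rewrite /Rintegral fineK// integrable_fin_num.
Qed.

End upper_integral_probability.

(** * Comparing integrals through tails *)

Section layer_cake.
Local Open Scope ereal_scope.
Context {d : measure_display} {T : measurableType d} {R : realType}.
Variables (m : {sigma_finite_measure set T -> \bar R}) (f : T -> R).
Hypotheses (mf : measurable_fun setT f) (f0 : forall x, (0 <= f x)%R).

(** The subgraph of [f] above height 0. Its sections at negative heights are empty, so the integral
    over heights may run over the whole line. *)
Let E : set (T * measurableTypeR R) := [set p | 0 <= p.2 < f p.1]%R.

Let mE : measurable E.
Proof.
have -> : E = (@snd T R) @^-1` `[0%R, +oo[%classic `&`
    (fun p : T * R => f p.1 - p.2)%R @^-1` `]0%R, +oo[%classic.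
  apply/seteqP; split => [[x s]|[x s]] /=; rewrite /E/= !in_itv/= !andbT.
    by move=> /andP[-> h]; rewrite subr_gt0.
  by move=> [-> h]; rewrite -subr_gt0.
apply: measurableI.
  by rewrite -[X in measurable X]setTI; exact: measurable_snd.
rewrite -[X in measurable X]setTI.
suff : measurable_fun setT (fun p : T * R => f p.1 - p.2)%R by exact.
apply: measurable_funB; first exact: measurableT_comp.
exact: measurable_snd.
Qed.

Let ysectionE s : ysection E s = [set x | 0 <= s < f x]%R.
Proof. by apply/seteqP; split => x /=; rewrite /ysection/= inE. Qed.

Lemma measurable_tail :
  measurable_fun setT (fun s : R => m [set x | 0 <= s < f x]%R).
Proof.
have := measurable_fun_ysection m mE; apply: eq_measurable_fun => s _ /=.
by rewrite ysectionE.
Qed.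

Lemma layer_cake :
  \int[m]_x (f x)%:E =
  \int[lebesgue_measure]_s m [set x | 0 <= s < f x]%R.
Proof.
have := indic_fubini_tonelli m lebesgue_measure mE.
rewrite indic_fubini_tonelli_FE// indic_fubini_tonelli_GE// => h.
transitivity (\int[m]_x (lebesgue_measure \o xsection E) x).
  apply: eq_integral => x _ /=.
  rewrite (_ : xsection E x = `[0%R, f x[%classic); last first.
    by apply/seteqP; split => s /=; rewrite /xsection/= inE/= in_itv/=.
  rewrite lebesgue_measure_itv/= lte_fin.
  by case: ltgtP (f0 x) => // [_ _|<- _]; rewrite ?sube0.
by rewrite h; apply: eq_integral => s _ /=; rewrite ysectionE.
Qed.

End layer_cake.

Lemma le_integral_tail {d1 d2 : measure_display} {T1 : measurableType d1}
    {T2 : measurableType d2} {R : realType}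
    (m1 : {sigma_finite_measure set T1 -> \bar R})
    (m2 : {sigma_finite_measure set T2 -> \bar R}) (f : T1 -> R) (g : T2 -> R)
    (c : R) :
  measurable_fun setT f -> measurable_fun setT g ->
  (forall x, 0 <= f x) -> (forall x, 0 <= g x) -> 0 <= c ->
  (forall s : R, 0 <= s ->
    (m1 [set x | s < f x]%R <= c%:E * m2 [set x | s < g x]%R)%E) ->
  (\int[m1]_x (f x)%:E <= c%:E * \int[m2]_x (g x)%:E)%E.
Proof.
move=> mf mg f0 g0 c0 fg; rewrite !layer_cake// -ge0_integralZl_EFin//; last first.
  exact: measurable_tail.
apply: ge0_le_integral => //.
- exact: measurable_tail.
- by apply: measurable_funeM; exact: measurable_tail.
- move=> s _; have [s0|s0] := leP 0 s.
    exact: fg.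
  rewrite (_ : [set x | _] = set0) ?measure0 ?mule_ge0//.
  by apply/seteqP; split.
Qed.

Lemma nonincreasing_in_measurable (R : realType) (D : set R) (f : R -> R) :
  is_interval D -> {in D &, {homo f : x y /~ x <= y}} -> measurable_fun D f.
Proof.
move=> iD fni; have mD := is_interval_measurable iD.
apply: (measurability (@RGenCInfty.G R)) => [|/= _ [_] [r] -> <-].
  exact: RGenCInfty.measurableE.
apply: is_interval_measurable => s t/=.
rewrite !in_itv/= !andbT => -[Ds fs] [Dt ft] u /andP[su ut].
have Du : D u by apply: (iD s t) => //; rewrite su.
by split => //=; rewrite in_itv/= andbT (le_trans ft)// fni// inE.
Qed.

(** * Comparison of v below b with b - t w(u) *)

Section transfer.
Context {d : measure_display} {T : measurableType d} {R : realType}.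
Variables (P : probability T R) (v : T -> R) (b t : R) (w phi : R -> R).
Hypotheses (mv : measurable_fun setT v) (t0 : 0 <= t).
Hypothesis (wni : {in `]0, 1] &, {homo w : x y /~ x <= y}}).
Hypothesis (vw : forall c, c < b -> (0 < P [set x | (v x <= c)%R])%E ->
  b - c <= t * w (Num.min (fine (P [set x | (v x <= c)%R])) (1 / 2))).
Hypotheses (phi0 : forall x, 0 <= phi x) (phini : nonincreasing_fun phi).
Hypothesis (phib : forall x, b <= x -> phi x = 0).

Let g (u : R) : R := if u \in `]0, 1] then phi (b - t * w u) else 0.

Let mg : measurable_fun setT g.
Proof.
rewrite (_ : g = (fun u => phi (b - t * w u)) \_ (`]0, 1]%classic : set R)).
  apply/(measurable_restrictT _ _).1 => //.
  apply: nonincreasing_in_measurable; first exact: interval_is_interval.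
  move=> x y; rewrite !inE => x01 y01 xy; apply: phini.
  by rewrite lerD2l lerN2 ler_wpM2l// wni.
by apply/funext => u; rewrite /g patchE mem_setE.
Qed.

Let mle (c : R) : measurable [set x | v x <= c].
Proof.
rewrite -[X in measurable X]setTI (_ : [set x | _] = v @^-1` `]-oo, c]%classic).
  exact: mv.
by apply/seteqP; split => x /=; rewrite in_itv.
Qed.

(** Put u' = min(p, 1/2), with p the measure of {v <= c}. As [w] is nonincreasing, b - t w(u) <= b -
    t w(u') <= c on ]0, u'], so {s < g} contains this interval. The factor 2 is p <= 2 u'. *)
Let le_tail (c s : R) : 0 <= s -> s < phi c ->
  (P [set x | v x <= c]%R <= 2%:E * lebesgue_measure [set u | s < g u]%R)%E.
Proof.
move=> s0 sc; have cb : c < b.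
  by rewrite ltNge; apply/negP => /phib pc; move: sc; rewrite pc ltNge s0.
have [->|Pc] := eqVneq (P [set x | v x <= c]%R) 0%E; first by rewrite mule_ge0.
have Pc0 : (0 < P [set x | v x <= c]%R)%E by rewrite lt0e Pc/=.
have := vw cb Pc0.
set p := fine _; set u' := Num.min _ _ => hu.
have pE : P [set x | v x <= c]%R = p%:E by rewrite /p fineK// fin_num_measure.
have p0 : 0 < p by move: Pc0; rewrite pE lte_fin.
have u'0 : 0 < u' by rewrite lt_min p0/=; lra.
have u'1 : u' <= 1 by rewrite ge_min; apply/orP; right; lra.
have p1 : p <= 1 by rewrite -lee_fin -pE probability_le1.
have pu : p <= 2 * u' by rewrite /u' /Num.min; case: ifPn; lra.
apply: (@le_trans _ _ (2%:E * lebesgue_measure `]0%R, u']%classic)%E).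
  rewrite lebesgue_measure_itv/= lte_fin u'0 oppr0 adde0 pE.
  by rewrite -EFinM lee_fin.
apply: lee_wpmul2l => //; apply: le_measure; rewrite ?inE//.
  rewrite (_ : [set u | _] = g @^-1` `]s, +oo[%classic).
    by rewrite -[X in measurable X]setTI; exact: mg.
  by apply/seteqP; split => x /=; rewrite in_itv/= andbT.
move=> u /=; rewrite in_itv/= => /andP[u0 uu'].
have u01 : u \in `]0, 1] by rewrite in_itv/= u0 (le_trans uu').
have u'01 : u' \in `]0, 1] by rewrite in_itv/= u'0.
rewrite /g u01 (lt_le_trans sc)//; apply: phini.
have := wni u'01 u01 uu' => h.
by have := ler_wpM2l t0 h; lra.
Qed.

Lemma integral_transfer :
  (\int[P]_x (phi (v x))%:E <=
   2%:E * \int[lebesgue_measure]_(u in `]0%R, 1%R]) (phi (b - t * w u))%:E)%E.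
Proof.
rewrite [X in (_ * X)%E](_ : _ = \int[lebesgue_measure]_u (g u)%:E)%E; last first.
  rewrite integral_mkcond; apply: eq_integral => u _.
  by rewrite patchE mem_setE /g; case: ifP.
apply: le_integral_tail => //.
- by apply: measurableT_comp => //; exact: nonincreasing_measurable.
- by move=> u; rewrite /g; case: ifP.
move=> s s0.
have [[c sc]|nc] := pselect (exists c, s < phi c); last first.
  rewrite (_ : [set x | _] = set0) ?measure0 ?mule_ge0//.
  by apply/seteqP; split => // x /= sx; apply: nc; exists (v x).
pose S := [set c | s < phi c].
have ubS : ubound S b.
  move=> x; rewrite /S/= => sx; rewrite leNgt; apply/negP => /ltW /phib px.
  by move: sx; rewrite px ltNge s0.
have hS : has_sup S by split; [exists c|exists b].
(* The set where [phi] exceeds [s] is a half-line, closed or open at its supremum. [le_tail] treats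
   closed half-lines; an open one is exhausted by closed ones. *)
have [Ssup|nSsup] := pselect (S (sup S)).
  apply: le_trans (le_tail s0 Ssup); apply: le_measure; rewrite ?inE//.
    rewrite (_ : [set u | _] = (phi \o v) @^-1` `]s, +oo[%classic).
      rewrite -[X in measurable X]setTI.
      suff : measurable_fun setT (phi \o v) by exact.
      by apply: measurableT_comp => //; exact: nonincreasing_measurable.
    by apply/seteqP; split => x /=; rewrite in_itv/= andbT.
  by move=> x /= sx; apply: ub_le_sup; [exists b|].
pose F n := [set x | v x <= sup S - n.+1%:R^-1].
have FE : [set x | s < phi (v x)] = \bigcup_n F n.
  apply/seteqP; split => x /=.
    move=> sx; have : v x < sup S.
      rewrite lt_neqAle; apply/andP; split; last by apply: ub_le_sup; [exists b|].
      by apply/eqP => vS; apply: nSsup; rewrite -vS.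
    rewrite -subr_gt0 => /ltr_add_invr[n]; rewrite add0r => hn.
    by exists n => //; rewrite /F/= lerBrDr -lerBrDl ltW.
  move=> [n _] /=; rewrite /F /= => vx.
  have [y Sy yl] : exists2 y, S y & sup S - n.+1%:R^-1 < y.
    by apply: sup_adherent => //; rewrite invr_gt0.
  by apply: (lt_le_trans Sy); apply: phini; rewrite (le_trans vx)// ltW.
rewrite FE.
have cvF : P (F n) @[n --> \oo] --> P (\bigcup_n F n).
  apply: nondecreasing_cvg_mu.
  - by move=> n; exact: mle.
  - by apply: bigcup_measurable => n _; exact: mle.
  - move=> m n mn; apply/subsetPset => x /=; rewrite /F/= => /le_trans; apply.
    by rewrite lerD2l lerN2 lef_pV2 ?posrE// ler_nat.
suff : (P (\bigcup_n F n) <=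
    2%:E * lebesgue_measure [set u | s < g u]%R)%E by [].
rewrite -(cvg_lim (@ereal_hausdorff R) cvF); apply: lime_le; first by apply/cvg_ex; eexists; exact: cvF.
near=> n.
have [y Sy yl] : exists2 y, S y & sup S - n.+1%:R^-1 < y.
  by apply: sup_adherent => //; rewrite invr_gt0.
apply: le_tail => //; apply: (lt_le_trans Sy); apply: phini; exact: ltW.
Unshelve. all: by end_near. Qed.

End transfer.

(** * Pointwise estimates *)

Section exp_bounds.
Context {R : realType}.
Implicit Types x y z t : R.

(** From 1 - z/2 <= exp(-z/2) follows exp z <= (1 - z/2)^-2, and a polynomial identity compares this
    with the quadratic. Arbitrarily negative [z] are covered, as points far below the reference
    level demand. *)
Lemma expR_le_quad z : z <= 1 -> expR z <= 1 + z + 2 * z ^+ 2.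
Proof.
move=> z1; have h2 : 0 < 1 - z / 2 by lra.
have e1 : 1 - z / 2 <= (expR (z / 2))^-1.
  by rewrite -expRN; have := expR_ge1Dx (- (z / 2)); rewrite addrC.
have e2 : expR (z / 2) * (1 - z / 2) <= 1.
  by rewrite mulrC -ler_pdivlMr ?expR_gt0// div1r.
have e3 : expR z = expR (z / 2) ^+ 2 by rewrite expr2 -expRD -splitr.
have e0 := expR_ge0 (z / 2).
set u := expR (z / 2) in e2 e3 e0 *.
have e4 : (u * (1 - z / 2)) ^+ 2 <= 1 by rewrite expr_le1// mulr_ge0// ltW.
rewrite e3 -(@ler_pM2r _ ((1 - z / 2) ^+ 2)) ?exprn_gt0//.
rewrite -exprMn (le_trans e4)//.
have -> : (1 + z + 2 * z ^+ 2) * (1 - z / 2) ^+ 2 =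
  1 + z ^+ 2 * ((1 - z) * (5 / 2 - z) / 2) by field.
by rewrite lerDl mulr_ge0 ?sqr_ge0// divr_ge0// mulr_ge0//; lra.
Qed.

Lemma expR_le4 z : z <= 1 -> expR z <= 4.
Proof.
move=> z1; apply: (@le_trans _ _ (expR 1)); first by rewrite ler_expR.
by apply: le_trans (expR_le_quad (lexx 1)) _; rewrite expr1n; lra.
Qed.

Lemma expR_scale_le t z : 0 <= t <= 1 -> expR (t * z) <= 1 - t + t * expR z.
Proof.
move=> /andP[t0 t1].
have := convex_expR (Itv01 t0 t1) z 0.
by rewrite !convRE/= /unstable.onem expR0 mulr0 addr0 mulr1 addrC.
Qed.

Lemma expR_div_le L z : 1 <= L -> expR (z / L) <= 1 + expR z.
Proof.
move=> L1; have L0 : 0 < L by lra.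
have := @expR_scale_le L^-1 z.
rewrite invr_ge0 ltW//= invf_le1// L1 mulrC => /(_ isT) h.
have i0 : 0 <= L^-1 by rewrite invr_ge0 ltW.
have i1 : L^-1 <= 1 by rewrite invf_le1.
by have := expR_ge0 z; nra.
Qed.

Lemma expRB1_le (X : R) : 0 <= X -> expR X - 1 <= X * expR X.
Proof.
move=> X0; have := expR_ge1Dx (- X); rewrite expRN => h.
have e0 := expR_gt0 X.
have : (1 - X) * expR X <= 1 by rewrite -ler_pdivlMr// div1r.
lra.
Qed.

Lemma sqr_le_expR z : 0 <= z -> z ^+ 2 <= 64 * expR (z / 4).
Proof.
move=> z0; have -> : expR (z / 4) = expR (z / 8) ^+ 2.
  by rewrite expr2 -expRD; congr expR; field.
have := expR_ge1Dx (z / 8) => h.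
have : (1 + z / 8) ^+ 2 <= expR (z / 8) ^+ 2.
  by rewrite lerXn2r ?nnegrE ?expR_ge0//; lra.
nra.
Qed.

(** With z = p/L the linear bound gives exp X <= exp(z/4), and exp X - 1 <= X exp X leaves t^2 L^2 /
    K times z^2 exp(z/4). The square is absorbed by a second exp(z/4), and z/2 = 1 + (p/2 - L)/L
    brings in exp(p/2 - L), whose mean is at most 1 when exp(p/2) has mean at most exp L. A move of
    weight t thus costs order t^2. *)
Lemma expRB1_small_weight (X t p L K : R) : 0 <= X -> 0 <= t -> 0 <= p ->
  0 < K -> 1 <= L -> t * L <= K / 4 ->
  X <= t * p / K -> X <= t ^+ 2 * p ^+ 2 / K ->
  expR X - 1 <= 256 * (t ^+ 2 * L ^+ 2 / K) * (1 + expR (p / 2 - L)).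
Proof.
move=> X0 t0 p0 K0 L1 tL X1 X2.
have L0 : 0 < L by lra.
set z := p / L.
have z0 : 0 <= z by rewrite divr_ge0// ltW.
have pE : p = z * L by rewrite /z divfK// gt_eqF.
apply: le_trans (expRB1_le X0) _.
have XE : expR X <= expR (z / 4).
  rewrite ler_expR (le_trans X1)// pE ler_pdivrMr//.
  have -> : t * (z * L) = z * (t * L) by ring.
  have -> : z / 4 * K = z * (K / 4) by ring.
  exact: ler_wpM2l.
apply: (@le_trans _ _ (t ^+ 2 * p ^+ 2 / K * expR (z / 4))).
  by rewrite ler_pM ?expR_ge0.
have E4 : expR (z / 4) * expR (z / 4) = expR (z / 2).
  by rewrite -expRD; congr expR; field.
have z2 := sqr_le_expR z0.
have E1 : expR (z / 2) <= 4 * (1 + expR (p / 2 - L)).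
  have -> : z / 2 = 1 + (p / 2 - L) / L by rewrite pE; field; rewrite gt_eqF.
  rewrite expRD; apply: ler_pM; rewrite ?expR_ge0 ?expR_le4//.
  exact: expR_div_le.
have A0 : 0 <= t ^+ 2 * L ^+ 2 / K.
  by rewrite divr_ge0 ?mulr_ge0 ?sqr_ge0// ltW.
rewrite (_ : t ^+ 2 * p ^+ 2 / K = t ^+ 2 * L ^+ 2 / K * z ^+ 2); last first.
  by rewrite pE; field; rewrite gt_eqF.
rewrite -[leLHS]mulrA [256 * _]mulrC -[leRHS]mulrA ler_wpM2l//.
apply: (@le_trans _ _ (64 * expR (z / 2))).
  by rewrite -E4 mulrA ler_wpM2r ?expR_ge0.
by have := expR_ge0 (p / 2 - L); lra.
Qed.

End exp_bounds.

Section pointwise.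
Context {R : realType}.

(* Moving with weight [t] to a level set at distance [B] below the reference level. *)
Lemma low_level_bound (J x B t u X Q : R) : x <= 1 -> 0 <= t <= 1 ->
  0 <= B -> t * B <= u -> 0 <= Q -> expR X - 1 <= Q ->
  J <= expR x ->
  (0 <= x + B -> J <= expR ((1 - t) * x - t * B + X)) ->
  J <= 1 + x - t * (x + B) + 12 * x ^+ 2 + 8 * u ^+ 2 + 4 * Q.
Proof.
move=> x1 /andP[t0 t1] B0 tB Q0 XQ Jx JX.
have tB0 : 0 <= t * B by rewrite mulr_ge0.
have u2 : (t * B) ^+ 2 <= u ^+ 2 by rewrite lerXn2r ?nnegrE//; lra.
have [xB|xB] := leP 0 (x + B); last first.
  have := expR_le_quad x1; have : t * (x + B) <= 0.
    by rewrite mulr_ge0_le0// ltW.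
  have := sqr_ge0 x; have := sqr_ge0 u; lra.
have txB : 0 <= t * (x + B) by rewrite mulr_ge0.
set z := x - t * (x + B).
have z1 : z <= 1 by rewrite /z; lra.
have zE : (1 - t) * x - t * B + X = z + X by rewrite /z; ring.
have := JX xB; rewrite zE expRD => {}JX.
have e4 := expR_le4 z1; have ez := expR_le_quad z1; have e0 := expR_ge0 z.
have eQ : expR z * (expR X - 1) <= 4 * Q.
  apply: (@le_trans _ _ (expR z * Q)); first exact: ler_wpM2l.
  exact: ler_wpM2r.
have z2 : z ^+ 2 <= 6 * x ^+ 2 + 4 * u ^+ 2.
  have : z ^+ 2 <= 2 * x ^+ 2 + 2 * (t * x + t * B) ^+ 2.
    have := sqr_ge0 (x + (t * x + t * B)); rewrite /z; nra.
  have : (t * x + t * B) ^+ 2 <= 2 * (t * x) ^+ 2 + 2 * (t * B) ^+ 2.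
    have := sqr_ge0 (t * x - t * B); nra.
  have : (t * x) ^+ 2 <= x ^+ 2.
    by rewrite exprMn ler_piMl ?sqr_ge0// expr_le1.
  lra.
have zd : z = x - t * (x + B) by [].
clearbody z; lra.
Qed.

(** The gain 18 x^2 is granted to every x > 0; where it is missing it is charged to [del] or [bet],
    whence 288 = 18 * 16. Up to x = 1/72 the weight 72 x is admissible. *)
Lemma upper_level_bound (J x del bet : R) : x <= 1 / 72 -> 0 <= bet ->
  J <= expR x ->
  [\/ x <= 4 * del, J <= expR (x - 18 * x ^+ 2) | x ^+ 2 <= 16 * bet] ->
  J <= 1 + x + 2 * x ^+ 2 - 18 * Num.max x 0 ^+ 2 + 288 * del ^+ 2 + 288 * bet.
Proof.
move=> x1 bet0 Jx H.
have x1' : x <= 1 by lra.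
have e0 := expR_le_quad x1'; have d0 := sqr_ge0 del.
have [x0|x0] := leP x 0; first by rewrite expr0n/=; lra.
case: H => [xd|Je|xb].
- have : x ^+ 2 <= (4 * del) ^+ 2 by rewrite lerXn2r ?nnegrE//; lra.
  rewrite exprMn; lra.
- set z := x - 18 * x ^+ 2 in Je *.
  have zx : z <= x by rewrite /z; have := sqr_ge0 x; lra.
  have z1 : z <= 1 by lra.
  have z0 : 0 <= z by rewrite /z; nra.
  have := expR_le_quad z1; have : z ^+ 2 <= x ^+ 2.
    by rewrite lerXn2r ?nnegrE// ltW.
  have zd : z = x - 18 * x ^+ 2 by [].
  clearbody z; lra.
- lra.
Qed.

(* With the weight [72 * x], half of the gain [18 * x ^+ 2] exceeds the losses
   [8 * x ^+ 2] that [combine_levels] collects. *)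
Lemma good_level_exponent (x r p s K : R) : 0 <= x -> 2 * r < x -> 0 <= p ->
  p <= s -> 288 * s ^+ 2 <= K -> 0 < K ->
  (1 - 72 * x) * x + 72 * x * r +
    Num.min (72 * x * p / K) ((72 * x) ^+ 2 * p ^+ 2 / K) <= x - 18 * x ^+ 2.
Proof.
move=> x0 rx p0 ps sK K0.
have p2 : p ^+ 2 <= s ^+ 2 by apply: lerXn2r; rewrite ?nnegrE// (le_trans p0).
have h1 : (72 * x) ^+ 2 * p ^+ 2 / K <= 18 * x ^+ 2.
  rewrite ler_pdivrMr//.
  have -> : (72 * x) ^+ 2 * p ^+ 2 = 18 * x ^+ 2 * (288 * p ^+ 2) by ring.
  by apply: ler_wpM2l; [rewrite mulr_ge0 ?sqr_ge0|lra].
have h2 : 72 * x * r <= 36 * x ^+ 2 by nra.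
have h3 : Num.min (72 * x * p / K) ((72 * x) ^+ 2 * p ^+ 2 / K) <=
  (72 * x) ^+ 2 * p ^+ 2 / K by rewrite ge_min lexx orbT.
move: h1 h2 h3; set m := Num.min _ _; set u := _ / K; lra.
Qed.

(** The average of the two bounds. For x > 0 the losses in x^2 are (12 + 2)/2 from the expansions
    and 1 from replacing [x] by [Gam], against 18/2 gained: one unit of max(x, 0)^2 remains to pay
    for exceptional points. *)
Lemma combine_levels (J x Gam ph1 t B u Q del bet : R) :
  0 <= t <= 1 ->
  J <= 1 + x - t * (x + B) + 12 * x ^+ 2 + 8 * u ^+ 2 + 4 * Q ->
  J <= 1 + x + 2 * x ^+ 2 - 18 * Num.max x 0 ^+ 2 + 288 * del ^+ 2 + 288 * bet ->
  Gam <= x -> x <= Gam + ph1 + Num.max x 0 ^+ 2 ->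
  J <= 1 + (1 - t / 2) * Gam - t * B / 2 + ph1 + 7 * Num.max (- x) 0 ^+ 2 +
    4 * u ^+ 2 + 2 * Q + 144 * del ^+ 2 + 144 * bet - Num.max x 0 ^+ 2.
Proof.
move=> /andP[t0 t1] h1 h2 Gx xG.
have : x ^+ 2 = Num.max (- x) 0 ^+ 2 + Num.max x 0 ^+ 2.
  have [x0|x0] := leP x 0; first by rewrite max_l ?sqrrN ?expr0n/= ?addr0; lra.
  by rewrite max_r ?expr0n/= ?add0r//; lra.
have : t * Gam <= t * x by exact: ler_wpM2l.
move: h1 h2 xG; rewrite mulrDr.
move: (x ^+ 2) (Num.max (- x) 0 ^+ 2) (Num.max x 0 ^+ 2) => x2 xm2 xp2.
move: (u ^+ 2) (del ^+ 2) (t * x) (t * B) => u2 d2 tx tB h1 h2 xG h3 h4.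
have -> : (1 - t / 2) * Gam = Gam - t * Gam / 2 by field.
lra.
Qed.

(** Far above the reference level nothing is gained by an expansion around it: J is at most
    exp(g1/4), or is charged to [q], while (1 - t/2) Gam alone is at least 7/8 of [g1]. This leaves
    g1/4 to spare. *)
Lemma top_level_bound (J Gam g1 t B z q : R) : 0 <= t <= 1 / 4 ->
  t * B <= g1 / 4 -> 0 < g1 <= 1 -> g1 <= Gam -> z <= g1 / 4 ->
  0 <= q ->
  J <= expR z \/ J <= 4 * q ->
  J <= 1 + (1 - t / 2) * Gam - t * B / 2 - g1 / 4 + 4 * q.
Proof.
move=> /andP[t0 t1] tB /andP[g0 g1'] gG zg q0 H.
have tG : (1 - t / 2) * Gam >= 7 / 8 * g1.
  by apply: ler_pM; lra.
case: H => [Je|]; last by lra.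
have : expR z <= expR (g1 / 4) by rewrite ler_expR.
have g4 : g1 / 4 <= 1 by lra.
have := expR_le_quad g4; have : (g1 / 4) ^+ 2 <= g1 / 4 * (1 / 4) by nra.
lra.
Qed.

Lemma level_sum_bound (S m r2 i : R) : S <= 2 * m -> m <= r2 ->
  288 * r2 <= 1 -> i <= 1 -> 144 * S + 4 * i <= 5.
Proof. by lra. Qed.

Lemma top_total (J z t g Th x1 x2 t2 d2 Q be q : R) : Th <= g -> 0 <= Q ->
  0 <= be -> 0 <= x1 -> 0 <= x2 -> 0 <= t2 -> 0 <= d2 ->
  J <= 1 + z - t - g + q ->
  J <= ((1 - t + t2 + d2) + z) + ((x1 + x2) + (-1) * Th) + (Q + (be + q)).
Proof. by lra. Qed.

Lemma low_total (J z t y2 Th x1 x2 t2 d2 Q be q : R) : Th <= y2 -> 0 <= q ->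
  J <= 1 + z - t + x1 + x2 + t2 + Q + d2 + be - y2 ->
  J <= ((1 - t + t2 + d2) + z) + ((x1 + x2) + (-1) * Th) + (Q + (be + q)).
Proof. by lra. Qed.

Lemma dyadic_level (r x : R) n : x <= 4 * r -> 2 * (r / 2 ^+ n) < x ->
  exists2 k, (k <= n)%N & 2 * (r / 2 ^+ k) < x <= 4 * (r / 2 ^+ k).
Proof.
move=> x4; elim: n => [|n IH] xn.
  by exists 0%N => //; rewrite xn expr0 divr1.
have [h|h] := ltP (2 * (r / 2 ^+ n)) x.
  by have [k kn hk] := IH h; exists k => //; exact: leqW.
exists n.+1 => //; rewrite xn/= (le_trans h)//.
by rewrite exprS invfM le_eqVlt; apply/orP; left; apply/eqP; field.
Qed.

Lemma dyadic_scale (del r : R) : 0 < del -> del < r ->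
  exists n, del < r / 2 ^+ n <= 2 * del.
Proof.
move=> d0 dr.
have ex : exists n, r / 2 ^+ n <= 2 * del.
  set m := Num.bound (r / del); exists m.
  have mr : r / del < m%:R by apply: archi_boundP; rewrite divr_ge0//; lra.
  have m2 : (m%:R : R) <= 2 ^+ m by rewrite -natrX ler_nat ltnW// ltn_expl.
  rewrite ler_pdivrMr ?exprn_gt0//.
  by move: mr; rewrite ltr_pdivrMr// => mr; nra.
pose n := ex_minn ex; exists n; rewrite /n; case: ex_minnP => -[|m] h hm.
  by rewrite h expr0 divr1 dr.
rewrite h andbT ltNge; apply/negP => h'.
have /hm : r / 2 ^+ m <= 2 * del.
  by move: h'; rewrite exprS invfM mulrCA ler_pdivrMl//; lra.
by rewrite ltnn.
Qed.

(** The squared scales below [y] form a geometric series, dominated by its largest term. The bound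
    does not depend on the number of scales, which grows as t0 tends to 0. *)
Lemma dyadic_sum (r y : R) n : 0 <= r -> 0 <= y ->
  \sum_(k < n) (r / 2 ^+ k) ^+ 2 * (r / 2 ^+ k < y)%R%:R <= 2 * Num.min y r ^+ 2.
Proof.
elim: n r => [|n IH] r r0 y0; first by rewrite big_ord0 mulr_ge0 ?sqr_ge0.
rewrite big_ord_recl/= expr0 divr1.
have r2 : 0 <= r / 2 by lra.
have := IH _ r2 y0.
have -> : \sum_(k < n) (r / 2 / 2 ^+ k) ^+ 2 * (r / 2 / 2 ^+ k < y)%R%:R =
  \sum_(k < n) (r / 2 ^+ bump 0 k) ^+ 2 * (r / 2 ^+ bump 0 k < y)%R%:R.
  have e (k : nat) : r / 2 / 2 ^+ k = r / 2 ^+ bump 0 k.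
    by rewrite /bump leq0n add1n exprS invfM mulrA.
  by apply: eq_bigr => k _; rewrite e.
set S := \sum_(_ < _) _ => h.
have [ry|yr] := ltP r y.
  move: h; rewrite (@min_r _ _ y (r / 2)); last by lra.
  by rewrite mulr1; nra.
rewrite mulr0 add0r (le_trans h)// ler_wpM2l// lerXn2r ?nnegrE//.
  by rewrite le_min y0.
by rewrite ge_min lexx.
Qed.

(** With this t the gain t B is of order eps K t0^2 / a. The exponential moment costs order eps^2 K
    t0^2, beaten by a small [eps]; the other losses are fixed multiples of t0^2, beaten by a large K
    eps. The bound t0 K <= 2 a keeps t below 1/4. *)
Lemma weight_params (gamma a K eps t0 W B : R) :
  0 < gamma -> 1 <= a * gamma -> 1 <= a -> 1 <= K -> 0 < eps ->
  1024 * (8 * a * eps) <= 1 ->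
  (20 + 144 * (8 / gamma) ^+ 2) * (8 * a) <= K * eps ->
  0 < t0 -> t0 <= 1 -> t0 * K <= 2 * a -> gamma <= W ->
  t0 * W <= 2 * B -> B <= t0 * W ->
  let t := eps * K * t0 / (a * W) in
  [/\ 0 <= t <= 1 / 4, t * B <= t0, t * (a * W) <= K / 4,
    t ^+ 2 * (a * W) ^+ 2 / K = eps ^+ 2 * K * t0 ^+ 2 &
    20 * t0 ^+ 2 + 144 * (8 * t0 / gamma) ^+ 2 +
      1024 * (eps ^+ 2 * K * t0 ^+ 2) <= t * B / 2].
Proof.
move=> g0 ag a1 K1 e0 e1 K4 t00 t01 tK gW tW BW t.
have W0 : 0 < W by lra.
have aW : 1 <= a * W by rewrite (le_trans ag)// ler_wpM2l//; lra.
have aW0 : 0 < a * W by lra.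
have K0 : 0 < K by lra.
have ea : a * eps <= 1 / 64 by lra.
have a0 : 0 < a by lra.
have [a00 t000 K00 e00] : [/\ 0 <= a, 0 <= t0, 0 <= K & 0 <= eps].
  by split; exact: ltW.
have ea0 : 0 < a * eps by rewrite mulr_gt0.
have eps_le : eps <= 1 / 64.
  by apply: le_trans ea; rewrite ler_peMl// ltW.
have num : eps * K * t0 <= 2 * (a * eps).
  have -> : eps * K * t0 = eps * (t0 * K) by ring.
  have -> : 2 * (a * eps) = eps * (2 * a) by ring.
  by rewrite ler_wpM2l// ltW.
have num0 : 0 <= eps * K * t0 by rewrite !mulr_ge0.
have tE : t * (a * W) = eps * K * t0 by rewrite /t divfK// gt_eqF.
have t_ge0 : 0 <= t by rewrite divr_ge0// ltW.
have t_le : t <= eps * K * t0 by rewrite ler_pdivrMr// ler_peMr.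
have tBle : t * B <= eps * K * t0 ^+ 2 / a.
  rewrite ler_pdivlMr//; have -> : t * B * a = t * (B * a) by ring.
  apply: (@le_trans _ _ (t * (t0 * W * a))).
    by rewrite ler_wpM2l// ler_wpM2r// ltW.
  have -> : t * (t0 * W * a) = t * (a * W) * t0 by ring.
  by rewrite tE; lra.
have tBge : eps * K * t0 ^+ 2 <= t * B * (2 * a).
  have -> : eps * K * t0 ^+ 2 = t * (t0 * W) * a.
    by rewrite expr2 mulrA -tE; ring.
  have -> : t * B * (2 * a) = t * (2 * B) * a by ring.
  by rewrite ler_wpM2r// ler_wpM2l.
split.
- by rewrite t_ge0/=; lra.
- apply: (le_trans tBle); rewrite ler_pdivrMr//.
  have -> : eps * K * t0 ^+ 2 = eps * K * t0 * t0 by ring.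
  by rewrite (mulrC t0) ler_wpM2r//; lra.
- by rewrite tE; lra.
- by rewrite -exprMn tE; field; rewrite gt_eqF.
- have -> : (8 * t0 / gamma) ^+ 2 = (8 / gamma) ^+ 2 * t0 ^+ 2 by field; rewrite gt_eqF.
  set C := (8 / gamma) ^+ 2 in K4 *.
  have t2 : 0 <= t0 ^+ 2 by exact: sqr_ge0.
  have h1 := ler_wpM2r t2 K4.
  have eKt : 0 <= eps * K * t0 ^+ 2 by rewrite !mulr_ge0.
  have h2 := ler_wpM2r eKt e1.
  rewrite -(@ler_pM2r _ (8 * a)); last by rewrite mulr_gt0.
  move: h1 h2 tBge; rewrite expr2.
  have -> : t * B / 2 * (8 * a) = t * B * (2 * a) * 2 by field.
  move: (t * B * (2 * a)) => q.
  lra.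
Qed.

(** At height [y] the dyadic sum is at most 2 y^2, and the indicator, nonzero only for y > rho, is
    at most y^2 / rho^2; [eta] absorbs the factors 2 * 144 and 4 / rho^2. *)
Lemma level_penalty (rho eta r y S : R) (q : bool) : 0 < rho -> 0 <= r ->
  0 <= eta -> eta * (288 + 4 * rho^-1 ^+ 2) <= 1 -> 0 <= y ->
  S <= 2 * Num.min y r ^+ 2 -> (q -> rho < y) ->
  eta * (144 * S + 4 * q%:R) <= y ^+ 2.
Proof.
move=> g0 r0 e0 e1 y0 Sy qy.
have m2 : Num.min y r ^+ 2 <= y ^+ 2.
  have m0 : 0 <= Num.min y r by rewrite le_min y0.
  have my : Num.min y r <= y by rewrite ge_min lexx.
  by apply: lerXn2r.
have q2 : q%:R <= rho^-1 ^+ 2 * y ^+ 2.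
  case: q qy => [/(_ isT) h|_] /=; last by rewrite mulr_ge0 ?sqr_ge0.
  by rewrite -exprMn exprn_ege1// mulrC ler_pdivlMr// mul1r ltW.
apply: (@le_trans _ _ (eta * (288 + 4 * rho^-1 ^+ 2) * y ^+ 2)).
  rewrite -mulrA ler_wpM2l//; move: (rho^-1 ^+ 2) q2 => z q2; lra.
by rewrite ler_piMl ?sqr_ge0.
Qed.

End pointwise.

(** * Expectations of bounded functions *)

Section expectation.
Context {d : measure_display} {T : measurableType d} {R : realType}.
Variable P : probability T R.
Implicit Types f g : T -> R.

Definition bounded_measurable f :=
  measurable_fun setT f /\ exists M, forall x, `|f x| <= M.

Lemma bounded_measurable_bounded f : bounded_measurable f -> bounded_fun f.
Proof.
move=> [_ [M fM]]; exists M; split; first exact: num_real.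
by move=> y My x _; exact: le_trans (fM x) (ltW My).
Qed.

Lemma bounded_measurable_integrable f : bounded_measurable f ->
  P.-integrable setT (EFin \o f).
Proof.
move=> bf; apply: measurable_bounded_integrable => //.
- by rewrite /= probability_setT ltry.
- by case: bf.
- exact: bounded_measurable_bounded.
Qed.

Lemma bounded_measurable_cst c : bounded_measurable (cst c).
Proof. by split; [exact: measurable_cst|exists `|c|]. Qed.

Lemma bounded_measurableD f g : bounded_measurable f -> bounded_measurable g ->
  bounded_measurable (fun x => f x + g x).
Proof.
move=> [mf [M fM]] [mg [N gN]]; split; first exact: measurable_funD.
by exists (M + N) => x; rewrite (le_trans (ler_normD _ _))// lerD.
Qed.

Lemma bounded_measurableZ c f : bounded_measurable f ->
  bounded_measurable (fun x => c * f x).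
Proof.
move=> [mf [M fM]]; split; first exact: measurable_funM.
by exists (`|c| * M) => x; rewrite normrM ler_wpM2l.
Qed.

Lemma bounded_measurable_sum n (F : nat -> T -> R) :
  (forall k, bounded_measurable (F k)) ->
  bounded_measurable (fun x => \sum_(k < n) F k x).
Proof.
move=> bF; elim: n => [|n IH].
  under eq_fun do rewrite big_ord0; exact: bounded_measurable_cst.
by under eq_fun do rewrite big_ord_recr; exact: bounded_measurableD.
Qed.

Lemma expectation_cst c : \int[P]_x (cst c x) = c.
Proof. by rewrite Rintegral_cst//= probability_setT/= mulr1. Qed.

Lemma expectation_add f g : bounded_measurable f -> bounded_measurable g ->
  \int[P]_x (f x + g x) = \int[P]_x f x + \int[P]_x g x.
Proof. by move=> bf bg; rewrite RintegralD//; exact: bounded_measurable_integrable. Qed.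

Lemma expectation_scale c f : bounded_measurable f ->
  \int[P]_x (c * f x) = c * \int[P]_x f x.
Proof. by move=> bf; rewrite RintegralZl//; exact: bounded_measurable_integrable. Qed.

Lemma expectation_sum n (F : nat -> T -> R) :
  (forall k, bounded_measurable (F k)) ->
  \int[P]_x (\sum_(k < n) F k x) = \sum_(k < n) \int[P]_x F k x.
Proof.
move=> bF; elim: n => [|n IH].
  rewrite big_ord0; under eq_Rintegral do rewrite big_ord0.
  exact: expectation_cst.
under eq_Rintegral do rewrite big_ord_recr.
rewrite big_ord_recr expectation_add ?IH//; exact: bounded_measurable_sum.
Qed.

Lemma expectation_le f g : bounded_measurable f -> bounded_measurable g ->
  (forall x, f x <= g x) -> \int[P]_x f x <= \int[P]_x g x.
Proof.
by move=> bf bg fg; apply: le_Rintegral => //; exact: bounded_measurable_integrable.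
Qed.

Lemma expectation_le_integral f (c : R) : bounded_measurable f ->
  (\int[P]_x (f x)%:E <= c%:E)%E -> \int[P]_x f x <= c.
Proof.
move=> bf; rewrite -lee_fin /Rintegral fineK//.
exact: integrable_fin_num (bounded_measurable_integrable bf).
Qed.

Lemma bounded_measurable_indic (A : set T) : measurable A ->
  bounded_measurable (\1_A : T -> R).
Proof.
move=> mA; split; first exact: measurable_indic.
by exists 1 => x; rewrite indicE; case: (_ \in _); rewrite ?normr1 ?normr0.
Qed.

Lemma expectation_indic (A : set T) : measurable A ->
  \int[P]_x (\1_A x : R) = fine (P A).
Proof. by move=> mA; rewrite /Rintegral integral_indic ?setIT. Qed.

Lemma measurable_le_set (v : T -> R) (c : R) : measurable_fun setT v ->
  measurable [set x | v x <= c].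
Proof.
move=> mv; rewrite -[X in measurable X]setTI.
rewrite (_ : [set x | _] = v @^-1` `]-oo, c]%classic); first exact: mv.
by apply/seteqP; split => x /=; rewrite in_itv.
Qed.

Lemma bounded_measurable_gt (v : T -> R) (c : R) : measurable_fun setT v ->
  bounded_measurable (fun x => (c < v x)%R%:R).
Proof.
move=> mv; split; last first.
  by exists 1 => x; case: (_ < _); rewrite ?normr1 ?normr0.
rewrite (_ : (fun x => _) = \1_(~` [set x | v x <= c])).
  by apply: measurable_indic; apply: measurableC; exact: measurable_le_set.
by apply/funext => x; rewrite indicE in_setC mem_setE/= -ltNge.
Qed.

Lemma expectation_gt (v : T -> R) (c : R) : measurable_fun setT v ->
  \int[P]_x (c < v x)%R%:R = 1 - fine (P [set x | v x <= c]).
Proof.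
move=> mv; have mc := measurable_le_set c mv.
transitivity (\int[P]_x (\1_(~` [set x | v x <= c]) x : R)).
  by apply: eq_Rintegral => x _; rewrite indicE in_setC mem_setE/= -ltNge.
rewrite /Rintegral integral_indic ?setIT//; last exact: measurableC.
by rewrite /= probability_setC// fineB// fin_num_measure.
Qed.

Definition upper_le f (r : R) : Prop :=
  (upper_integral P (fun x => (f x)%:E) <= r%:E)%E.

Lemma upper_le_add f g (r s : R) : (forall x, 0 <= f x) -> (forall x, 0 <= g x) ->
  upper_le f r -> upper_le g s -> upper_le (fun x => f x + g x) (r + s).
Proof.
move=> f0 g0 fr gs.
exact: (@upper_integralD_le _ _ _ P (fun x => (f x)%:E) (fun x => (g x)%:E)).
Qed.

Lemma upper_le_scale c f (r : R) : 0 <= c -> (forall x, 0 <= f x) ->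
  upper_le f r -> upper_le (fun x => c * f x) (c * r).
Proof.
by move=> c0 f0 fr; exact: (@upper_integralZ_le _ _ _ P (fun x => (f x)%:E)).
Qed.

Lemma upper_le_cst c f : (forall x, f x <= c) -> upper_le f c.
Proof. by move=> fc; apply: upper_integral_cst_le => x; rewrite lee_fin. Qed.

Lemma upper_le_trans f g (r s : R) : (forall x, f x <= g x) -> r <= s ->
  upper_le g r -> upper_le f s.
Proof.
move=> fg rs; rewrite /upper_le => gr.
apply: (@le_trans _ _ r%:E); last by rewrite lee_fin.
by apply: le_trans gr; apply: upper_integral_le => x; rewrite lee_fin.
Qed.

Lemma upper_le_null f (c : R) (N : set T) : measurable N -> P N = 0%E ->
  0 <= c -> (forall x, ~ N x -> f x <= c) -> upper_le f c.
Proof.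
move=> mN PN c0 fc; pose h x : \bar R := if x \in N then +oo%E else c%:E.
have mh : measurable_fun setT h.
  apply: measurable_fun_if => //.
  apply: (measurable_fun_bool true); rewrite setTI.
  rewrite (_ : _ @^-1` _ = N)//; apply/seteqP; split => x /=; first by move/set_mem.
  exact: mem_set.
have fh x : ((f x)%:E <= h x)%E.
  rewrite /h; case: ifPn => xN; first by rewrite leey.
  by rewrite lee_fin fc// => /mem_set Nx; rewrite Nx in xN.
apply: le_trans (upper_integral_le_integral P mh fh) _.
rewrite (@ge0_ae_eq_integral _ _ _ P setT h (cst c%:E))//.
- by rewrite integral_cst//= probability_setT mule1.
- by move=> x _; rewrite /h; case: ifP => _; rewrite ?lee_fin.
- exists N; split => // x /=; apply: contra_notP => nN _.
  by rewrite /h memNset.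
Qed.

Lemma upper_le_sum n (F : nat -> T -> R) (r : nat -> R) :
  (forall k x, 0 <= F k x) ->
  (forall k, (k < n)%N -> upper_le (F k) (r k)) ->
  upper_le (fun x => \sum_(k < n) F k x) (\sum_(k < n) r k).
Proof.
move=> F0; elim: n => [|n IH] Fr.
  by apply: upper_le_cst => x; rewrite !big_ord0.
rewrite big_ord_recr/=.
apply: (@upper_le_trans _ (fun x => \sum_(k < n) F k x + F n x)) (lexx _) _.
  by move=> x; rewrite big_ord_recr.
apply: upper_le_add => //; first by move=> x; apply: sumr_ge0.
  by apply: IH => k kn; apply: Fr; exact: ltnW.
exact: Fr.
Qed.

Lemma upper_le_bounded_add f phi F (r s : R) : bounded_measurable phi ->
  (forall x, 0 <= F x) -> upper_le F r -> \int[P]_x phi x + r <= s ->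
  (forall x, f x <= phi x + F x) -> upper_le f s.
Proof.
move=> bphi F0 Fr rs fF; rewrite /upper_le.
apply: (@le_trans _ _ ((\int[P]_x phi x)%R%:E + r%:E)%E).
  apply: (@upper_integral_bounded_add_le _ _ _ _ _ phi (fun x => (F x)%:E)) => //.
  - by case: bphi.
  - exact: bounded_measurable_bounded.
by rewrite -EFinD lee_fin.
Qed.

End expectation.

(** * The inequality in one coordinate *)

(** For b >= 0 the linearization error [Xi] vanishes at [b] and is nonincreasing below it. Extended
    by 0 above [b] it is nonincreasing everywhere, as the comparison with [w] demands. *)
Definition Xi_low (R : realType) (xi : R -> R) (b x : R) : R :=
  if x < b then Xi xi x b else 0.

Definition sqr_low (R : realType) (b x : R) : R := Num.max (b - x) 0 ^+ 2.

Section low_functions.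
Context {R : realType} (theta xi : R -> R) (b : R).
Hypotheses (pr : profile theta xi) (sm : smooth_profile xi) (b0 : 0 <= b).

Lemma Xi_lowE x : 0 <= x < b ->
  Xi_low xi b x = xi x - xi b + xi' xi b * (b - x).
Proof. by move=> /andP[x0 xb]; rewrite /Xi_low xb /Xi max_l//; ring. Qed.

Lemma Xi_low_ge0 x : 0 <= Xi_low xi b x.
Proof.
rewrite /Xi_low; case: ifPn => // xb; rewrite /Xi.
have m0 : 0 <= Num.max x 0 by rewrite le_max lexx orbT.
by have := xi_tangent sm b0 m0; lra.
Qed.

Lemma Xi_low_ni : nonincreasing_fun (Xi_low xi b).
Proof.
move=> x y xy; rewrite [X in X <= _]/Xi_low; case: ifPn => yb; last exact: Xi_low_ge0.
rewrite /Xi_low (le_lt_trans xy yb) /Xi.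
set mx := Num.max x 0; set my := Num.max y 0.
have mx0 : 0 <= mx by rewrite le_max lexx orbT.
have my0 : 0 <= my by rewrite le_max lexx orbT.
have mxy : mx <= my by rewrite ge_max le_max xy/= le_max lexx orbT.
have myb : my <= b by rewrite ge_max (ltW yb).
have := xi_tangent sm my0 mx0; have := xi'_le sm my0 myb => h1 h2.
nra.
Qed.

Lemma Xi_low_ge x : b <= x -> Xi_low xi b x = 0.
Proof. by rewrite /Xi_low ltNge => ->. Qed.

Lemma sqr_low_ge0 x : 0 <= sqr_low b x. Proof. exact: sqr_ge0. Qed.

Lemma sqr_low_ni : nonincreasing_fun (sqr_low b).
Proof.
move=> x y xy; have m0 (z : R) : 0 <= Num.max z 0 by rewrite le_max lexx orbT.
apply: lerXn2r; rewrite ?nnegrE ?m0//.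
by rewrite ge_max m0 andbT le_max lerD2l lerN2 xy.
Qed.

Lemma sqr_low_ge x : b <= x -> sqr_low b x = 0.
Proof. by move=> bx; rewrite /sqr_low max_r ?expr0n//= subr_le0. Qed.

End low_functions.

(** * Second order losses below b, and the median of v *)

Section level_sets.
Context {d : measure_display} {T : measurableType d} {R : realType}.
Variables (P : probability T R) (v g : T -> R).
Variables (theta xi w : R -> R) (gamma b t0 : R).
Hypotheses (gamma0 : 0 < gamma).
Hypotheses (pr : profile theta xi) (sm : smooth_profile xi).
Hypothesis (xi_gamma : gamma * `|xi' xi b| <= `|xi' xi (b + 1)|).
Hypotheses (w0 : {in `]0, 1], forall x, 0 <= w x}).
Hypotheses (wni : {in `]0, 1] &, {homo w : x y /~ x <= y}}).
Hypothesis (w2 :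
  (\int[lebesgue_measure]_(u in `]0%R, 1%R]) (w u ^+ 2)%:E <= 1)%E).
Hypotheses (Hxi : condition_H xi w) (b0 : 0 <= b).
Hypotheses (mv : measurable_fun setT v) (v01 : forall x, 0 <= v x <= b + 1).
Hypotheses (mg : measurable_fun setT g) (g0 : forall x, 0 <= g x <= xi (v x)).
Hypothesis (gE : forall x, v x < b + 1 -> g x = xi (v x)).
Hypothesis (Eg : \int[P]_x g x = xi b).

Let L (c : R) : set T := [set x | v x <= c].
Let wL (c : R) : R := w (Num.min (fine (P (L c))) (1 / 2)).

Hypotheses (t0_gt0 : 0 < t0) (t0_le1 : t0 <= 1).
Hypothesis (t0_ub :
  forall c, c < b -> (0 < P (L c))%E -> b - c <= t0 * wL c).

Let D := - xi' xi b.

Let D_gt0 : 0 < D. Proof. by rewrite oppr_gt0; exact: (xi'_lt0 pr sm). Qed.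

Let normD : `|xi' xi b| = D.
Proof. by rewrite ltr0_norm//; exact: (xi'_lt0 pr sm). Qed.

Lemma bounded_measurable_ni (phi : R -> R) : nonincreasing_fun phi ->
  (forall x, 0 <= phi x) -> bounded_measurable (phi \o v).
Proof.
move=> pni p0; split.
  by apply: measurableT_comp => //; exact: nonincreasing_measurable.
exists (phi 0) => x; rewrite ger0_norm//=.
by apply: pni; have /andP[] := v01 x.
Qed.

Lemma expectation_low (phi : R -> R) (C : R) : nonincreasing_fun phi ->
  (forall x, 0 <= phi x) -> (forall x, b <= x -> phi x = 0) ->
  (\int[lebesgue_measure]_(u in `]0%R, 1%R]) (phi (b - t0 * w u))%:E <= C%:E)%E ->
  \int[P]_x phi (v x) <= 2 * C.
Proof.
move=> pni p0 pb pC.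
apply: expectation_le_integral; first exact: bounded_measurable_ni.
apply: le_trans (@integral_transfer _ _ _ P v b t0 w phi mv _ wni _ p0 pni pb) _.
- exact: ltW.
- by move=> c cb Pc; exact: t0_ub.
- by rewrite EFinM lee_wpmul2l.
Qed.

Lemma expectation_Xi_low : \int[P]_x Xi_low xi b (v x) <= 2 * (t0 ^+ 2 * D).
Proof.
apply: expectation_low.
- exact: (Xi_low_ni sm b0).
- exact: (Xi_low_ge0 sm b0).
- exact: Xi_low_ge.
have := @Hxi b t0 b0; rewrite (ltW t0_gt0) t0_le1 normD => /(_ isT).
apply: le_trans; rewrite le_eqVlt; apply/orP; left; apply/eqP.
apply: eq_integral => u; rewrite inE/= => u01.
have := w0 u01; rewrite /Xi_low; case: ltP => // h wu.
have twu : 0 <= t0 * w u by rewrite mulr_ge0// ltW.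
have -> : b - t0 * w u = b by lra.
by rewrite /Xi max_l// !subrr mul0r subr0.
Qed.

Lemma expectation_sqr_low : \int[P]_x sqr_low b (v x) <= 2 * t0 ^+ 2.
Proof.
apply: expectation_low; [exact: sqr_low_ni|exact: sqr_low_ge0|exact: sqr_low_ge|].
have -> : (\int[lebesgue_measure]_(u in `]0%R, 1%R])
    (sqr_low b (b - t0 * w u))%:E = \int[lebesgue_measure]_(u in `]0%R, 1%R])
    ((t0 ^+ 2)%:E * (w u ^+ 2)%:E))%E.
  apply: eq_integral => u; rewrite inE/= => u01; rewrite -EFinM /sqr_low.
  have twu : 0 <= t0 * w u by rewrite mulr_ge0 ?w0// ltW.
  rewrite max_l; last by lra.
  by congr (_%:E); ring.
rewrite ge0_integralZl_EFin//.
- by rewrite -[leRHS]mule1 lee_wpmul2l// lee_fin sqr_ge0.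
- by move=> u _; rewrite lee_fin sqr_ge0.
- apply/measurable_EFinP; apply: measurable_funX.
  apply: nonincreasing_in_measurable; first exact: interval_is_interval.
  by move=> x y; rewrite !inE => x01 y01 xy; exact: wni.
- exact: sqr_ge0.
Qed.

Let delta := 8 * t0 / gamma.

Let Gam x := (xi b - g x) / D.

(** [g] has mean xi(b). If {v > c} had measure above 1/2, the drop of [g] there would average more
    than gamma D (c - b) / 2 > 4 D t0. The points below [b], whose excess is D (b - v) plus [Xi],
    can return at most 7/2 D t0. This fixes the 8 in [delta]. *)
Lemma median_level c : bounded_measurable Gam -> \int[P]_x Gam x = 0 ->
  b + delta < c -> c <= b + 1 -> ((1 / 2)%:E <= P (L c))%E.
Proof.
move=> bGam E_Gam bc cb1.
have PLc : P (L c) = (fine (P (L c)))%:E.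
  by rewrite fineK// fin_num_measure//; exact: measurable_le_set.
rewrite PLc lee_fin leNgt; apply/negP => Pc.
have delta0 : 0 < delta by rewrite divr_gt0// mulr_gt0.
have bc' : b <= c by lra.
pose phi1 := Xi_low xi b; pose phi2 := sqr_low b.
pose lo x := gamma * D * (c - b) * (c < v x)%R%:R.
pose hi x := (D * Gam x + phi1 (v x)) + (cst (D * t0 / 2) x + D / t0 / 2 * phi2 (v x)).
have b1 : bounded_measurable (phi1 \o v).
  apply: bounded_measurable_ni; [exact: (Xi_low_ni sm b0)|exact: (Xi_low_ge0 sm b0)].
have b2 : bounded_measurable (phi2 \o v).
  by apply: bounded_measurable_ni; [exact: sqr_low_ni|exact: sqr_low_ge0].
have bg := bounded_measurable_gt c mv.
have bG := bounded_measurableZ D bGam.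
have bhi1 := bounded_measurableD bG b1.
have bhi2 := bounded_measurableD (bounded_measurable_cst (D * t0 / 2))
  (bounded_measurableZ (D / t0 / 2) b2).
have : \int[P]_x lo x <= \int[P]_x hi x.
  apply: expectation_le; [exact: bounded_measurableZ|exact: bounded_measurableD|].
  move=> x; rewrite /lo /hi /Gam [D * (_ / _)]mulrC divfK ?gt_eqF//=.
  have /andP[vx0 vx1] := v01 x.
  have D0 := D_gt0.
  have [vb|vb] := ltP (v x) b.
    rewrite ltNge (le_trans (ltW vb))//= mulr0.
    rewrite /phi1 Xi_lowE ?vx0// gE; last by rewrite (lt_trans vb)// ltrDl.
    rewrite /phi2 /sqr_low max_l; last by rewrite subr_ge0 ltW.
    (* Arithmetic-geometric mean inequality at scale t0: the first moment of b - v is read off from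
       the second, which the integral of w^2 controls. *)
    have : 2 * (b - v x) <= t0 + (b - v x) ^+ 2 / t0.
      rewrite -subr_ge0.
      have -> : t0 + (b - v x) ^+ 2 / t0 - 2 * (b - v x) =
        (t0 - (b - v x)) ^+ 2 / t0 by field; rewrite gt_eqF.
      by rewrite divr_ge0 ?sqr_ge0// ltW.
    move=> /(ler_wpM2l (ltW D0)) h.
    have e : D / t0 / 2 * (b - v x) ^+ 2 = D * ((b - v x) ^+ 2 / t0) / 2 by ring.
    rewrite e; move: h; rewrite /D.
    move: ((b - v x) ^+ 2 / t0) (b - v x) => q r h; lra.
  have gx : g x <= xi b.
    by have /andP[_ h] := g0 x; rewrite (le_trans h)// (xi_le pr).
  have r0 : 0 <= D * t0 / 2 + D / t0 / 2 * phi2 (v x).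
    have t00 := ltW t0_gt0; have D00 := ltW D0.
    apply: addr_ge0; first by rewrite !mulr_ge0 ?invr_ge0.
    by apply: mulr_ge0; [rewrite !mulr_ge0 ?invr_ge0|exact: sqr_low_ge0].
  rewrite /phi1 Xi_low_ge// addr0.
  have [cv|vc] := ltP c (v x); last by rewrite mulr0 addr_ge0// subr_ge0.
  rewrite mulr1.
  have h1 : gamma * D * (c - b) <= xi b - xi c.
    by apply: (xi_drop_lin pr sm b0 _ xi_gamma); rewrite bc' cb1.
  have c_ge0 : 0 <= c by rewrite (le_trans b0).
  have h2 := xi_le pr c_ge0 (ltW cv); have /andP[_ h3] := g0 x.
  by lra.
rewrite expectation_scale// expectation_gt//.
rewrite (expectation_add _ bhi1 bhi2) (expectation_add _ bG b1).
rewrite (expectation_add _ (bounded_measurable_cst (D * t0 / 2))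
  (bounded_measurableZ (D / t0 / 2) b2)).
rewrite (expectation_scale _ D bGam) (expectation_scale _ (D / t0 / 2) b2).
rewrite E_Gam expectation_cst mulr0 add0r => h.
have h1 : \int[P]_x phi1 (v x) <= 2 * (t0 ^+ 2 * D) by exact: expectation_Xi_low.
have h2 : \int[P]_x phi2 (v x) <= 2 * t0 ^+ 2 by exact: expectation_sqr_low.
have D0 := D_gt0; have D00 := ltW D0.
have h3 : D / t0 / 2 * \int[P]_x phi2 (v x) <= D * t0.
  apply: (@le_trans _ _ (D / t0 / 2 * (2 * t0 ^+ 2))).
    by rewrite ler_wpM2l// !mulr_ge0 ?invr_ge0// ltW.
  by rewrite le_eqVlt; apply/orP; left; apply/eqP; field; rewrite gt_eqF.
have h4 : D * t0 ^+ 2 <= D * t0.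
  by rewrite ler_wpM2l// expr2 ler_piMl// ltW.
have h5 : D * (8 * t0) < D * (gamma * (c - b)).
  rewrite ltr_pM2l// -ltr_pdivrMl// mulrC -/delta; lra.
have h6 : gamma * D * (c - b) * (1 / 2) <=
    gamma * D * (c - b) * (1 - fine (P [set x | v x <= c])).
  apply: ler_wpM2l; last by move: Pc; rewrite /L; lra.
  by rewrite !mulr_ge0 ?subr_ge0// ltW.
have h7 := mulr_gt0 D0 t0_gt0.
lra.
Qed.

End level_sets.

(* In the application, [g] is the measure of the sections of a set of measure
   [xi b], [v] is [theta (g)] cut off at [b + 1], [J] is the inner integral divided
   by [expR b], and [p B] is the cost of reaching the set [B]. *)
Section one_coordinate.
Context {d : measure_display} {T : measurableType d} {R : realType}.
Variables (P : probability T R) (p : set T -> T -> R) (v g J : T -> R).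
Variables (theta xi w : R -> R) (gamma a s K b eta eps rho r0 : R).
Hypotheses (gamma01 : 0 < gamma <= 1) (a1 : 1 <= a) (ag1 : 1 <= a * gamma) (s1 : 1 <= s).
Hypotheses (r0E : r0 = 1 / 288) (rhoE : rho = gamma * r0 / 2).
Hypotheses (K1 : 18 * a <= rho * gamma * K).
Hypotheses (K2 : 288 * s ^+ 2 <= K) (K3 : s <= rho * K).
Hypotheses (eps0 : 0 < eps) (eps1 : 1024 * (8 * a * eps) <= 1).
Hypothesis (K4 : (20 + 144 * (8 / gamma) ^+ 2) * (8 * a) <= K * eps).
Hypotheses (eta0 : 0 <= eta) (eta1 : 5 * eta <= gamma * r0).
Hypothesis (eta2 : eta * (288 + 4 * rho^-1 ^+ 2) <= 1).
Hypotheses (pr : profile theta xi) (sm : smooth_profile xi).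
Hypothesis (xi_gamma :
  forall x, 0 <= x -> gamma * `|xi' xi x| <= `|xi' xi (x + 1)|).
Hypotheses (w0 : {in `]0, 1], forall x, 0 <= w x}).
Hypotheses (wni : {in `]0, 1] &, {homo w : x y /~ x <= y}}).
Hypotheses (wgamma : gamma <= w (1 / 2)).
Hypothesis (w2 :
  (\int[lebesgue_measure]_(u in `]0%R, 1%R]) (w u ^+ 2)%:E <= 1)%E).
Hypotheses (Hxi : condition_H xi w) (b0 : 0 <= b).
Hypotheses (mv : measurable_fun setT v) (v01 : forall x, 0 <= v x <= b + 1).
Hypotheses (mg : measurable_fun setT g) (g0 : forall x, 0 <= g x <= xi (v x)).
Hypothesis (gE : forall x, v x < b + 1 -> g x = xi (v x)).
Hypothesis (Eg : \int[P]_x g x = xi b).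

Let L (c : R) : set T := [set x | v x <= c].
Let wL (c : R) : R := w (Num.min (fine (P (L c))) (1 / 2)).

Hypotheses (p1 : forall B x, 1 <= p B x).
Hypothesis (pexp : forall c, (0 < P (L c))%E ->
  upper_le P (fun x => expR (p (L c) x / 2)) (expR (a * wL c))).
Hypothesis (ptail : forall c, ((1 / 2)%:E <= P (L c))%E ->
  upper_le P (fun x => if s <= p (L c) x then expR (p (L c) x / 2) else 0)
    (eta * (1 - fine (P (L c))))).
Hypothesis (Jlow : forall x c t, L c !=set0 -> c < b + 1 -> v x < b + 1 ->
  0 <= t <= 1 -> J x <= expR ((1 - t) * (v x - b) + t * (c - b) +
    Num.min (t * p (L c) x / K) (t ^+ 2 * p (L c) x ^+ 2 / K))).
Hypothesis (Jhigh : forall x c, L c !=set0 -> c < b + 1 ->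
  J x <= expR (c - b + p (L c) x / K)).

Let K_ge288 : 288 <= K.
Proof.
have : 1 <= s ^+ 2 by rewrite exprn_ege1.
have := K2; lra.
Qed.

Let K_gt0 : 0 < K. Proof. by move: K_ge288; lra. Qed.

Let mL c : measurable (L c). Proof. exact: measurable_le_set. Qed.

Let PL c : P (L c) = (fine (P (L c)))%:E.
Proof. by rewrite fineK// fin_num_measure. Qed.

Let L_neq0 c : (0 < P (L c))%E -> L c !=set0.
Proof.
by move=> Pc; apply/set0P/negP => /eqP L0; move: Pc; rewrite L0 measure0 ltxx.
Qed.

Let wL_ge c : (0 < P (L c))%E -> gamma <= wL c.
Proof.
rewrite PL lte_fin => Pc; apply: (le_trans wgamma).
have h0 : 0 < 1 / 2 :> R by lra.
have h1 : 1 / 2 <= 1 :> R by lra.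
apply: wni.
- by rewrite in_itv/= h0 h1.
- by rewrite in_itv/= lt_min Pc h0 ge_min h1 orbT.
- by rewrite ge_min lexx orbT.
Qed.

Let J_le_self x : v x < b + 1 -> J x <= expR (v x - b).
Proof.
move=> vx; have := @Jlow x (v x) 0 _ vx vx.
rewrite lexx ler01 => /(_ _ isT) h.
have := h; rewrite subr0 mul1r !mul0r expr0n/= !mul0r minxx !addr0; apply.
by exists x; rewrite /L/=.
Qed.

Let D := - xi' xi b.

Let D_gt0 : 0 < D. Proof. by rewrite oppr_gt0; exact: (xi'_lt0 pr sm). Qed.

Let normD : `|xi' xi b| = D.
Proof. by rewrite ltr0_norm//; exact: (xi'_lt0 pr sm). Qed.

Let bounded_g : bounded_measurable g.
Proof.
split => //; exists 1 => x; have /andP[h1 h2] := g0 x.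
rewrite ger0_norm// (le_trans h2)//.
have := xi_range pr; move=> /(_ (v x)); rewrite !in_itv/= andbT.
by have /andP[-> _] := v01 x; move=> /(_ isT)/andP[].
Qed.

Let Gam x := (xi b - g x) / D.

Let bounded_Gam : bounded_measurable Gam.
Proof.
rewrite (_ : Gam = fun x => D^-1 * (cst (xi b) x + (-1) * g x)).
  apply: bounded_measurableZ; apply: bounded_measurableD.
    exact: bounded_measurable_cst.
  exact: bounded_measurableZ.
by apply/funext => x; rewrite /Gam mulN1r mulrC.
Qed.

Let E_Gam : \int[P]_x Gam x = 0.
Proof.
rewrite (_ : Gam = fun x => D^-1 * (cst (xi b) x + (-1) * g x)); last first.
  by apply/funext => x; rewrite /Gam mulN1r mulrC.
rewrite expectation_scale ?expectation_add ?expectation_scale ?expectation_cst//.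
- by rewrite Eg mulN1r subrr mulr0.
- exact: bounded_measurable_cst.
- exact: bounded_measurableZ.
- apply: bounded_measurableD; first exact: bounded_measurable_cst.
  exact: bounded_measurableZ.
Qed.

Let g_le x : b <= v x -> g x <= xi b.
Proof.
by move=> bv; have /andP[_ h] := g0 x; rewrite (le_trans h)// (xi_le pr).
Qed.

(** Without mass below [b], g <= xi(b) almost everywhere; the mean of [g] being xi(b), equality
    holds almost everywhere, which forces v <= b and J <= 1. Here the least t0 would be 0, and there
    is no lower level to move to. *)
Lemma degenerate_case : (forall c, c < b -> P (L c) = 0%E) -> upper_le P J 1.
Proof.
move=> Pb.
have invn0 n : 0 < n.+1%:R^-1 :> R by rewrite invr_gt0.
have mlt (f : T -> R) c : measurable_fun setT f -> measurable [set x | f x < c].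
  move=> mf; rewrite -[X in measurable X]setTI.
  rewrite (_ : [set x | _] = f @^-1` `]-oo, c[%classic); first exact: mf.
  by apply/seteqP; split => x /=; rewrite in_itv.
have null_lt (f : T -> R) c : measurable_fun setT f ->
    (forall n, P [set x | f x <= c - n.+1%:R^-1] = 0%E) ->
    P [set x | f x < c] = 0%E.
  move=> mf Pf; apply/(negligibleP _ (mlt _ c mf)).
  have -> : [set x | f x < c] = \bigcup_n [set x | f x <= c - n.+1%:R^-1].
    apply/seteqP; split => x /=.
      rewrite -subr_gt0 => /ltr_add_invr[n]; rewrite add0r => hn.
      by exists n => //=; rewrite lerBrDr -lerBrDl ltW.
    move=> [n _] /= fx; rewrite (le_lt_trans fx)//.
    by rewrite ltrBlDr ltrDl.
  apply: negligible_bigcup => n; apply/negligibleP; last exact: Pf.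
  exact: measurable_le_set.
have Nlt : P [set x | v x < b] = 0%E.
  by apply: null_lt => // n; apply: Pb; rewrite ltrBlDr ltrDl.
have Ngt : P [set x | g x < xi b] = 0%E.
  apply: null_lt => // n; set A := [set x | _].
  have mA : measurable A by exact: measurable_le_set.
  have bA := bounded_measurable_indic mA.
  have bN := bounded_measurable_indic (mlt _ b mv).
  have bG : bounded_measurable (fun x => D * Gam x) by exact: bounded_measurableZ.
  have [e e0 [e1 AE]] : exists2 e : R, 0 < e &
      e <= 1 /\ (forall x, A x -> g x <= xi b - e).
    by exists n.+1%:R^-1 => //; rewrite invf_le1// ler1n.
  have h : e * fine (P A) <= 0.
    rewrite -(expectation_indic P mA) -expectation_scale//.
    (* The indicator of the null set {v < b} makes the comparison with D Gam hold at every point and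
       adds nothing to the mean. *)
    rewrite [leRHS](_ : _ = \int[P]_x (D * Gam x + \1_[set x | v x < b] x)).
      apply: expectation_le; [exact: bounded_measurableZ|exact: bounded_measurableD|].
      move=> x; rewrite !indicE /Gam [D * _]mulrC divfK ?gt_eqF//.
      have xib : 0 <= xi b.
        have := xi_range pr; move=> /(_ b); rewrite !in_itv/= b0.
        by move=> /(_ isT)/andP[/ltW].
      have g1 : g x <= 1.
        have /andP[_ h2] := g0 x; rewrite (le_trans h2)//.
        have := xi_range pr; move=> /(_ (v x)); rewrite !in_itv/= andbT.
        by have /andP[-> _] := v01 x; move=> /(_ isT)/andP[].
      have [vx|vx] := ltP (v x) b.
        rewrite [X in _ + X](_ : _ = 1); last by rewrite mem_set.
        case: (boolP (x \in A)) => [/set_mem|_]; last by rewrite /= mulr0; lra.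
        by move/AE; rewrite /= mulr1; lra.
      rewrite [X in _ + X](_ : _ = 0); last by rewrite memNset//= ltNge vx.
      have gx := g_le vx.
      case: (boolP (x \in A)) => [/set_mem|_]; last by rewrite /= mulr0; lra.
      by move/AE; rewrite /= mulr1; lra.
    rewrite expectation_add// expectation_scale// E_Gam mulr0 add0r.
    by rewrite expectation_indic ?Nlt//; exact: mlt.
  have P0 : 0 <= fine (P A) by exact: fine_ge0.
  have : fine (P A) = 0.
    by apply/eqP; rewrite eq_le P0 andbT; nra.
  by move=> h0; rewrite -[LHS]fineK ?h0// fin_num_measure.
apply: (@upper_le_null _ _ _ _ _ _ [set x | g x < xi b]) => // [|x /=].
  exact: mlt.
move=> /negP; rewrite -leNgt => gx.
have vb : v x <= b.
  rewrite leNgt; apply/negP => bv.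
  have := xi_lt pr b0 bv; have /andP[_] := g0 x; lra.
apply: le_trans (J_le_self _) _; first lra.
by rewrite -expR0 ler_expR subr_le0.
Qed.

(** Moving with t = 1 to level [c] gains exp(c - b) and costs exp(p/K). As p/K is 2/K times p/2 and
    exp(p/2 - Lam) has mean at most 1, convexity bounds the mean of exp(p/K) by exp(2 Lam / K). A
    level deeper than 2 Lam / K therefore already wins. *)
Lemma weight_bound c : c < b -> (0 < P (L c))%E ->
  b - c <= 2 * a * wL c / K \/ upper_le P J 1.
Proof.
move=> cb Pc; have [|h] := leP (b - c) (2 * a * wL c / K); first by left.
right; set Lam := a * wL c.
have th : 0 <= 2 / K <= 1.
  rewrite divr_ge0 ?(ltW K_gt0)//= ler_pdivrMr// mul1r.
  by have := K_ge288; lra.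
have /andP[th0 th1] := th.
pose C := expR (c - b + 2 / K * Lam).
have C1 : C <= 1.
  have e : 2 / K * Lam = 2 * a * wL c / K by rewrite /Lam; ring.
  by rewrite /C -[leRHS]expR0 ler_expR e; lra.
have C0 : 0 <= C by exact: expR_ge0.
apply: (@upper_le_trans _ _ _ _ _ (fun x => C * ((1 - 2 / K) +
    2 / K * expR (- Lam) * expR (p (L c) x / 2))) (C * ((1 - 2 / K) +
    2 / K * expR (- Lam) * expR Lam))).
- move=> x; apply: le_trans (Jhigh x (L_neq0 Pc) _) _; first lra.
  have := @expR_scale_le _ (2 / K) (p (L c) x / 2 - Lam) th => h2.
  rewrite [expR (p (L c) x / 2 - Lam)]expRD in h2.
  have -> : c - b + p (L c) x / K =
      (c - b + 2 / K * Lam) + 2 / K * (p (L c) x / 2 - Lam).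
    by field; rewrite gt_eqF.
  rewrite expRD ler_wpM2l ?expR_ge0// (le_trans h2)//.
  by rewrite -mulrA (mulrC (expR (- Lam))).
- by rewrite -mulrA -expRD addNr expR0 mulr1 subrK mulr1.
- apply: upper_le_scale => //.
    by move=> x; rewrite addr_ge0 ?mulr_ge0 ?expR_ge0//; lra.
  apply: upper_le_add => //.
  + by move=> _; lra.
  + by move=> x; rewrite mulr_ge0 ?expR_ge0// mulr_ge0 ?expR_ge0.
  + by apply: upper_le_cst.
  + apply: upper_le_scale; first by rewrite mulr_ge0 ?expR_ge0.
      by move=> x; exact: expR_ge0.
    exact: pexp.
Qed.

Lemma nondegenerate_case (t0 c0 : R) : 0 < t0 -> t0 <= 2 * a / K ->
  (forall c, c < b -> (0 < P (L c))%E -> b - c <= t0 * wL c) ->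
  c0 < b -> (0 < P (L c0))%E -> t0 * wL c0 <= 2 * (b - c0) ->
  upper_le P J 1.
Proof.
move=> t0_gt0 t0K t0_ub c0b Pc0 c0t0.
have /andP[gam0 gam1] := gamma01.
have D0 := D_gt0; have K0 := K_gt0.
have half1 : 1 / 2 < 1 :> R by lra.
have half0 : 0 < 1 / 2 :> R by lra.
have quarter_lt1 : 1 / 4 < 1 :> R by lra.
have quarter1 := ltW quarter_lt1.
have quarter72 : 1 / 72 <= 1 / 4 :> R by lra.
have b_gt0 : 0 < b.
  have [x] := L_neq0 Pc0; rewrite /L/= => vx.
  by have /andP[h _] := v01 x; rewrite (le_lt_trans _ c0b)// (le_trans h).
have t0K' : t0 * K <= 2 * a by rewrite -ler_pdivlMr.
have r00 : 0 < r0 by rewrite r0E; lra.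
have r01 : r0 <= 1 / 2 by rewrite r0E; lra.
have rho0 : 0 < rho by rewrite rhoE !mulr_gt0// invr_gt0.
pose r (k : nat) : R := r0 / 2 ^+ k.
pose delta := 8 * t0 / gamma.
have delta0 : 0 < delta by rewrite divr_gt0// mulr_gt0.
have delta_rho : delta < rho.
  rewrite /delta ltr_pdivrMr// -(ltr_pM2r K0).
  by have h := K1; have h2 := a1; lra.
have rho_r0 : 2 * rho <= r0.
  have -> : 2 * rho = gamma * r0 by rewrite rhoE; field.
  by rewrite ler_piMl// ltW.
have t01 : t0 <= 1.
  have : delta < 1 by lra.
  by rewrite /delta ltr_pdivrMr// mul1r; lra.
have delta_r : delta < r0 by lra.
(* The finest scale lies in ]delta, 2 delta]: every scale exceeds [delta], so [median_level] applies
   to each b + r k, and every height between 4 delta and 4 r0 has a comparable scale. *)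
have [n /andP[rn1 rn2]] := dyadic_scale delta0 delta_r.
have r_ge k : (k <= n)%N -> delta < r k.
  move=> kn; apply: (lt_le_trans rn1); rewrite /r ler_pM2l//.
  by rewrite lef_pV2 ?posrE ?exprn_gt0// ler_eXn2l// ltr1n.
have r_le k : r k <= r0.
  rewrite /r ler_pdivrMr ?exprn_gt0// ler_peMr//; first exact: ltW.
  by rewrite exprn_ege1// ler1n.
have r_gt0 k : 0 < r k by rewrite /r divr_gt0// exprn_gt0.
have K_ge1 : 1 <= K by have := K_ge288; lra.
have wL0 := wL_ge Pc0.
have Bt0 := t0_ub _ c0b Pc0.
pose B := b - c0; pose Lam := a * wL c0; pose t := eps * K * t0 / Lam.
have [t_range tB tLam tLamE tgain] := weight_params gam0 ag1 a1 K_ge1 eps0 eps1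
  K4 t0_gt0 t01 t0K' wL0 c0t0 Bt0.
rewrite -/Lam -/t -/B in t_range tB tLam tLamE tgain.
have Lam1 : 1 <= Lam.
  by rewrite (le_trans ag1)// ler_wpM2l// (le_trans ler01).
have B0 : 0 <= B by rewrite subr_ge0 ltW.
have t1 : 0 <= t <= 1.
  by have /andP[-> h] := t_range; rewrite (le_trans h)// quarter1.
have t_ge0 : 0 <= t by have /andP[] := t1.
(* The exceptional part of exp(p/2). It is at least 1 where s <= p, so it also dominates the
   indicator of the exceptional set. *)
pose q c x := if s <= p (L c) x then expR (p (L c) x / 2) else 0.
have q0 c x : 0 <= q c x by rewrite /q; case: ifP => _ //; exact: expR_ge0.
pose C := 256 * (t ^+ 2 * Lam ^+ 2 / K).
have C0 : 0 <= C.
  have K00 := ltW K0; have h1 := sqr_ge0 t; have h2 := sqr_ge0 Lam.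
  by rewrite /C; apply: mulr_ge0; [exact: ler0n|apply: divr_ge0; [apply: mulr_ge0|]].
pose Q x := C * (1 + expR (- Lam) * expR (p (L c0) x / 2)).
have Q0 x : 0 <= Q x.
  by rewrite mulr_ge0// addr_ge0// mulr_ge0 ?expR_ge0.
pose bet x := \sum_(k < n.+1) r k ^+ 2 * q (b + r k) x.
have bet0 x : 0 <= bet x by apply: sumr_ge0 => k _; rewrite mulr_ge0 ?sqr_ge0.
pose F x := 2 * Q x + (144 * bet x + 4 * q (b + rho) x).
(* The mean of [Theta] is exactly the bound that the tail hypothesis gives for the last two terms of
   [F]; subtracted in [Phi], it cancels them. Pointwise it is at most max(v - b, 0)^2, and at most
   g1/4 at the high points. *)
pose Theta x := eta * (144 * (\sum_(k < n.+1) r k ^+ 2 * (b + r k < v x)%R%:R) +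
  4 * (b + rho < v x)%R%:R).
pose A := 1 - t * B / 2 + 4 * t0 ^+ 2 + 144 * delta ^+ 2.
pose Phi x := (cst A x + (1 - t / 2) * Gam x) + ((D^-1 * Xi_low xi b (v x) +
  7 * sqr_low b (v x)) + (-1) * Theta x).
have mem_level c : b + delta < c -> c <= b + 1 -> ((1 / 2)%:E <= P (L c))%E.
  move=> h1 h2; apply: (@median_level _ _ _ P v g theta xi w gamma b t0) => //.
  exact: xi_gamma.
have half_gt0 c : ((1 / 2)%:E <= P (L c))%E -> L c !=set0.
  by move=> h; apply: L_neq0; exact: lt_le_trans h.
have rk1 k : b + r k < b + 1 by rewrite ltrD2l (le_lt_trans (r_le k))// (le_lt_trans r01).
have rho_1 : b + rho < b + 1.
  rewrite ltrD2l (le_lt_trans _ half1)// (le_trans _ r01)// (le_trans _ rho_r0)//.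
  by rewrite ler_peMl ?ler1n// ltW.
have rk_level k : (k <= n)%N -> ((1 / 2)%:E <= P (L (b + r k)))%E.
  by move=> kn; apply: mem_level; rewrite ?ltrD2l ?r_ge//; exact: ltW.
have rho_level : ((1 / 2)%:E <= P (L (b + rho)))%E.
  by apply: mem_level; rewrite ?ltrD2l//; exact: ltW.
have bound_Theta : bounded_measurable Theta.
  apply: bounded_measurableZ; apply: bounded_measurableD.
    apply: bounded_measurableZ.
    apply: (@bounded_measurable_sum _ _ _ n.+1
      (fun k x => r k ^+ 2 * (b + r k < v x)%R%:R)).
    by move=> k; apply: bounded_measurableZ; exact: bounded_measurable_gt.
  by apply: bounded_measurableZ; exact: bounded_measurable_gt.
have E_Theta : \int[P]_x Theta x =
    eta * (144 * (\sum_(k < n.+1) r k ^+ 2 * (1 - fine (P (L (b + r k))))) +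
      4 * (1 - fine (P (L (b + rho))))).
  have bs : bounded_measurable (fun x =>
      \sum_(k < n.+1) r k ^+ 2 * (b + r k < v x)%R%:R).
    apply: (@bounded_measurable_sum _ _ _ n.+1
      (fun k x => r k ^+ 2 * (b + r k < v x)%R%:R)).
    by move=> k; apply: bounded_measurableZ; exact: bounded_measurable_gt.
  have b4 := bounded_measurable_gt (b + rho) mv.
  rewrite (expectation_scale P eta (bounded_measurableD
    (bounded_measurableZ 144 bs) (bounded_measurableZ 4 b4))).
  rewrite (expectation_add P (bounded_measurableZ 144 bs)
    (bounded_measurableZ 4 b4)).
  rewrite (expectation_scale P 144 bs) (expectation_scale P 4 b4).
  rewrite expectation_gt//; congr (_ * (_ * _ + _)).
  rewrite (@expectation_sum _ _ _ P n.+1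
    (fun k x => r k ^+ 2 * (b + r k < v x)%R%:R)); last first.
    by move=> k; apply: bounded_measurableZ; exact: bounded_measurable_gt.
  apply: eq_bigr => k _; rewrite expectation_scale ?expectation_gt//.
  exact: bounded_measurable_gt.
have bXi : bounded_measurable (Xi_low xi b \o v).
  apply: (bounded_measurable_ni mv v01); first exact: (Xi_low_ni sm b0).
  exact: (Xi_low_ge0 sm b0).
have bsq : bounded_measurable (sqr_low b \o v).
  apply: (bounded_measurable_ni mv v01); first exact: sqr_low_ni.
  exact: sqr_low_ge0.
have bP1 := bounded_measurableD (bounded_measurable_cst A)
  (bounded_measurableZ (1 - t / 2) bounded_Gam).
have bP2 := bounded_measurableD (bounded_measurableZ D^-1 bXi)
  (bounded_measurableZ 7 bsq).
have bP3 := bounded_measurableZ (-1) bound_Theta.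
have bPhi : bounded_measurable Phi.
  exact: bounded_measurableD bP1 (bounded_measurableD bP2 bP3).
have E_Phi : \int[P]_x Phi x <= A + 16 * t0 ^+ 2 - \int[P]_x Theta x.
  rewrite /Phi (expectation_add P bP1 (bounded_measurableD bP2 bP3)).
  rewrite (expectation_add P bP2 bP3) (expectation_scale P _ bound_Theta).
  rewrite (expectation_add P (bounded_measurable_cst A)
    (bounded_measurableZ (1 - t / 2) bounded_Gam)).
  rewrite (expectation_add P (bounded_measurableZ D^-1 bXi)
    (bounded_measurableZ 7 bsq)).
  rewrite (expectation_scale P _ bounded_Gam) (expectation_scale P _ bXi).
  rewrite (expectation_scale P _ bsq) E_Gam expectation_cst mulr0 addr0 mulN1r.
  rewrite addrA lerD2r lerD2l.
  have -> : 16 * t0 ^+ 2 = D^-1 * (2 * (t0 ^+ 2 * D)) + 7 * (2 * t0 ^+ 2).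
    by field; rewrite gt_eqF.
  apply: lerD.
    apply: ler_wpM2l; first by rewrite invr_ge0 ltW.
    by apply: (@expectation_Xi_low _ _ _ P v theta xi w).
  rewrite ler_wpM2l//.
  by apply: (@expectation_sqr_low _ _ _ P v w).
have F01 x : 0 <= 2 * Q x by apply: mulr_ge0; [exact: ler0n|exact: Q0].
have F02 x : 0 <= 144 * bet x.
  by apply: mulr_ge0; [exact: ler0n|exact: bet0].
have F03 x : 0 <= 4 * q (b + rho) x.
  by apply: mulr_ge0; [exact: ler0n|exact: q0].
have F023 x : 0 <= 144 * bet x + 4 * q (b + rho) x by exact: addr_ge0.
have F0 x : 0 <= F x by exact: addr_ge0.
have F_le : upper_le P F (2 * (C * 2) + \int[P]_x Theta x).
  apply: upper_le_add.
  - exact: F01.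
  - exact: F023.
  - apply: upper_le_scale; [exact: ler0n|exact: Q0|].
    apply: upper_le_scale; first exact: C0.
      by move=> x; rewrite addr_ge0// mulr_ge0 ?expR_ge0.
    apply: upper_le_add.
    + by [].
    + by move=> x; rewrite mulr_ge0 ?expR_ge0.
    + exact: (@upper_le_cst _ _ _ P 1 (fun=> 1) (fun=> lexx 1)).
    + rewrite [X in upper_le _ _ X](_ : _ = expR (- Lam) * expR Lam); last first.
        by rewrite -expRD addNr expR0.
      apply: upper_le_scale; [exact: expR_ge0|by move=> x; exact: expR_ge0|].
      exact: pexp.
  - rewrite E_Theta mulrDr [eta * (144 * _)]mulrCA [eta * (4 * _)]mulrCA.
    apply: upper_le_add.
    + exact: F02.
    + exact: F03.
    + apply: upper_le_scale; [exact: ler0n|exact: bet0|].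
      rewrite mulr_sumr; apply: (@upper_le_sum _ _ _ P n.+1
        (fun k x => r k ^+ 2 * q (b + r k) x)
        (fun k => eta * (r k ^+ 2 * (1 - fine (P (L (b + r k))))))).
        by move=> k x; rewrite mulr_ge0 ?sqr_ge0.
      move=> k kn; rewrite mulrCA; apply: upper_le_scale.
      * exact: sqr_ge0.
      * exact: q0.
      exact: ptail (rk_level k kn).
    + apply: upper_le_scale; [exact: ler0n|exact: q0|].
      exact: ptail rho_level.
apply: (upper_le_bounded_add bPhi F0 F_le).
  apply: (@le_trans _ _ (A + 16 * t0 ^+ 2 - \int[P]_x Theta x +
      (2 * (C * 2) + \int[P]_x Theta x))); first by rewrite lerD2r.
  have -> : A + 16 * t0 ^+ 2 - \int[P]_x Theta x + (2 * (C * 2) +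
    \int[P]_x Theta x) = A + 16 * t0 ^+ 2 + 4 * C by ring.
  rewrite /A /C tLamE -/delta.
  have -> : 1 - t * B / 2 + 4 * t0 ^+ 2 + 144 * delta ^+ 2 + 16 * t0 ^+ 2 +
      4 * (256 * (eps ^+ 2 * K * t0 ^+ 2)) =
    1 + ((20 * t0 ^+ 2 + 144 * delta ^+ 2 + 1024 * (eps ^+ 2 * K * t0 ^+ 2)) -
      t * B / 2) by ring.
  by rewrite gerDl subr_le0.
move=> x; pose y := Num.max (v x - b) 0.
have y0 : 0 <= y by rewrite le_max lexx orbT.
have gt_y c : 0 < c -> (b + c < v x) = (c < y).
  by move=> c_gt0; rewrite /y lt_max ltrBrDl (ltNge c 0) (ltW c_gt0) orbF.
have bet_ge k : (k <= n)%N -> s <= p (L (b + r k)) x -> r k ^+ 2 <= bet x.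
  move=> kn sp; rewrite /bet (bigD1 (Ordinal (kn : (k < n.+1)%N)))//=.
  rewrite -[leLHS]addr0; apply: lerD; last first.
    by apply: sumr_ge0 => i _; rewrite mulr_ge0 ?sqr_ge0.
  rewrite ler_peMr ?sqr_ge0// /q sp -expR0 ler_expR divr_ge0//.
  exact: le_trans (p1 _ _).
have Theta_le : \sum_(k < n.+1) r k ^+ 2 * (b + r k < v x)%R%:R <=
    2 * Num.min y r0 ^+ 2.
  apply: le_trans (dyadic_sum n.+1 (ltW r00) y0); apply: ler_sum => k _.
  by rewrite gt_y.
have /andP[vx0 vx1] := v01 x.
have r04 : 4 * r0 = 1 / 72 by rewrite r0E; field.
have c72_gt0 : 0 < 1 / 72 :> R by rewrite -r04 mulr_gt0.
have c72_ge0 := ltW c72_gt0.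
(* Up to 1/72 = 4 r0 the dyadic levels serve, with weight 72 (v - b) <= 1. Higher points, including
   those cut off at b + 1, move with t = 1 to the single level b + rho. *)
have [xlow|xtop] := leP (v x - b) (1 / 72); last first.
  (* [xi_drop_lin] at distance 1/72 gives Gam >= g1. The choice of [rho] makes g1/4 = 2 rho: one
     half for the level b + rho, the other for the cost s/K. *)
  pose g1 := gamma * (1 / 72).
  have g1_gt0 : 0 < g1 by exact: mulr_gt0.
  have g1_le1 : g1 <= 1.
    apply: le_trans quarter1; apply: le_trans quarter72.
    by apply: ler_piMl.
  have g1E : g1 / 4 = 2 * rho by rewrite /g1 rhoE -r04; field.
  have gG : g1 <= Gam x.
    rewrite /Gam ler_pdivlMr//.
    have c72 : 0 <= b + 1 / 72 by rewrite addr_ge0.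
    have h1 : gamma * D * (b + 1 / 72 - b) <= xi b - xi (b + 1 / 72).
      apply: (xi_drop_lin pr sm b0 _ (xi_gamma b0)).
      rewrite lerDl lerD2l c72_ge0/=.
      exact: le_trans quarter72 quarter1.
    have h2 : xi (v x) <= xi (b + 1 / 72).
      by apply: (xi_le pr c72); rewrite -lerBrDl ltW.
    have /andP[_ h3] := g0 x.
    have -> : g1 * D = gamma * D * (b + 1 / 72 - b) by rewrite /g1; ring.
    by apply: (le_trans h1); rewrite lerD2l lerN2 (le_trans h3).
  have tBg : t * B <= g1 / 4.
    apply: (le_trans tB); rewrite g1E.
    have := ltW delta_rho; rewrite /delta ler_pdivrMr// => h.
    have h2 : rho * gamma <= rho by rewrite ler_piMr// ltW.
    have h3 : t0 <= 8 * t0 by rewrite ler_peMl ?ler1n// ltW.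
    have h4 : rho <= 2 * rho by rewrite ler_peMl ?ler1n// ltW.
    exact: le_trans h3 (le_trans h (le_trans h2 h4)).
  have zg : rho + s / K <= g1 / 4.
    rewrite g1E mulr_natl mulr2n lerD2l ler_pdivrMr//; exact: K3.
  have Jtop : J x <= expR (rho + s / K) \/ J x <= 4 * q (b + rho) x.
    have := Jhigh x (half_gt0 _ rho_level) rho_1.
    rewrite (_ : b + rho - b = rho); last by rewrite addrC addKr.
    move=> Jx.
    rewrite /q; have [sp|ps] := leP s (p (L (b + rho)) x); [right|left].
      apply: (le_trans Jx); rewrite expRD; apply: ler_pM; rewrite ?expR_ge0//.
        apply: expR_le4; apply: le_trans (ltW half1).
        by apply: le_trans r01; apply: le_trans rho_r0; rewrite ler_peMl ?ler1n// ltW.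
      rewrite ler_expR ler_pM2l; last exact: lt_le_trans (p1 _ _).
      rewrite lef_pV2 ?posrE//; apply: le_trans K_ge288.
      by rewrite ler_nat.
    by apply: (le_trans Jx); rewrite ler_expR lerD2l ler_pM2r ?invr_gt0// ltW.
  have g1_range : 0 < g1 <= 1 by rewrite g1_gt0.
  have := top_level_bound t_range tBg g1_range gG zg (q0 _ _) Jtop.
  have T1 : Theta x <= g1 / 4.
    have m : Num.min y r0 ^+ 2 <= r0 ^+ 2.
      apply: lerXn2r; rewrite ?nnegrE ?le_min ?y0 ?(ltW r00)//.
      by rewrite ge_min lexx orbT.
    have m2 : 288 * r0 ^+ 2 <= 1.
      have -> : 288 * r0 ^+ 2 = r0 by rewrite r0E; field.
      exact: le_trans r01 (ltW half1).
    have g1E' : g1 / 4 = gamma * r0 by rewrite g1E rhoE; field.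
    rewrite g1E' (le_trans _ eta1)// /Theta mulrC ler_wpM2r//.
    have b1 : (b + rho < v x)%R%:R <= 1 :> R by case: (_ < _).
    exact: level_sum_bound Theta_le m m2 b1.
  have hQ := F01 x; have hbet := F02 x.
  have h1 : 0 <= D^-1 * Xi_low xi b (v x).
    rewrite mulr_ge0 ?invr_ge0 ?(ltW D0)//; exact: (Xi_low_ge0 sm b0).
  have h2 : 0 <= 7 * sqr_low b (v x) by rewrite mulr_ge0 ?sqr_low_ge0.
  have h3 : 0 <= 4 * t0 ^+ 2 by rewrite mulr_ge0 ?sqr_ge0.
  have h4 : 0 <= 144 * delta ^+ 2 by apply: mulr_ge0; rewrite ?sqr_ge0.
  by move=> hJ; exact: (top_total T1).
have vb1 : v x < b + 1.
  by rewrite -ltrBlDl; exact: le_lt_trans xlow (le_lt_trans quarter72 quarter_lt1).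
have Jself := J_le_self vb1.
have xle1 : v x - b <= 1 by rewrite lerBlDl ltW.
have p0 : 0 <= p (L c0) x by exact: le_trans (p1 _ _).
pose M := Num.min (t * p (L c0) x / K) (t ^+ 2 * p (L c0) x ^+ 2 / K).
have M0 : 0 <= M.
  rewrite le_min; apply/andP; split; apply: divr_ge0; try exact: ltW.
    exact: mulr_ge0.
  by apply: mulr_ge0; exact: sqr_ge0.
have M1 : M <= t * p (L c0) x / K by rewrite ge_min lexx.
have M2 : M <= t ^+ 2 * p (L c0) x ^+ 2 / K by rewrite ge_min lexx orbT.
have MQ : expR M - 1 <= Q x.
  have := expRB1_small_weight M0 t_ge0 p0 K0 Lam1 tLam M1 M2.
  by rewrite expRD [expR _ * expR (- Lam)]mulrC.
have Jlow0 : J x <= expR ((1 - t) * (v x - b) - t * B + M).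
  have := Jlow (L_neq0 Pc0) (lt_trans c0b (_ : b < b + 1)) vb1 t1.
  rewrite ltrDl ltr01 => /(_ isT).
  by rewrite -/M (_ : t * (c0 - b) = - (t * B)) //; rewrite /B; ring.
have JA := low_level_bound xle1 t1 B0 tB (Q0 x) MQ Jself (fun _ => Jlow0).
(* Beyond 4 delta there is a scale r k comparable to the height. If the cost of reaching b + r k is
   below [s], moving there with weight 72 (v - b) gains; otherwise the point is exceptional and its
   squared height is charged to [bet]. *)
have levels : [\/ v x - b <= 4 * delta,
    J x <= expR ((v x - b) - 18 * (v x - b) ^+ 2) |
    (v x - b) ^+ 2 <= 16 * bet x].
  have [xd|dx] := leP (v x - b) (4 * delta); first exact: Or31.
  have x4 : v x - b <= 4 * r0 by rewrite r04.
  have xn : 2 * (r0 / 2 ^+ n) < v x - b.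
    apply: le_lt_trans dx.
    have -> : 4 * delta = 2 * (2 * delta) by ring.
    by apply: ler_wpM2l.
  have [k kn /andP[rx xr]] := dyadic_level x4 xn.
  rewrite -/(r k) in rx xr.
  have x_ge0 : 0 <= v x - b.
    by apply: ltW; apply: lt_trans rx; rewrite mulr_gt0.
  have [sp|ps] := leP s (p (L (b + r k)) x).
    apply: Or33; apply: (@le_trans _ _ (16 * r k ^+ 2)).
      have -> : 16 * r k ^+ 2 = (4 * r k) ^+ 2 by ring.
      by apply: lerXn2r; rewrite ?nnegrE// (le_trans x_ge0).
    by apply: ler_wpM2l; [exact: ler0n|exact: bet_ge].
  apply: Or32.
  have t72 : 0 <= 72 * (v x - b) <= 1.
    rewrite mulr_ge0//=; have e72 : 72 * (1 / 72) = 1 :> R by field.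
    by rewrite -[leRHS]e72; apply: ler_wpM2l; first exact: ler0n.
  have pk0 : 0 <= p (L (b + r k)) x by exact: le_trans (p1 _ _).
  apply: (le_trans (Jlow (half_gt0 _ (rk_level k kn)) (rk1 k) vb1 t72)).
  rewrite ler_expR (_ : b + r k - b = r k); last by rewrite addrC addKr.
  exact: (good_level_exponent x_ge0 rx pk0 (ltW ps) K2 K0).
have JB := upper_level_bound xlow (bet0 x) Jself levels.
have gx := gE vb1.
have GX : Gam x <= v x - b.
  rewrite /Gam ler_pdivrMr// gx lerBlDl -lerBlDr /D mulrN opprK.
  exact: (xi_tangent sm b0 vx0).
have XG : v x - b <= Gam x + D^-1 * Xi_low xi b (v x) + y ^+ 2.
  rewrite /Gam gx; have [vb|bv] := ltP (v x) b.
    rewrite Xi_lowE ?vx0//.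
    have -> : (xi b - xi (v x)) / D + D^-1 * (xi (v x) - xi b +
        xi' xi b * (b - v x)) = v x - b.
      have -> : xi' xi b = - D by rewrite /D opprK.
      by field; rewrite gt_eqF.
    by rewrite lerDl sqr_ge0.
  rewrite Xi_low_ge// mulr0 addr0 -lerBlDr ler_pdivlMr// mulrC.
  have -> : y = v x - b by rewrite /y max_l// subr_ge0.
  exact: (xi_drop_quad pr sm b_gt0 bv).
have T2 : Theta x <= y ^+ 2.
  apply: (level_penalty rho0 (ltW r00) eta0 eta2 y0 Theta_le).
  by rewrite gt_y.
have := combine_levels t1 JA JB GX XG.
rewrite opprB -/y -/(sqr_low b (v x)) => hJ.
exact: low_total T2 (F03 x) hJ.
Qed.

Lemma one_coordinate_le : upper_le P J 1.
Proof.
have [P0|/existsNP[c1 /not_implyP[c1b /eqP Pc1]]] :=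
  pselect (forall c, c < b -> P (L c) = 0%E); first exact: degenerate_case.
have {Pc1}Pc1 : (0 < P (L c1))%E by rewrite lt0e Pc1 measure_ge0.
have [done|no] := pselect (upper_le P J 1) => //.
have wb c : c < b -> (0 < P (L c))%E -> b - c <= 2 * a * wL c / K.
  by move=> cb Pc; have [|/no] := weight_bound cb Pc.
have /andP[gam0 _] := gamma01.
have wL0 c : (0 < P (L c))%E -> 0 < wL c.
  by move=> Pc; exact: lt_le_trans (wL_ge Pc).
(* The least admissible t0 is the supremum of these ratios. It is at most 2 a / K, unless one level
   already gives the conclusion, and some [c0] reaches half of it. *)
pose S := [set (b - c) / wL c | c in [set c | c < b /\ (0 < P (L c))%E]].
have ubS : ubound S (2 * a / K).
  move=> _ [c [cb Pc] <-]; rewrite ler_pdivrMr ?wL0//.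
  by rewrite mulrAC; exact: wb.
have hS : has_sup S by split; [exists ((b - c1) / wL c1), c1|exists (2 * a / K)].
have S_le c : c < b -> (0 < P (L c))%E -> (b - c) / wL c <= sup S.
  by move=> cb Pc; apply: ub_le_sup; [exists (2 * a / K)|exists c].
have t0_gt0 : 0 < sup S.
  by apply: lt_le_trans (S_le _ c1b Pc1); rewrite divr_gt0 ?subr_gt0 ?wL0.
have half_gt0 : 0 < sup S / 2 by rewrite divr_gt0.
have [_ [c0 [c0b Pc0] <-] hc0] := sup_adherent half_gt0 hS.
apply: (nondegenerate_case t0_gt0 _ _ c0b Pc0).
- by apply: sup_le_ub => //; case: hS.
- by move=> c cb Pc; rewrite -ler_pdivrMr ?wL0//; exact: S_le.
- move: hc0; rewrite ltr_pdivlMr ?wL0// => /ltW.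
  have -> : sup S - sup S / 2 = sup S / 2 by field.
  by rewrite mulrAC ler_pdivrMr// [_ * 2]mulrC.
Qed.

End one_coordinate.

(** * Cost of a level set *)

Section tail.
Context {d : measure_display} {T : measurableType d} {R : realType}.
Variable mu : probability T R.

Lemma measurable_cover_lt (X : set T) (r : R) :
  (mu_ext mu X < r%:E)%E ->
  exists2 Y, measurable Y & X `<=` Y /\ (mu Y <= r%:E)%E.
Proof.
move=> /ereal_inf_lt[_ [A [mA XA] <-] Ar].
exists (\bigcup_k A k); first by apply: bigcup_measurable => k _; exact: mA.
split => //; apply: le_trans (ltW Ar).
apply: measure_sigma_subadditive => //.
by apply: bigcup_measurable => k _; exact: mA.
Qed.

Lemma geometric_sum_le (q : R) n : 0 <= q < 1 ->
  \sum_(i < n) q ^+ i <= (1 - q)^-1.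
Proof.
move=> /andP[q0 q1]; have q1' : 0 < 1 - q by rewrite subr_gt0.
rewrite -[leRHS]mul1r ler_pdivlMr//.
have -> : (\sum_(i < n) q ^+ i) * (1 - q) = 1 - q ^+ n.
  by rewrite -[in RHS](expr1n _ n) subrXX mulrC; congr (_ * _); apply: eq_bigr => i _; rewrite expr1n mul1r.
by rewrite gerBl exprn_ge0.
Qed.

(** The sum over i of exp((m + i + 1)/2) exp(-(m + i)), divided by exp(-m/2): on the layer m + i <=
    f < m + i + 1 the function exp(f/2) is bounded by its value at the upper end. *)
Definition exp_tail_const : R := expR (1 / 2) / (1 - expR (- (1 / 2))).

Lemma expR_mhalf_lt1 : expR (- (1 / 2)) < 1 :> R.
Proof. by rewrite -[ltRHS]expR0 ltr_expR; lra. Qed.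

Lemma exp_tail_const_gt0 : 0 < exp_tail_const.
Proof. by rewrite divr_gt0 ?expR_gt0// subr_gt0 expR_mhalf_lt1. Qed.

Lemma exp_tail_le (f : T -> R) (c : R) (m : nat) : 0 <= c ->
  (forall t : R, 1 <= t ->
    (mu_ext mu [set x | t <= f x]%R <= (expR (- t) * c)%:E)%E) ->
  (1 <= m)%N ->
  upper_le mu (fun x => if m%:R <= f x then expR (f x / 2) else 0)
    (exp_tail_const * expR (- (1 / 2)) ^+ m * c).
Proof.
move=> c0 ftail m1; set q := expR (- (1 / 2)).
have q01 : 0 <= q < 1 by rewrite expR_ge0 expR_mhalf_lt1.
set C := exp_tail_const * q ^+ m.
have C0 : 0 <= C by rewrite mulr_ge0 ?exprn_ge0 ?expR_ge0// ltW// exp_tail_const_gt0.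
rewrite /upper_le; apply/lee_addgt0Pr => e e0.
have e' : 0 < e / (C + 1) by rewrite divr_gt0// ltr_wpDl.
(* Only outer measures of the tails are known, so each is enclosed in a measurable set. The sum
   multiplies the slack e / (C + 1) by at most C. *)
have cover (i : nat) : exists Y, [/\ measurable Y,
    [set x | (m + i)%:R <= f x] `<=` Y &
    (mu Y <= (expR (- (m + i)%:R) * (c + e / (C + 1)))%:E)%E].
  have h : (mu_ext mu [set x | (m + i)%:R <= f x]%R <
      (expR (- (m + i)%:R) * (c + e / (C + 1)))%:E)%E.
    apply: le_lt_trans (ftail _ _) _; first by rewrite ler1n addn_gt0 m1.
    by rewrite lte_fin ltr_pM2l ?expR_gt0// ltrDl.
  by have [Y mY [XY muY]] := measurable_cover_lt h; exists Y.
have [Y HY] := choice cover.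
have mY i : measurable (Y i) by have [] := HY i.
pose G i x : \bar R := (expR ((m + i).+1%:R / 2) * \1_(Y i) x)%:E.
have mG i : measurable_fun setT (G i).
  by apply/measurable_EFinP; apply: measurable_funM => //; exact: measurable_indic.
have G0 i x : (0 <= G i x)%E by rewrite lee_fin mulr_ge0 ?expR_ge0.
apply: (@le_trans _ _ (\int[mu]_x \sum_(0 <= i <oo) G i x)%E).
  apply: upper_integral_le_integral.
    by apply: ge0_emeasurable_sum => // i x _ _; exact: G0.
  move=> x; case: ifPn => [mf|_]; last by apply: nneseries_ge0 => i _ _; exact: G0.
  have f0 : 0 <= f x by exact: le_trans mf.
  pose j := (Num.truncn (f x) - m)%N.
  have mj : (m <= Num.truncn (f x))%N by rewrite leqNgt truncn_lt_nat// -leNgt.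
  have mjE : (m + j = Num.truncn (f x))%N by rewrite /j subnKC.
  apply: (@le_trans _ _ (G j x)).
    rewrite /G indicE mem_set; last first.
      by have [_ + _] := HY j; apply; rewrite /= mjE; have /andP[] := truncn_itv f0.
    by rewrite mulr1 lee_fin ler_expR ler_pM2r// mjE ltW// truncnS_gt.
  apply: le_trans (nneseries_lim_ge j.+1 _); last by move=> *; exact: G0.
  by rewrite big_nat_recr//= leeDr// sume_ge0.
rewrite integral_nneseries//.
have IG i : (\int[mu]_x G i x <=
    (expR (1 / 2) * q ^+ m * (c + e / (C + 1)) * q ^+ i)%:E)%E.
  rewrite /G; under eq_integral do rewrite EFinM.
  rewrite ge0_integralZl_EFin ?expR_ge0//; last first.
    by apply/measurable_EFinP; exact: measurable_indic.
  rewrite integral_indic// setIT; have [_ _ muY] := HY i.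
  apply: le_trans (lee_wpmul2l _ muY) _; first by rewrite lee_fin expR_ge0.
  rewrite -EFinM lee_fin mulrA -expRD.
  have -> : (m + i).+1%:R / 2 - (m + i)%:R = 1 / 2 + (m + i)%:R * (- (1 / 2)) :> R.
    by rewrite -natr1; field.
  rewrite expRD expRM_natl exprD -/q.
  by rewrite le_eqVlt; apply/orP; left; apply/eqP; ring.
apply: (@le_trans _ _ (C * (c + e / (C + 1)))%:E); last first.
  rewrite -EFinD lee_fin mulrDr lerD2l mulrA ler_pdivrMr ?ltr_wpDl//.
  by move: e0; lra.
apply: lime_le; first by apply: is_cvg_nneseries => i _ _; apply: integral_ge0.
near=> n; apply: le_trans (lee_sum _ (fun i _ => IG i)) _.
rewrite sumEFin lee_fin -mulr_sumr big_mkord.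
apply: le_trans (ler_wpM2l _ (geometric_sum_le n q01)) _.
  rewrite !mulr_ge0 ?expR_ge0 ?exprn_ge0 ?expR_ge0//.
  by rewrite addr_ge0// ltW.
rewrite le_eqVlt; apply/orP; left; apply/eqP.
rewrite /C /exp_tail_const -/q; ring.
Unshelve. all: by end_near. Qed.


End tail.

Section cost.
Context {R : realType} {T : Type}.
Variables (h : T -> T -> R) (psi : R -> R).
Hypotheses (h0 : forall x y, 0 <= h x y).
Hypotheses (cpsi : convex_function (setT : set R) psi) (psi0 : psi 0 = 0).
Hypotheses (psi_sqr : forall x, 0 <= x <= 1 -> psi x <= x ^+ 2).
Hypotheses (psi_id : forall x, 1 <= x -> x <= psi x).

(* The summand 1 absorbs the distance from [hdist] to an attained value of [h]. *)
Definition cost (B : set T) (x : T) : R := Num.max (psi (hdist h x B)) 0 + 1.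

Lemma cost_ge1 B x : 1 <= cost B x.
Proof. by rewrite lerDr le_max lexx orbT. Qed.

Lemma psi_convex (x y t : R) : 0 <= t <= 1 ->
  psi ((1 - t) * x + t * y) <= (1 - t) * psi x + t * psi y.
Proof. exact: (@convex_functionE _ setT psi). Qed.

(** psi(z) >= z for z >= 1 gives z <= p. Then psi(t z) <= t p by convexity from 0, and psi(t z) <=
    (t z)^2 while t z <= 1; beyond that t p >= 1, so the linear bound is the smaller one. The
    quadratic bound makes small moves cheap. *)
Lemma psi_scale_le (z t p : R) : 0 <= z -> 0 <= t <= 1 -> 1 <= p -> psi z <= p ->
  psi (t * z) <= Num.min (t * p) (t ^+ 2 * p ^+ 2).
Proof.
move=> z0 t01 p1 zp; have /andP[t0 t1] := t01.
have zle : z <= p.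
  by have [z1|/ltW/psi_id h1] := leP z 1; [exact: le_trans p1|exact: le_trans zp].
have lin : psi (t * z) <= t * p.
  have := psi_convex 0 z t01; rewrite mulr0 add0r psi0 mulr0 add0r => /le_trans.
  by apply; exact: ler_wpM2l.
have tz0 : 0 <= t * z by exact: mulr_ge0.
have tzp : t * z <= t * p by exact: ler_wpM2l.
rewrite le_min lin/= -exprMn.
have [tz|tz] := leP (t * z) 1.
  apply: (le_trans (psi_sqr _)); first by rewrite tz0.
  by apply: lerXn2r; rewrite ?nnegrE// (le_trans tz0).
apply: (le_trans lin); rewrite expr2 ler_peMr//; first exact: le_trans tzp.
exact: le_trans (ltW tz) tzp.
Qed.

(** The infimum D may not be attained, and convexity gives no uniform modulus for psi. Interpolation
    between D and D + 1 bounds the excess over max(psi(D), 0) by e |psi(D + 1)|, which [eta] keeps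
    below 1. *)
Lemma cost_attained (B : set T) (x : T) : B !=set0 ->
  exists2 y, B y & psi (h x y) <= cost B x.
Proof.
move=> [y0 By0]; set S := [set h x y | y in B].
have infS : has_inf S.
  by split; [exists (h x y0), y0|exists 0 => _ [y _ <-]].
set D := hdist h x B; have DE : D = inf S by [].
pose eta : R := (1 + `|psi (D + 1)|)^-1.
have eta_gt0 : 0 < eta by rewrite invr_gt0 ltr_wpDr.
have eta_le1 : eta <= 1 by rewrite invf_le1 ?lerDl// ltr_wpDr.
have [_ [y By <-] hy] := inf_adherent eta_gt0 infS.
exists y => //; pose e := h x y - D.
have e0 : 0 <= e by rewrite subr_ge0 DE; apply: ge_inf; [case: infS|exists y].
have e_eta : e <= eta by rewrite lerBlDl ltW.
have e1 : e <= 1 by exact: le_trans eta_le1.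
have -> : h x y = (1 - e) * D + e * (D + 1) by rewrite /e; ring.
have e01 : 0 <= e <= 1 by rewrite e0.
apply: (le_trans (psi_convex _ _ e01)); apply: lerD.
  apply: (@le_trans _ _ ((1 - e) * Num.max (psi D) 0)).
    by rewrite ler_wpM2l ?subr_ge0// le_max lexx.
  by rewrite ler_piMl ?gerBl// le_max lexx orbT.
apply: (@le_trans _ _ (eta * `|psi (D + 1)|)).
  apply: (@le_trans _ _ (e * `|psi (D + 1)|)); first by rewrite ler_wpM2l// ler_norm.
  exact: ler_wpM2r.
by rewrite /eta mulrC ler_pdivrMr ?ltr_wpDr// mul1r lerDr.
Qed.

End cost.

Section cost_measure.
Context {d : measure_display} {T : measurableType d} {R : realType}.
Variables (mu : probability T R) (h : T -> T -> R) (psi w : R -> R) (gamma : R).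
Hypotheses (gamma01 : 0 < gamma <= 1) (wgamma : gamma <= w (1 / 2)).
Hypotheses (wni : {in `]0, 1] &, {homo w : x y /~ x <= y}}).
Hypothesis (Hexp : forall B : set T, measurable B ->
  (0 < mu B)%E -> (mu B <= (1 / 2)%:E)%E ->
  (upper_integral mu (fun x => (expR (psi (hdist h x B)))%:E)
    <= (expR (w (fine (mu B))))%:E)%E).
Hypothesis (Htail : forall (B : set T) (t : R), measurable B ->
  ((1 / 2)%:E <= mu B)%E -> 1 <= t ->
  (mu_ext mu [set x | t <= psi (hdist h x B)]%R
    <= (expR (- t))%:E * (1 - mu B))%E).

Let tail_cost (B : set T) (m : nat) : measurable B -> ((1 / 2)%:E <= mu B)%E ->
  (1 <= m)%N ->
  upper_le mu (fun x => if m%:R <= psi (hdist h x B) then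
    expR (psi (hdist h x B) / 2) else 0)
    (@exp_tail_const R * expR (- (1 / 2)) ^+ m * (1 - fine (mu B))).
Proof.
move=> mB muB m1; have muBE : mu B = (fine (mu B))%:E.
  by rewrite fineK// fin_num_measure.
apply: exp_tail_le => //.
  by rewrite subr_ge0 -lee_fin -muBE probability_le1.
move=> t t1; apply: (le_trans (Htail mB muB t1)).
by rewrite {1}muBE -EFinB -EFinM.
Qed.

Lemma cost_tail (B : set T) (m : nat) : measurable B ->
  ((1 / 2)%:E <= mu B)%E -> (1 <= m)%N ->
  upper_le mu (fun x => if m.+1%:R <= cost h psi B x then
    expR (cost h psi B x / 2) else 0)
    (expR (1 / 2) * @exp_tail_const R * expR (- (1 / 2)) ^+ m *
      (1 - fine (mu B))).
Proof.
move=> mB muB m1.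
have := upper_le_scale (expR_ge0 (1 / 2)) _ (tail_cost mB muB m1).
rewrite !mulrA => H; apply: (upper_le_trans _ (lexx _) (H _)) => x; last first.
  by case: ifP => // _; exact: expR_ge0.
rewrite /cost -natr1 lerD2r le_max [_ <= 0](_ : _ = false) ?orbF; last first.
  by apply/negbTE; rewrite -ltNge ltr0n.
case: ifPn => [mf|_]; last by rewrite mulr0.
have f0 : 0 <= psi (hdist h x B) by exact: le_trans mf.
by rewrite max_l// -expRD mulrDl addrC.
Qed.

(** The 4 serves sets of measure at most 1/2: there the moment is at most exp(3 + W), and 3 + W <= 4
    W / gamma because gamma <= W and gamma <= 1. The other summand bounds the moment for larger
    sets, where w(1/2) / gamma >= 1. *)
Definition cost_exp_const : R :=
  4 + expR (1 / 2) * (expR (1 / 2) + @exp_tail_const R).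

Lemma cost_exp_const_ge4 : 4 <= cost_exp_const.
Proof.
by rewrite lerDl mulr_ge0 ?addr_ge0 ?expR_ge0// ltW// exp_tail_const_gt0.
Qed.

Lemma cost_exp (B : set T) : measurable B -> (0 < mu B)%E ->
  upper_le mu (fun x => expR (cost h psi B x / 2))
    (expR (cost_exp_const / gamma * w (Num.min (fine (mu B)) (1 / 2)))).
Proof.
move=> mB muB0; have muBE : mu B = (fine (mu B))%:E.
  by rewrite fineK// fin_num_measure.
have /andP[gam0 gam1] := gamma01.
have C4 := cost_exp_const_ge4.
have [u2|u2] := leP (fine (mu B)) (1 / 2).
  have muB2 : (mu B <= (1 / 2)%:E)%E by rewrite muBE lee_fin.
  set W := w (fine (mu B)).
  have gW : gamma <= W.
    apply: (le_trans wgamma); apply: wni => //.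
    - by rewrite in_itv/=; lra.
    - rewrite in_itv/= -lte_fin -muBE muB0 (le_trans u2)//; lra.
  have W0 : 0 <= W by lra.
  have H1 : upper_le mu (fun x => expR (psi (hdist h x B))) (expR W) by exact: Hexp.
  have H2 : upper_le mu (fun x : T => 1 + expR (psi (hdist h x B))) (1 + expR W).
    apply: upper_le_add; [by []|by move=> x; exact: expR_ge0| |exact: H1].
    exact: (@upper_le_cst _ _ _ mu 1 (fun=> 1) (fun=> lexx 1)).
  have H3 := upper_le_scale (ler0n _ 4) (fun x => addr_ge0 ler01 (expR_ge0 _)) H2.
  apply: (upper_le_trans _ _ H3) => [x|].
    rewrite /cost; set f := psi _.
    have [f0|f0] := leP f 0.
      rewrite add0r; have := expR_le4 (_ : 1 / 2 <= 1 :> R).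
      by have := expR_ge0 f => h1 h2; have := h2 _; lra.
    apply: (@le_trans _ _ (expR (1 + f))).
      by rewrite ler_expR; lra.
    rewrite expRD; have := expR_le4 (lexx (1 : R)); have := expR_ge0 f; nra.
  apply: (@le_trans _ _ (expR (3 + W))).
    have e1 : 2 <= expR 1 :> R by have := expR_ge1Dx (1 : R).
    have e3 : 8 <= expR 3 :> R.
      have -> : 3 = 1 + (1 + 1) :> R by ring.
      by rewrite !expRD; nra.
    have eW : 1 <= expR W by rewrite -[leLHS]expR0 ler_expR.
    by rewrite expRD; nra.
  rewrite ler_expR.
  have h1 : 4 * W <= cost_exp_const / gamma * W * gamma.
    by rewrite mulrAC divfK ?gt_eqF// ler_wpM2r.
  rewrite mulrAC ler_pdivlMr//.
  have : 4 * W <= cost_exp_const * W by rewrite ler_wpM2r.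
  nra.
have muB2 : ((1 / 2)%:E <= mu B)%E by rewrite muBE lee_fin ltW.
have u1 : fine (mu B) <= 1 by rewrite -lee_fin -muBE probability_le1.
have H1 := tail_cost mB muB2 (leqnn 1).
set f := fun x => if 1%:R <= _ then _ else _ in H1.
have f0 x : 0 <= f x by rewrite /f; case: ifP => // _; exact: expR_ge0.
have H2 : upper_le mu (fun x => expR (1 / 2) + f x) (expR (1 / 2) +
    @exp_tail_const R * expR (- (1 / 2)) ^+ 1 * (1 - fine (mu B))).
  apply: upper_le_add; [by move=> _; exact: expR_ge0|exact: f0| |exact: H1].
  exact: (@upper_le_cst _ _ _ mu _ (fun=> expR (1 / 2)) (fun=> lexx _)).
have H3 := upper_le_scale (expR_ge0 (1 / 2)) (fun x => addr_ge0 (expR_ge0 _) (f0 x)) H2.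
apply: (upper_le_trans _ _ H3) => [x|].
  rewrite /cost mulrDl expRD mulrC ler_wpM2l ?expR_ge0//.
  rewrite /f; case: ifPn => [f1|].
    rewrite max_l; last by exact: le_trans f1.
    by rewrite lerDr expR_ge0.
  rewrite -ltNge => f1; rewrite addr0 ler_expR ler_wpM2r// ge_max ler01 andbT.
  exact: ltW.
apply: (@le_trans _ _ (expR cost_exp_const)).
  apply: le_trans (expR_ge1Dx _).
  apply: (@le_trans _ _ (expR (1 / 2) * (expR (1 / 2) + @exp_tail_const R))).
    rewrite ler_wpM2l ?expR_ge0// lerD2l expr1 -mulrA ler_piMr//.
      by apply: ltW; exact: exp_tail_const_gt0.
    have q1 := @expR_mhalf_lt1 R; have q0 := expR_ge0 (- (1 / 2) : R).
    nra.
  by rewrite /cost_exp_const addrA lerDr.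
rewrite ler_expR.
rewrite mulrAC ler_pdivlMr// ler_wpM2l//; lra.
Qed.

End cost_measure.

(** * Induction on the dimension *)

Section slices.
Context {R : realType} {d : measure_display} {T : measurableType d}.
Variables (h : T -> T -> R) (psi : R -> R) (k : R).
Hypotheses (h0 : forall x y, 0 <= h x y) (hxx : forall x, h x x = 0).
Hypotheses (cpsi : convex_function (setT : set R) psi).
Hypothesis (k0 : 0 < k).

Definition slice n (A : set (n.+1.-tuple T)) (y : T) : set (n.-tuple T) :=
  [set x | A (tuple_cons (y, x))].

Definition row_cons n (r : R) (s : 'rV[R]_n) : 'rV[R]_n.+1 :=
  \row_i (if unlift ord0 i is Some j then s ord0 j else r).

Lemma row_cons0 n r (s : 'rV[R]_n) : row_cons r s ord0 ord0 = r.
Proof. by rewrite mxE unlift_none. Qed.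

Lemma row_consS n r (s : 'rV[R]_n) j : row_cons r s ord0 (lift ord0 j) = s ord0 j.
Proof. by rewrite mxE liftK. Qed.

Lemma row_cons_conv n (r r' t : R) (s s' : 'rV[R]_n) :
  row_cons (t * r + (1 - t) * r') (t *: s + (1 - t) *: s') =
  t *: row_cons r s + (1 - t) *: row_cons r' s'.
Proof.
apply/rowP => i; rewrite !mxE; case: (unliftP ord0 i) => [j _|_] //.
by rewrite !mxE.
Qed.

Lemma convex_hull_conv n (U : set 'rV[R]_n) (x y : 'rV[R]_n) (t : R) :
  0 <= t <= 1 -> convex_hull U x -> convex_hull U y ->
  convex_hull U (t *: x + (1 - t) *: y).
Proof.
move=> /andP[t0 t1] Ux Uy B [cB UB].
have Bx : B x by apply: Ux.
have By : B y by apply: Uy.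
have := cB x y (Itv01 t0 t1); rewrite !inE => /(_ Bx By).
by [].
Qed.

Lemma convex_hull_sub n (U : set 'rV[R]_n) : U `<=` convex_hull U.
Proof. by move=> x Ux B [_ UB]; exact: UB. Qed.

(** The rows whose extension by [h y z] lies in the target hull form a convex set that contains
    [U_set h (slice A z) x], hence its hull. *)
Lemma V_set_cons n (A : set (n.+1.-tuple T)) (y z : T) (x : n.-tuple T)
    (s : 'rV[R]_n) :
  V_set h (slice A z) x s -> V_set h A (tuple_cons (y, x)) (row_cons (h y z) s).
Proof.
pose B := [set s | V_set h A (tuple_cons (y, x)) (row_cons (h y z) s)].
move=> /(_ B); apply; split.
  move=> s1 s2 t; rewrite !inE /B/= => B1 B2.
  have t01 : 0 <= t%:num <= 1 by rewrite ge0 le1.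
  have := convex_hull_conv t01 B1 B2.
  rewrite -row_cons_conv (_ : t%:num * h y z + (1 - t%:num) * h y z = h y z) //.
  by ring.
move=> {}s [s0 [x' Ax' hx']]; apply: convex_hull_sub; split.
  move=> i; case: (unliftP ord0 i) => [j ->|->].
    by rewrite row_consS.
  by rewrite row_cons0.
exists (tuple_cons (z, x')) => // i.
case: (unliftP ord0 i) => [j ->|->]; first by rewrite row_consS !tnthS.
by rewrite row_cons0 !(tnth_nth y).
Qed.

Definition psi_sum n (s : 'rV[R]_n) : R := \sum_(i < n) psi (s ord0 i).

Lemma psi_sum_cons n r (s : 'rV[R]_n) :
  psi_sum (row_cons r s) = psi r + psi_sum s.
Proof.
rewrite /psi_sum big_ord_recl row_cons0; congr (_ + _).
by apply: eq_bigr => j _; rewrite row_consS.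
Qed.

Lemma psi_sum_conv n (s s' : 'rV[R]_n) (t : R) : 0 <= t <= 1 ->
  psi_sum (t *: s + (1 - t) *: s') <= t * psi_sum s + (1 - t) * psi_sum s'.
Proof.
move=> t01; rewrite /psi_sum !mulr_sumr -big_split/=; apply: ler_sum => i _.
rewrite !mxE addrC [leRHS]addrC.
exact: (psi_convex cpsi).
Qed.

Definition exp_f n (A : set (n.-tuple T)) (x : n.-tuple T) : \bar R :=
  expeR (k%:E * f_hpsi h psi A x)%E.

Lemma V_set_neq0 n (A : set (n.-tuple T)) (x : n.-tuple T) :
  A !=set0 -> V_set h A x !=set0.
Proof.
move=> [y Ay]; exists (\row_i h (tnth x i) (tnth y i)).
apply: convex_hull_sub; split; first by move=> i; rewrite mxE.
by exists y => // i; rewrite mxE.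
Qed.

Lemma exp_f_ge0 n (A : set (n.-tuple T)) x : (0 <= exp_f A x)%E.
Proof. exact: expeR_ge0. Qed.

Lemma exp_f_le n (A : set (n.-tuple T)) x s : V_set h A x s ->
  (exp_f A x <= (expR (k * psi_sum s))%:E)%E.
Proof.
move=> Vs; rewrite /exp_f.
apply: (@le_trans _ _ (expeR (k * psi_sum s)%:E)) => //.
rewrite lee_expeR EFinM lee_wpmul2l ?lee_fin ?(ltW k0)//.
by apply: ereal_inf_lbound; exists s.
Qed.

Lemma exp_f_adherent n (A : set (n.-tuple T)) x (e : R) : A !=set0 -> 0 < e ->
  exists2 s, V_set h A x s & expR (k * psi_sum s) <= fine (exp_f A x) + e.
Proof.
move=> A0 e0; have [s0 Vs0] := V_set_neq0 x A0.
have [//|no] := pselect (exists2 s, V_set h A x s &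
  expR (k * psi_sum s) <= fine (exp_f A x) + e).
exfalso; set z := fine (exp_f A x) + e in no.
have z0 : 0 < z by rewrite ltr_wpDl// fine_ge0// exp_f_ge0.
have zs s : V_set h A x s -> ln z / k <= psi_sum s.
  move=> Vs; rewrite ler_pdivrMr// mulrC -ler_expR lnK ?posrE// leNgt.
  by apply/negP => /ltW h1; apply: no; exists s.
have h1 : ((ln z / k)%:E <= f_hpsi h psi A x)%E.
  by apply: le_ereal_inf_tmp => _ [s Vs <-]; rewrite lee_fin; exact: zs.
have h2 : (z%:E <= exp_f A x)%E.
  apply: (@le_trans _ _ (expeR (k%:E * (ln z / k)%:E))).
    by rewrite -EFinM/= mulrC divfK ?gt_eqF// lnK.
  by rewrite lee_expeR lee_wpmul2l// lee_fin ltW.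
have ffin : exp_f A x \is a fin_num.
  rewrite ge0_fin_numE ?exp_f_ge0//.
  by apply: le_lt_trans (exp_f_le Vs0) _; rewrite ltry.
have : z <= fine (exp_f A x) by rewrite -lee_fin (fineK ffin).
by rewrite /z leNgt ltrDl e0.
Qed.

Lemma exp_f_fin n (A : set (n.-tuple T)) x : A !=set0 ->
  exp_f A x = (fine (exp_f A x))%:E.
Proof.
move=> A0; have [s0 Vs0] := V_set_neq0 x A0.
rewrite fineK// ge0_fin_numE ?exp_f_ge0//.
by apply: le_lt_trans (exp_f_le Vs0) _; rewrite ltry.
Qed.

(** The move with t = 1. The section at [y] may be empty, so this serves the points with v(y) = b +
    1. *)
Lemma exp_f_cons_le n (A : set (n.+1.-tuple T)) (y z : T) (x : n.-tuple T) :
  slice A z !=set0 ->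
  fine (exp_f A (tuple_cons (y, x))) <=
  expR (k * psi (h y z)) * fine (exp_f (slice A z) x).
Proof.
move=> Az; have A0 : A !=set0 by case: Az => x' Ax'; exists (tuple_cons (z, x')).
apply/ler_addgt0Pr => e e0.
have e' : 0 < e / expR (k * psi (h y z)) by rewrite divr_gt0// expR_gt0.
have [s Vs hs] := exp_f_adherent x Az e'.
have := exp_f_le (V_set_cons (y := y) Vs); rewrite (exp_f_fin _ A0) lee_fin.
move=> /le_trans; apply; rewrite psi_sum_cons mulrDr expRD.
apply: le_trans (ler_wpM2l (expR_ge0 _) hs) _.
by rewrite mulrDr lerD2l mulrC divfK// gt_eqF// expR_gt0.
Qed.

(** The parameters [al] and [be] replace Hoelder's inequality by convexity of exp. With al = v(y)
    and be = v(z) both normalized terms have upper integral at most 1, and subadditivity yields the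
    exponential of the interpolated levels. *)
Lemma exp_f_conv_le n (A : set (n.+1.-tuple T)) (y z : T) (x : n.-tuple T)
    (t al be : R) : 0 <= t <= 1 ->
  slice A y !=set0 -> slice A z !=set0 ->
  fine (exp_f A (tuple_cons (y, x))) <=
  expR (k * psi (t * h y z) + (1 - t) * al + t * be) *
  ((1 - t) * (expR (- al) * fine (exp_f (slice A y) x)) +
   t * (expR (- be) * fine (exp_f (slice A z) x))).
Proof.
move=> t01 Ay Az; have /andP[t0 t1] := t01.
have A0 : A !=set0 by case: Az => x' Ax'; exists (tuple_cons (z, x')).
set C := expR _; set u := fine _; set a1 := expR (- al); set u1 := fine _.
set a2 := expR (- be); set u2 := fine _.
have C0 : 0 <= C by exact: expR_ge0.
have a10 : 0 <= a1 by exact: expR_ge0.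
have a20 : 0 <= a2 by exact: expR_ge0.
have t1' : 0 <= 1 - t by rewrite subr_ge0.
set M := C * ((1 - t) * a1 + t * a2).
have M0 : 0 <= M by rewrite mulr_ge0// addr_ge0// mulr_ge0.
apply/ler_addgt0Pr => e e0.
have e' : 0 < e / (M + 1) by rewrite divr_gt0// ltr_wpDl.
have [s Vs hs] := exp_f_adherent x Ay e'.
have [s' Vs' hs'] := exp_f_adherent x Az e'.
have t01' : 0 <= 1 - t <= 1 by rewrite t1' gerBl.
have Vc := convex_hull_conv t01' (V_set_cons (y := y) Vs) (V_set_cons (y := y) Vs').
rewrite -row_cons_conv hxx in Vc.
have := exp_f_le Vc; rewrite (exp_f_fin _ A0) lee_fin => /le_trans; apply.
rewrite psi_sum_cons mulr0 add0r opprB addrCA subrr addr0.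
have h1 := psi_sum_conv s s' t01'.
rewrite opprB addrCA subrr addr0 in h1.
pose X := k * psi_sum s - al; pose Y := k * psi_sum s' - be.
apply: (@le_trans _ _ (C * expR ((1 - t) * X + t * Y))).
  rewrite -expRD ler_expR.
  have -> : k * psi (t * h y z) + (1 - t) * al + t * be + ((1 - t) * X + t * Y) =
    k * (psi (t * h y z) + ((1 - t) * psi_sum s + t * psi_sum s')).
    by rewrite /X /Y; ring.
  by rewrite ler_wpM2l ?(ltW k0)// lerD2l.
have h2 : expR ((1 - t) * X + t * Y) <= (1 - t) * expR X + t * expR Y.
  have -> : (1 - t) * X + t * Y = X + t * (Y - X) by ring.
  rewrite expRD; apply: le_trans (ler_wpM2l (expR_ge0 _) (expR_scale_le _ t01)) _.
  have <- : expR X * expR (Y - X) = expR Y by rewrite -expRD addrC subrK.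
  by rewrite le_eqVlt; apply/orP; left; apply/eqP; ring.
apply: (le_trans (ler_wpM2l C0 h2)).
have eX : expR X <= a1 * (u1 + e / (M + 1)).
  by rewrite /X expRD mulrC ler_wpM2l.
have eY : expR Y <= a2 * (u2 + e / (M + 1)).
  by rewrite /Y expRD mulrC ler_wpM2l.
apply: (@le_trans _ _ (C * ((1 - t) * (a1 * (u1 + e / (M + 1))) +
    t * (a2 * (u2 + e / (M + 1)))))).
  by rewrite ler_wpM2l// lerD// ler_wpM2l.
have -> : C * ((1 - t) * (a1 * (u1 + e / (M + 1))) +
    t * (a2 * (u2 + e / (M + 1)))) =
  C * ((1 - t) * (a1 * u1) + t * (a2 * u2)) + M * (e / (M + 1)).
  by rewrite /M; ring.
rewrite lerD2l mulrA ler_pdivrMr ?ltr_wpDl//.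
by rewrite mulrC ler_pM2l// lerDl.
Qed.

End slices.

(** * Iterated upper integrals on powers of the space *)

Section tuple_fubini.
Local Open Scope ereal_scope.
Context {d : measure_display} {T : measurableType d} {R : realType}.
Variables (mu : probability T R).

Lemma upper_integral_le_ae (d' : measure_display) (T' : measurableType d')
    (P : probability T' R) (f g : T' -> \bar R) : measurable_fun setT g ->
  (forall x, 0 <= g x) -> {ae P, forall x, f x <= g x} ->
  upper_integral P f <= \int[P]_x g x.
Proof.
move=> mg g0 [N [mN PN fN]].
pose g' x : \bar R := if x \in N then +oo else g x.
have mg' : measurable_fun setT g'.
  apply: measurable_fun_if => //.
    apply: (measurable_fun_bool true); rewrite setTI.
    rewrite (_ : _ @^-1` _ = N)//; apply/seteqP; split => x /=; first by move/set_mem.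
    exact: mem_set.
  exact: measurable_funTS.
rewrite (@ge0_ae_eq_integral _ _ _ P setT g g')//.
- apply: upper_integral_le_integral => // x; rewrite /g'; case: ifPn => [_|xN].
    by rewrite leey.
  apply: contrapT => fgx; move/negP: xN; apply; apply/mem_set.
  exact: fN.
- by move=> x _; rewrite /g'; case: ifP => _; rewrite ?leey.
- exists N; split => // x /=; apply: contra_notP => nN _.
  by rewrite /g' memNset.
Qed.

Lemma integral_tuple_cons n (G : n.+1.-tuple T -> \bar R) :
  measurable_fun setT G -> (forall x, 0 <= G x) ->
  \int[power_probability mu n.+1]_x G x =
  \int[mu]_y \int[power_probability mu n]_x G (tuple_cons (y, x)).
Proof.
move=> mG G0.
transitivity (\int[(mu \x power_probability mu n)]_z (G \o @tuple_cons _ _ n) z).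
  rewrite /= /distribution.
  by rewrite (ge0_integral_pushforward (@measurable_tuple_cons _ T n)).
have mGc : measurable_fun setT (G \o @tuple_cons _ T n).
  by apply: measurableT_comp => //; exact: measurable_tuple_cons.
by rewrite (fubini_tonelli1 _ mGc) // => x /=.
Qed.

Lemma measurable_slice_integral n (G : n.+1.-tuple T -> \bar R) :
  measurable_fun setT G -> (forall x, 0 <= G x) ->
  measurable_fun setT
    (fun y => \int[power_probability mu n]_x G (tuple_cons (y, x))).
Proof.
move=> mG G0.
have mGc : measurable_fun setT (G \o @tuple_cons _ T n).
  by apply: measurableT_comp => //; exact: measurable_tuple_cons.
have Gc0 x : 0 <= (G \o @tuple_cons _ T n) x by exact: G0.
exact: (@measurable_fun_fubini_tonelli_F _ _ _ _ _ (power_probability mu n)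
  (G \o @tuple_cons _ _ n) mGc Gc0).
Qed.

Lemma measurable_preimage_tuple_cons n (A : set (n.+1.-tuple T)) :
  measurable A -> measurable (@tuple_cons _ T n @^-1` A).
Proof.
by move=> mA; rewrite -[X in measurable X]setTI; exact: measurable_tuple_cons.
Qed.

Lemma measurable_slice n (A : set (n.+1.-tuple T)) (y : T) : measurable A ->
  measurable (slice A y).
Proof.
move=> mA; have := measurable_xsection y
  (measurable_preimage_tuple_cons mA).
congr measurable.
by apply/seteqP; split => x; rewrite /xsection/= inE.
Qed.

Lemma power_probability_slice n (A : set (n.+1.-tuple T)) : measurable A ->
  power_probability mu n.+1 A =
  \int[mu]_y power_probability mu n (slice A y).
Proof.
move=> mA; rewrite /= /distribution /pushforward /product_measure1.
apply: eq_integral => y _ /=; congr (_ _).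
by apply/seteqP; split => x; rewrite /xsection/= inE.
Qed.

Lemma measurable_slice_measure n (A : set (n.+1.-tuple T)) : measurable A ->
  measurable_fun setT (fun y => power_probability mu n (slice A y)).
Proof.
move=> mA.
have := measurable_fun_xsection (power_probability mu n)
  (measurable_preimage_tuple_cons mA).
apply: eq_measurable_fun => y _ /=; congr (_ _).
by apply/seteqP; split => x; rewrite /xsection/= inE.
Qed.

(** Iterated upper integrals do not control the joint one for arbitrary functions. The measurable
    [F] repairs this: Tonelli applies to it, and almost every section of the null set where it
    differs from [E] is null. *)
Lemma upper_integral_tuple_cons n (E F : n.+1.-tuple T -> \bar R)
    (J : T -> \bar R) (r : R) :
  measurable_fun setT F -> (forall x, 0 <= F x) -> (forall x, 0 <= E x) ->
  {ae power_probability mu n.+1, forall x, E x = F x} ->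
  (forall y, upper_integral (power_probability mu n)
    (fun x => E (tuple_cons (y, x))) <= J y) ->
  upper_integral mu J <= r%:E ->
  upper_integral (power_probability mu n.+1) E <= r%:E.
Proof.
move=> mF F0 E0 EF EJ Jr.
apply: (@le_trans _ _ (\int[power_probability mu n.+1]_x F x)).
  apply: upper_integral_le_ae => //.
  by apply: filterS EF => x ->.
rewrite integral_tuple_cons//.
apply/lee_addgt0Pr => e e0.
have [g [mg Jg] Ig] := upper_integral_adherent Jr e0.
rewrite -EFinD; apply: le_trans Ig.
have EF' := EF; case: EF' => N [mN PN NEF].
have mM := measurable_slice_measure mN.
have : \int[mu]_y `|power_probability mu n (slice N y)| = 0.
  under eq_integral do rewrite gee0_abs//.
  by rewrite -power_probability_slice.
move=> /(ae_eq_integral_abs mu measurableT mM) Nae.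
have Fg : {ae mu, forall y,
    \int[power_probability mu n]_x F (tuple_cons (y, x)) <= g y}.
  apply: filterS Nae => y /(_ I) Ny; apply: le_trans (Jg y).
  apply: le_trans (EJ y); apply: le_ereal_inf_tmp => _ [k [mk Ek] <-].
  have mFy : measurable_fun setT (fun x => F (tuple_cons (y, x))).
    apply: measurableT_comp => //.
    suff : measurable_fun setT (@tuple_cons _ T n \o pair y) by exact.
    apply: measurableT_comp; first exact: measurable_tuple_cons.
    exact: measurable_pair1.
  have aeFk : {ae power_probability mu n, forall x, setT x ->
      F (tuple_cons (y, x)) <= k x}.
    exists (slice N y); split; [exact: measurable_slice|exact: Ny|].
    move=> x /= nFk; apply: NEF => /= EFx; apply: nFk => _.
    by rewrite -EFx Ek.
  apply: ae_ge0_le_integral => // x _.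
  exact: le_trans (Ek x).
have g0 y : 0 <= g y.
  apply: le_trans (Jg y); apply: le_trans (EJ y).
  by apply: upper_integral_ge0.
apply: ae_ge0_le_integral => //.
- by move=> y _; apply: integral_ge0.
- exact: measurable_slice_integral.
- by apply: filterS Fg => y.
Qed.

End tuple_fubini.

(** * Choice of the constants *)

Section constants.
Context {R : realType}.

Lemma exp_decay (C eta : R) : 0 < eta -> 0 <= C ->
  exists2 m, (1 <= m)%N & C * expR (- (1 / 2)) ^+ m <= eta.
Proof.
move=> eta0 C0; set q := expR (- (1 / 2)).
have q0 : 0 <= q by exact: expR_ge0.
have q1 : `|q| < 1 by rewrite ger0_norm// expR_mhalf_lt1.
have C1 : 0 < eta / (C + 1) by rewrite divr_gt0// ltr_wpDl.
have /cvgrPdist_lt/(_ _ C1)[m _ hm] := cvg_expr q1.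
exists m.+1 => //; have := hm m.+1 (leqnSn m); rewrite sub0r normrN.
rewrite ger0_norm ?exprn_ge0// => /ltW h.
apply: le_trans (ler_wpM2l C0 h) _.
rewrite mulrA ler_pdivrMr ?ltr_wpDl//.
by rewrite mulrC ler_pM2l// lerDl.
Qed.

(** The constraints are met in the order [eps], [eta], [m], [K]: the threshold [m] makes the tail
    smaller than [eta], and only then is [K] taken large. *)
Lemma constants_exist (gamma a C r0 rho : R) : 0 < gamma -> 0 < a ->
  0 <= C -> 0 < r0 -> 0 < rho ->
  exists K eps eta : R, exists2 m, (1 <= m)%N &
  [/\ 0 < K, 18 * a <= rho * gamma * K, 288 * m.+1%:R ^+ 2 <= K &
    m.+1%:R <= rho * K] /\
  [/\ 0 < eps, 1024 * (8 * a * eps) <= 1,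
    (20 + 144 * (8 / gamma) ^+ 2) * (8 * a) <= K * eps &
    [/\ 0 <= eta, 5 * eta <= gamma * r0, eta * (288 + 4 * rho^-1 ^+ 2) <= 1 &
      C * expR (- (1 / 2)) ^+ m <= eta]].
Proof.
move=> g0 a0 C0 r00 rho0.
have [M1 M1E] : exists M1 : R, M1 = 1024 * 8 by eexists.
have M10 : 0 < M1 by rewrite M1E; apply: mulr_gt0; rewrite ltr0n.
pose eps := (M1 * a)^-1.
have eps0 : 0 < eps by rewrite invr_gt0 mulr_gt0.
have [z zE] : exists z : R, z = 288 + 4 * rho^-1 ^+ 2 by eexists.
have z0 : 0 < z.
  rewrite zE; apply: ltr_wpDr; last by rewrite ltr0n.
  by apply: mulr_ge0; [exact: ler0n|exact: sqr_ge0].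
pose eta := Num.min (gamma * r0 / 5) z^-1.
have eta0 : 0 < eta by rewrite lt_min divr_gt0 ?mulr_gt0//= invr_gt0.
have [m m1 hm] := exp_decay eta0 C0.
pose s : R := m.+1%:R.
have s0 : 0 <= s by exact: ler0n.
have [w wE] : exists w : R, w = (20 + 144 * (8 / gamma) ^+ 2) * (8 * a) by eexists.
have w0 : 0 <= w.
  have a00 := ltW a0; rewrite wE; apply: mulr_ge0.
    by apply: addr_ge0; [exact: ler0n|apply: mulr_ge0; [exact: ler0n|exact: sqr_ge0]].
  by apply: mulr_ge0; first exact: ler0n.
have [u uE] : exists u : R, u = 288 * s ^+ 2 by eexists.
have u0 : 0 <= u by rewrite uE; apply: mulr_ge0; [exact: ler0n|exact: sqr_ge0].
pose K := 18 * a / (rho * gamma) + u + s / rho + w / eps.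
have K1 : 0 < 18 * a / (rho * gamma) by rewrite divr_gt0 ?mulr_gt0.
have K3 : 0 <= s / rho by rewrite divr_ge0// ltW.
have K4 : 0 <= w / eps by rewrite divr_ge0// ltW.
have [h1 h2 h3 h4] : [/\ 18 * a / (rho * gamma) <= K, u <= K, s / rho <= K & w / eps <= K].
  rewrite /K; move: (18 * a / (rho * gamma)) (s / rho) (w / eps) K1 K3 K4.
  by move=> x1 x2 x3 *; split; lra.
exists K, eps, eta, m; first exact: m1.
split; split.
- exact: lt_le_trans h1.
- by rewrite [leRHS]mulrC -ler_pdivrMr ?mulr_gt0.
- by rewrite -/s -uE.
- by rewrite -/s [leRHS]mulrC -ler_pdivrMr.
- exact: eps0.
- have -> : 1024 * (8 * a * eps) = (1024 * 8) * a * eps by rewrite !mulrA.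
  by rewrite -M1E divff// gt_eqF// mulr_gt0.
- by rewrite -wE -ler_pdivrMr.
- split; [exact: ltW| | |exact: hm].
    by rewrite [leLHS]mulrC -ler_pdivlMr// ge_min lexx.
  by rewrite -zE -ler_pdivlMr// div1r ge_min lexx orbT.
Qed.

End constants.

Lemma measurable_expeR (R : realType) :
  measurable_fun [set: \bar R] (@expeR R).
Proof.
rewrite (_ : @expeR R = fun x => maxe (er_map expR x) 0%E).
  apply: measurable_maxe; last exact: measurable_cst.
  by apply: (measurable_er_map (measurableTypeR R)); exact: measurable_expR.
apply/funext => -[r| |] /=; last by rewrite max_r ?leNye.
  by rewrite max_l// lee_fin expR_ge0.
by rewrite max_l ?leey.
Qed.

Section profile_theory.
Context {R : realType} (theta xi : R -> R).
Hypothesis pr : profile theta xi.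

Lemma theta_le (x y : R) : 0 < x -> x <= y -> y <= 1 -> theta y <= theta x.
Proof.
move=> x0; rewrite le_eqVlt => /orP[/eqP->//|xy] y1; apply/ltW.
apply: (theta_decreasing pr) => //; rewrite in_itv/=.
  by rewrite (lt_trans x0).
by rewrite x0 (le_trans (ltW xy)).
Qed.

Lemma xi_gt0 (b : R) : 0 <= b -> 0 < xi b <= 1.
Proof.
by move=> b0; have := xi_range pr; move=> /(_ b); rewrite !in_itv/= b0; apply.
Qed.

(* [theta] at [g], cut off at the level [b + 1]; by monotonicity this is
   [min (theta g) (b + 1)], also when [g = 0]. *)
Definition cut_theta (b g : R) : R := theta (Num.min 1 (Num.max g (xi (b + 1)))).

Lemma measurable_cut_theta (b : R) : 0 <= b ->
  measurable_fun setT (cut_theta b).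
Proof.
move=> b0; have /andP[h1 h2] := xi_gt0 (addr_ge0 b0 ler01).
apply: nonincreasing_measurable => // x y xy; apply: theta_le.
- by rewrite lt_min ltr01/= lt_max h1 orbT.
- by rewrite le_min !ge_min lexx/= ge_max !le_max xy lexx /= !orbT.
- by rewrite ge_min lexx.
Qed.

Lemma cut_thetaE (b g : R) : 0 <= b -> 0 <= g <= 1 ->
  xi (cut_theta b g) = Num.max g (xi (b + 1)) /\
  0 <= cut_theta b g <= b + 1.
Proof.
move=> b0 /andP[g0 g1]; have b1 : 0 <= b + 1 by exact: addr_ge0.
have /andP[h1 h2] := xi_gt0 b1.
have m1 : Num.max g (xi (b + 1)) <= 1 by rewrite ge_max g1.
have m0 : 0 < Num.max g (xi (b + 1)) by rewrite lt_max h1 orbT.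
have min_ : Num.max g (xi (b + 1)) \in `]0, 1] by rewrite in_itv/= m0.
rewrite /cut_theta min_r//; split; first exact: (thetaK pr).
rewrite (theta_ge0 pr)//=.
rewrite -[leRHS](xiK pr) ?in_itv/= ?b1//.
by apply: theta_le => //; rewrite le_max lexx orbT.
Qed.

Lemma cut_theta_lt (b g : R) : 0 <= b -> 0 <= g <= 1 ->
  cut_theta b g < b + 1 -> xi (b + 1) < g /\ cut_theta b g = theta g.
Proof.
move=> b0 /andP[g0 g1]; have b1 : 0 <= b + 1 by exact: addr_ge0.
have /andP[h1 h2] := xi_gt0 b1.
rewrite /cut_theta; have [gx|gx] := leP g (xi (b + 1)).
  by rewrite min_r// (xiK pr) ?in_itv/= ?b1// ltxx.
by rewrite min_r.
Qed.

End profile_theory.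

Section induction.
Context {d : measure_display} {T : measurableType d} {R : realType}.
Variables (mu : probability T R) (N : nat) (h : T -> T -> R).
Variables (psi theta xi w : R -> R) (gamma a K eps eta rho r0 : R) (m : nat).
Hypotheses (gamma01 : 0 < gamma <= 1) (aE : a = @cost_exp_const R / gamma).
Hypotheses (r0E : r0 = 1 / 288) (rhoE : rho = gamma * r0 / 2) (m1 : (1 <= m)%N).
Hypotheses (K_gt0 : 0 < K) (K1 : 18 * a <= rho * gamma * K).
Hypotheses (K2 : 288 * m.+1%:R ^+ 2 <= K) (K3 : m.+1%:R <= rho * K).
Hypotheses (eps0 : 0 < eps) (eps1 : 1024 * (8 * a * eps) <= 1).
Hypothesis (K4 : (20 + 144 * (8 / gamma) ^+ 2) * (8 * a) <= K * eps).
Hypotheses (eta0 : 0 <= eta) (eta1 : 5 * eta <= gamma * r0).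
Hypothesis (eta2 : eta * (288 + 4 * rho^-1 ^+ 2) <= 1).
Hypothesis (eta3 :
  expR (1 / 2) * @exp_tail_const R * expR (- (1 / 2)) ^+ m <= eta).
Hypotheses (h0 : forall x y, 0 <= h x y) (hxx : forall x, h x x = 0).
Hypotheses (cpsi : convex_function (setT : set R) psi) (psi0 : psi 0 = 0).
Hypotheses (psi_sqr : forall x, 0 <= x <= 1 -> psi x <= x ^+ 2).
Hypotheses (psi_id : forall x, 1 <= x -> x <= psi x).
Hypotheses (pr : profile theta xi) (sm : smooth_profile xi).
Hypothesis (xi_gamma :
  forall b, 0 <= b -> gamma * `|xi' xi b| <= `|xi' xi (b + 1)|).
Hypotheses (w0 : {in `]0, 1], forall x, 0 <= w x}).
Hypotheses (wni : {in `]0, 1] &, {homo w : x y /~ x <= y}}).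
Hypotheses (wgamma : gamma <= w (1 / 2)).
Hypothesis (w2 :
  (\int[lebesgue_measure]_(u in `]0%R, 1%R]) (w u ^+ 2)%:E <= 1)%E).
Hypothesis (Hxi : condition_H xi w).
Hypothesis (Hmeas : forall (n : nat) (A : set (n.-tuple T)), (n <= N)%N ->
  measurable A ->
  completed_measurable (power_probability mu n) (f_hpsi h psi A)).
Hypothesis (Hexp : forall B : set T, measurable B ->
  (0 < mu B)%E -> (mu B <= (1 / 2)%:E)%E ->
  (upper_integral mu (fun x => (expR (psi (hdist h x B)))%:E)
    <= (expR (w (fine (mu B))))%:E)%E).
Hypothesis (Htail : forall (B : set T) (t : R), measurable B ->
  ((1 / 2)%:E <= mu B)%E -> 1 <= t ->
  (mu_ext mu [set x | t <= psi (hdist h x B)]%R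
    <= (expR (- t))%:E * (1 - mu B))%E).

Let k := 1 / K.
Let k0 : 0 < k. Proof. by rewrite divr_gt0. Qed.

Let a_ge : 1 <= a /\ 1 <= a * gamma.
Proof.
have /andP[g0 g1] := gamma01; have C4 := @cost_exp_const_ge4 R.
have C1 : 1 <= @cost_exp_const R by apply: le_trans C4; rewrite ler1n.
have e : a * gamma = @cost_exp_const R by rewrite aE divfK// gt_eqF.
have a0 : 0 <= a by rewrite aE divr_ge0 ?(ltW g0)// (le_trans ler01).
split; last by rewrite e.
by apply: (le_trans C1); rewrite -e ler_piMr.
Qed.

Definition exp_f_bound n := forall A : set (n.-tuple T), measurable A ->
  (upper_integral (power_probability mu n) (exp_f h psi k A) <=
   expeR (theta_ext theta (fine (power_probability mu n A))))%E.

Lemma exp_f_bound0 : exp_f_bound 0.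
Proof.
move=> A mA; have [A0|/eqP A0] := eqVneq (fine (power_probability mu 0 A)) 0.
  by rewrite /theta_ext A0 eqxx/= leey.
have AE : power_probability mu 0 A = 1%E.
  by move: A0; rewrite /= diracE indicE; case: (_ \in _) => /= hA; [|case: hA].
rewrite AE/= /theta_ext oner_eq0 (theta1 pr)/= expR0.
apply: upper_integral_cst_le => x.
have Ane : A !=set0.
  by apply/set0P/eqP => A00; move: AE; rewrite A00 measure0 => /eqP; rewrite eqe eq_sym oner_eq0.
have [s Vs] := V_set_neq0 h0 x Ane.
apply: le_trans (exp_f_le psi k0 Vs) _.
by rewrite /psi_sum big_ord0 mulr0 expR0.
Qed.

Section step.
Variables (n : nat) (IH : exp_f_bound n).
Variables (A : set (n.+1.-tuple T)) (mA : measurable A).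
Let g (y : T) : R := fine (power_probability mu n (slice A y)).
Let pA : R := fine (power_probability mu n.+1 A).
Hypothesis pA_gt0 : 0 < pA.
Let b := theta pA.
Let v (y : T) : R := cut_theta theta xi b (g y).

Let g01 y : 0 <= g y <= 1.
Proof.
rewrite fine_ge0//= -lee_fin fineK ?probability_le1 ?fin_num_measure//;
  exact: measurable_slice.
Qed.

Let pA01 : pA \in `]0, 1].
Proof.
rewrite in_itv/= pA_gt0/= -lee_fin fineK ?fin_num_measure//.
exact: (@probability_le1 _ _ _ (power_probability mu n.+1)).
Qed.

Let b0 : 0 <= b. Proof. exact: (theta_ge0 pr). Qed.

Let xib : xi b = pA. Proof. exact: (thetaK pr). Qed.

Let gE y : power_probability mu n (slice A y) = (g y)%:E.
Proof. by rewrite fineK// fin_num_measure//; exact: measurable_slice. Qed.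

Let mg : measurable_fun setT g.
Proof.
apply/measurable_EFinP; apply: eq_measurable_fun (measurable_slice_measure mu mA).
by move=> y _; rewrite /= gE.
Qed.

Let Eg : \int[mu]_y g y = xi b.
Proof.
rewrite xib /pA power_probability_slice// /Rintegral; congr fine.
by apply: eq_integral => y _; rewrite gE.
Qed.

Let slice_neq0 y : v y < b + 1 -> slice A y !=set0.
Proof.
move=> vy; have [gy _] := cut_theta_lt pr b0 (g01 y) vy.
have /andP[x0 _] := xi_gt0 pr (addr_ge0 b0 ler01).
apply/set0P/eqP => A0; move: gy; rewrite /g A0 measure0/= ltNge.
by rewrite ltW.
Qed.

Let slice_bound y : v y < b + 1 ->
  upper_le (power_probability mu n) (fun x => fine (exp_f h psi k (slice A y) x))
    (expR (v y)).
Proof.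
move=> vy; have sl := slice_neq0 vy; rewrite /v.
have [gy ->] := cut_theta_lt pr b0 (g01 y) vy.
have /andP[x0 _] := xi_gt0 pr (addr_ge0 b0 ler01).
have := IH (measurable_slice y mA); rewrite gE /= /theta_ext.
rewrite gt_eqF; last exact: lt_trans gy.
apply: le_trans; apply: upper_integral_le => x.
by rewrite -(exp_f_fin psi h0 k0 x sl).
Qed.

Let fA y x := fine (exp_f h psi k A (tuple_cons (y, x))).

Let fA0 y x : 0 <= fA y x.
Proof. by rewrite fine_ge0// exp_f_ge0. Qed.

Let A_neq0 : A !=set0.
Proof.
apply/set0P/eqP => A00; move: pA_gt0.
by rewrite /pA A00 measure0 ltxx.
Qed.

Let fA_high y z : v z < b + 1 ->
  upper_le (power_probability mu n) (fA y) (expR (k * psi (h y z)) * expR (v z)).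
Proof.
move=> vz; have sl := slice_neq0 vz.
apply: (upper_le_trans _ (lexx _) (upper_le_scale (expR_ge0 _) _ (slice_bound vz))).
  by move=> x; exact: exp_f_cons_le.
by move=> x; rewrite fine_ge0// exp_f_ge0.
Qed.

Let fA_low y z t : 0 <= t <= 1 -> v y < b + 1 -> v z < b + 1 ->
  upper_le (power_probability mu n) (fA y)
    (expR (k * psi (t * h y z) + (1 - t) * v y + t * v z)).
Proof.
move=> t01 vy vz; have /andP[t0 t1] := t01.
have E0 u x : 0 <= fine (exp_f h psi k (slice A u) x).
  by rewrite fine_ge0// exp_f_ge0.
have t1' : 0 <= 1 - t by rewrite subr_ge0.
have U1 := upper_le_scale t1' (fun x => mulr_ge0 (expR_ge0 (- v y)) (E0 y x))
  (upper_le_scale (expR_ge0 (- v y)) (E0 y) (slice_bound vy)).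
have U2 := upper_le_scale t0 (fun x => mulr_ge0 (expR_ge0 (- v z)) (E0 z x))
  (upper_le_scale (expR_ge0 (- v z)) (E0 z) (slice_bound vz)).
have p1 x : 0 <= (1 - t) * (expR (- v y) * fine (exp_f h psi k (slice A y) x)).
  by rewrite !mulr_ge0 ?expR_ge0.
have p2 x : 0 <= t * (expR (- v z) * fine (exp_f h psi k (slice A z) x)).
  by rewrite !mulr_ge0 ?expR_ge0.
have U3 := upper_le_scale
  (expR_ge0 (k * psi (t * h y z) + (1 - t) * v y + t * v z))
  (fun x => addr_ge0 (p1 x) (p2 x)) (upper_le_add p1 p2 U1 U2).
apply: (upper_le_trans _ _ U3).
  by move=> x; apply: exp_f_conv_le => //; exact: slice_neq0.
by rewrite -!expRD !addNr expR0 !mulr1 subrK mulr1.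
Qed.

Let UJ y : \bar R :=
  upper_integral (power_probability mu n) (fun x => (fA y x)%:E).

Let UJ_ge0 y : (0 <= UJ y)%E.
Proof. by apply: upper_integral_ge0 => x; rewrite lee_fin. Qed.

(** Otherwise all sections would have measure at most xi(b + 1), and so would their mean xi(b).
    Moving to such a point makes every inner upper integral finite, so [J] can be real-valued. *)
Let low_point : exists z, v z < b + 1.
Proof.
have b1 : 0 <= b + 1 by exact: addr_ge0.
apply: contrapT => no.
have gle y : g y <= xi (b + 1).
  have [xv /andP[_ vb]] := cut_thetaE pr b0 (g01 y).
  have vE : cut_theta theta xi b (g y) = b + 1.
    apply/eqP; rewrite eq_le vb leNgt; apply/negP => vy; apply: no.
    by exists y.
  by rewrite vE in xv; rewrite xv le_max lexx.
have : \int[mu]_y g y <= \int[mu]_y cst (xi (b + 1)) y.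
  apply: expectation_le => //; last exact: bounded_measurable_cst.
  split => //; exists 1 => y; have /andP[h1 h2] := g01 y.
  by rewrite ger0_norm.
rewrite Eg expectation_cst leNgt.
by rewrite (xi_lt pr b0)// ltrDl.
Qed.

Let UJ_fin y : UJ y = (fine (UJ y))%:E.
Proof.
have [z vz] := low_point; rewrite fineK// ge0_fin_numE//.
by apply: le_lt_trans (fA_high y vz) _; rewrite ltry.
Qed.

Let J y := expR (- b) * fine (UJ y).

Let J_le y (r : R) : upper_le (power_probability mu n) (fA y) (expR r) ->
  J y <= expR (r - b).
Proof.
rewrite /upper_le -/(UJ y) UJ_fin lee_fin => hr.
by rewrite /J addrC expRD ler_wpM2l ?expR_ge0.
Qed.

Let s_ge1 : 1 <= m.+1%:R :> R. Proof. by rewrite ler1n. Qed.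

Let level_attained y c : [set u | v u <= c] !=set0 ->
  exists2 z, v z <= c & psi (h y z) <= cost h psi [set u | v u <= c] y.
Proof. by move=> Lc; have [z vz hz] := cost_attained h0 cpsi y Lc; exists z. Qed.

Let J_le1 : upper_le mu J 1.
Proof.
have [a1 ag1] := a_ge.
have kE z : k * z = z / K by rewrite /k mul1r mulrC.
have vv := fun y => (cut_thetaE pr b0 (g01 y)).
apply: (@one_coordinate_le _ _ _ mu (cost h psi) v g J theta xi w gamma a
  m.+1%:R K b eta eps rho r0) => //.
- by apply: measurableT_comp => //; exact: measurable_cut_theta.
- by move=> y; have [_] := vv y.
- move=> y; have [-> _] := vv y; rewrite le_max lexx andbT.
  by have /andP[] := g01 y.
- move=> y vy; have [-> _] := vv y.
  by have [gy _] := cut_theta_lt pr b0 (g01 y) vy; rewrite max_l// ltW.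
- by move=> B y; exact: cost_ge1.
- move=> c Lc; rewrite aE; apply: cost_exp => //.
  by apply: measurable_le_set; apply: measurableT_comp => //; exact: measurable_cut_theta.
- move=> c Lc.
  have mLc : measurable [set x | v x <= c].
    by apply: measurable_le_set; apply: measurableT_comp => //; exact: measurable_cut_theta.
  apply: (upper_le_trans _ _ (cost_tail Htail mLc Lc m1)) => //.
  rewrite ler_wpM2r// subr_ge0 -lee_fin fineK ?probability_le1// fin_num_measure//.
- move=> y c t Lc cb vy t01; have [z vz hz] := level_attained y Lc.
  have /andP[t0 t1] := t01.
  have vz1 := le_lt_trans vz cb.
  apply: le_trans (J_le (fA_low t01 vy vz1)) _; rewrite ler_expR.
  have ps := psi_scale_le cpsi psi0 psi_sqr psi_id (h0 y z) t01 (cost_ge1 _ _ _ _) hz.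
  set p := cost _ _ _ _ in ps *.
  have kp : k * psi (t * h y z) <= Num.min (t * p / K) (t ^+ 2 * p ^+ 2 / K).
    move: ps; rewrite kE le_min => /andP[q1 q2].
    by rewrite le_min !ler_pM2r ?invr_gt0// q1.
  have tv : t * v z <= t * c by exact: ler_wpM2l.
  lra.
- move=> y c Lc cb; have [z vz hz] := level_attained y Lc.
  have vz1 := le_lt_trans vz cb.
  have := fA_high y vz1; rewrite -expRD => /J_le /le_trans; apply.
  rewrite ler_expR.
  have : k * psi (h y z) <= cost h psi [set x | v x <= c] y / K.
    by rewrite kE ler_pM2r ?invr_gt0.
  lra.
Qed.

Lemma exp_f_bound_step : (n.+1 <= N)%N ->
  (upper_integral (power_probability mu n.+1) (exp_f h psi k A) <=
   (expR b)%:E)%E.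
Proof.
(* Measurability up to a null set enters here, to pass from the inner upper integrals to the one
   over the product. *)
move=> nN; have [F mF fF] := Hmeas nN mA.
apply: (@upper_integral_tuple_cons _ _ _ mu n _ (fun x => expeR (k%:E * F x)%E) UJ).
- have mkF : measurable_fun setT (fun x => k%:E * F x)%E by exact: measurable_funeM.
  exact: (measurableT_comp (@measurable_expeR R) mkF).
- by move=> x; exact: expeR_ge0.
- by move=> x; exact: exp_f_ge0.
- by apply: filterS fF => x fx; rewrite /exp_f fx.
- move=> y; apply: upper_integral_le => x.
  by rewrite -(exp_f_fin psi h0 k0 _ A_neq0).
- have U := upper_le_scale (expR_ge0 b) _ J_le1.
  have : upper_le mu (fun y => expR b * J y) (expR b * 1).
    by apply: U => y; rewrite mulr_ge0 ?expR_ge0// fine_ge0.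
  rewrite mulr1; apply: le_trans; apply: upper_integral_le => y.
  by rewrite /J mulrA -expRD subrr expR0 mul1r -UJ_fin.
Qed.

End step.

Lemma exp_f_bound_le n : (n <= N)%N -> exp_f_bound n.
Proof.
elim: n => [_|n IHn nN A mA]; first exact: exp_f_bound0.
have [A0|A0] := eqVneq (fine (power_probability mu n.+1 A)) 0.
  by rewrite /theta_ext A0 eqxx leey.
rewrite /theta_ext (negbTE A0) /=.
apply: exp_f_bound_step => //; first exact: IHn (ltnW nN).
by rewrite lt_neqAle eq_sym A0 fine_ge0.
Qed.

End induction.

Lemma exists_le_unit (R : realType) (gamma : R) : 0 < gamma ->
  exists2 G : R, 0 < G <= 1 & G <= gamma.
Proof.
move=> g0; exists (Num.min gamma 1); last by rewrite ge_min lexx.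
by rewrite lt_min g0 ltr01 ge_min lexx orbT.
Qed.

Theorem theorem4p4p1 (R : realType) (gamma : R) (gamma_gt0 : 0 < gamma) :
  exists2 K : R, 0 < K &
  forall (d : measure_display) (Omega : measurableType d)
    (mu : probability Omega R) (N : nat)
    (h : Omega -> Omega -> R) (psi theta xi w : R -> R),
  (1 <= N)%N ->
  measurable_fun [set: Omega * Omega] (fun p => h p.1 p.2) ->
  (forall x y, 0 <= h x y) ->
  (forall x, h x x = 0) ->
  convex_function (setT : set R) psi ->
  psi 0 = 0 ->
  (forall x, 0 <= x <= 1 -> psi x <= x ^+ 2) ->
  (forall x, 1 <= x -> x <= psi x) ->
  profile theta xi ->
  smooth_profile xi ->
  (forall b, 0 <= b -> gamma * `|xi' xi b| <= `|xi' xi (b + 1)|) ->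
  gamma <= `|derive_within `]0, 1]%classic theta 1| ->
  {in `]0, 1], forall x, 0 <= w x} ->
  {in `]0, 1] &, {homo w : x y /~ x <= y}} ->
  {in `]0, 1], forall x, w x <= theta x} ->
  gamma <= w (1 / 2) ->
  (\int[lebesgue_measure]_(u in `]0%R, 1%R]) (w u ^+ 2)%:E <= 1)%E ->
  condition_H xi w ->
  (* all functions are treated as if they were measurable *)
  (forall (n : nat) (A : set (n.-tuple Omega)), (n <= N)%N -> measurable A ->
    completed_measurable (power_probability mu n) (f_hpsi h psi A)) ->
  (forall B : set Omega, measurable B ->
    (0 < mu B)%E -> (mu B <= (1 / 2)%:E)%E ->
    (upper_integral mu (fun x => (expR (psi (hdist h x B)))%:E)
      <= (expR (w (fine (mu B))))%:E)%E) ->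
  (forall (B : set Omega) (t : R), measurable B ->
    ((1 / 2)%:E <= mu B)%E -> 1 <= t ->
    (mu_ext mu [set x | t <= psi (hdist h x B)]%R
      <= (expR (- t))%:E * (1 - mu B))%E) ->
  forall A : set (N.-tuple Omega), measurable A ->
    (upper_integral (power_probability mu N)
       (fun x => expeR ((1 / K)%:E * f_hpsi h psi A x))
     <= expeR (theta_ext theta (fine (power_probability mu N A))))%E.
Proof.
(* The estimates use gamma <= 1; passing to a smaller constant weakens every hypothesis in which
   gamma occurs. *)
have [G G01 Ggam] := exists_le_unit gamma_gt0.
have /andP[G0 G1] := G01.
have [r0 r0E] : exists r0 : R, r0 = 1 / 288 by eexists.
have r00 : 0 < r0.
  by rewrite r0E; apply: divr_gt0; [exact: ltr01|rewrite ltr0n].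
have rho0 : 0 < G * r0 / 2 by rewrite !mulr_gt0// invr_gt0.
have C40 : 0 < @cost_exp_const R.
  by apply: lt_le_trans (@cost_exp_const_ge4 R); rewrite ltr0n.
have a0 : 0 < @cost_exp_const R / G by exact: divr_gt0.
have C0 : 0 <= expR (1 / 2) * @exp_tail_const R.
  by rewrite mulr_ge0 ?expR_ge0// ltW// exp_tail_const_gt0.
have [K [eps [eta [m m1 [[K0 K1 K2 K3] [eps0 eps1 K4 [eta0 eta1 eta2 eta3]]]]]]] :=
  @constants_exist R G _ _ _ _ G0 a0 C0 r00 rho0.
exists K => //.
move=> d Omega mu N h psi theta xi w N1 mh h0 hxx cpsi psi0 psi_sqr psi_id pr sm.
move=> xi_gamma theta1 w0 wni wth wgamma w2 Hxi Hmeas Hexp Htail A mA.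
have xi_G b : 0 <= b -> G * `|xi' xi b| <= `|xi' xi (b + 1)|.
  by move=> b0; apply: le_trans (xi_gamma b b0); rewrite ler_wpM2r.
exact: (@exp_f_bound_le _ _ _ mu N h psi theta xi w G _ K eps eta _ r0 m
  G01 erefl r0E erefl m1 K0 K1 K2 K3 eps0 eps1 K4 eta0 eta1 eta2 eta3 h0 hxx
  cpsi psi0 psi_sqr psi_id pr sm xi_G w0 wni (le_trans Ggam wgamma) w2 Hxi Hmeas
  Hexp Htail N (leqnn N) A mA).
Qed.
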